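(* For every (compact) Sol $3$-manifold $M$ there is a squarefree integer $n\ge2$ such that $M$ is commensurable to the $3$-manifold $N_n$, a manifold admitting the fundamental domain $P_n$; here $N_n$ and $P_n$ are the quotient manifold and region associated with the cusp group of $\mathrm{PSL}_2(\mathbb{Z}_K)$, $K=\mathbb{Q}(\sqrt n)$, as defined in the context.
   Context: A Sol $3$-manifold is a compact $3$-manifold modelled on the Thurston geometry Sol. Two manifolds are commensurable if they have diffeomorphic finite-sheeted covers. For squarefree $n\ge2$ let $K=\mathbb{Q}(\sqrt n)\subset\mathbb{R}$, $\mathbb{Z}_K$ its ring of integers, $\sigma$ the non-trivial element of $\mathrm{Gal}(K/\mathbb{Q})$, and $\varepsilon=\min\{z\in\mathbb{Z}_K^\times:z>1\}$ the fundamental unit. The cusp group $\Delta$ (the stabilizer of $(\infty,\infty)$ in $\mathrm{PSL}_2(\mathbb{Z}_K)$, acting on the product of two upper half-planes by Möbius transformations, $\gamma(p_1,p_2)=(\gamma(p_1),\sigma(\gamma)(p_2))$) is generated by $\tau_z=\begin{pmatrix}1&z\\0&1\end{pmatrix}$ ($z\in\mathbb{Z}_K$) and $\eta_1=\begin{pmatrix}\varepsilon&0\\0&\varepsilon^{-1}\end{pmatrix}$. In the coordinates $(x_1,x_2,k)$ with $k=y_1/y_2$ of a point $(x_1+y_1i,x_2+y_2i)$ on a hypersurface $\{y_1y_2=\text{const}\}$, which is preserved by $\Delta$, the action on $\mathbb{R}^2\times(0,\infty)$ is $$\tau_z(x_1,x_2,k)=(x_1+z,\,x_2+\sigma(z),\,k),\qquad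 \eta_1(x_1,x_2,k)=(\varepsilon^2x_1,\,\varepsilon^{-2}x_2,\,\varepsilon^4k).$$ $N_n$ is the quotient $(\mathbb{R}^2\times(0,\infty))/\Delta$ (the cusp section of the Hilbert-Blumenthal surface of $K$). The region $P_n$ is the set of $(x_1,x_2,k)$ with $1\le k<\varepsilon^4$ and $$2zx_1+z^2+k^2\big(2\sigma(z)x_2+\sigma(z)^2\big)\ge0\quad\text{for all } z\in L,$$ where $L$ is the following finite list. Let $z_1=1$, and $z_1'=\sqrt n$ if $n\not\equiv1\pmod4$, $z_1'=\frac{1+\sqrt n}2$ if $n\equiv1\pmod 4$. As long as $\{z_i,z_i'\}\ne\{\varepsilon^2z_1,\varepsilon^2z_1'\}$ put $z_{i+1}=z_i+z_i'$ and let $z_{i+1}'$ be the element of $\{z_i,z_i'\}$ with smaller $|\sigma(\cdot)|$; let $m$ be the index at which this stops. Then $L=\{\pm z_1,\pm z_1',\dots,\pm z_m,\pm z_m'\}$, together with $\pm\sigma(z_1')$ if $n\equiv1\pmod4$. The side of $P_n$ on the surface $2zx_1+z^2+k^2(2\sigma(z)x_2+\sigma(z)^2)=0$ is glued by $\tau_z$ to the one for $-z$, and the faces $k=1$ and $k=\varepsilon^4$ of the closure are glued by $\eta_1$. A fundamental domain for a group $G$ acting on $X$ is a subspace $R\subset X$ whose $G$-translates cover $X$ and such that distinct translates intersect in sets with empty interior. *)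

(* Defs.v *)
From HB Require Import structures.
From mathcomp Require Import all_boot all_order all_algebra.
From mathcomp Require Import all_classical all_reals all_analysis.

Set Implicit Arguments.
Unset Strict Implicit.
Unset Printing Implicit Defensive.

Import Order.TTheory GRing.Theory Num.Theory.
Import numFieldNormedType.Exports.

Local Open Scope classical_set_scope.
Local Open Scope quotient_scope.
Local Open Scope ring_scope.

(* Only meant for an open set U: differentiability and continuity are taken
   in the ambient space. *)
Fixpoint class_C (R : realType) (V W : normedModType R) (k : nat)
    (U : set V) (f : V -> W) : Prop :=
  if k is k'.+1 then
    (forall x, U x -> differentiable f x) /\
    (forall v, class_C k' U (fun x => 'D_v f x))
  else forall x, U x -> {for x, continuous f}.

Definition class_Coo (R : realType) (V W : normedModType R)
    (U : set V) (f : V -> W) : Prop :=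
  forall k, class_C k U f.

(* The values of a chart outside its domain are irrelevant. *)
Record chart (R : realType) (M : topologicalType) := Chart {
  chart_dom : set M;
  chart_map :> M -> 'rV[R]_3 }.

Record atlas_space (R : realType) := AtlasSpace {
  carrier :> topologicalType;
  atlas : set (chart R carrier) }.
Arguments atlas {R} M _ : rename.

(* Only meant for an open set U. The function t is the coordinate expression
   d \o f \o c^-1 of f, prolonged arbitrarily outside its (open) domain. *)
Definition smooth_on (R : realType) (M N : atlas_space R) (U : set M)
    (f : M -> N) : Prop :=
  (forall x, U x -> {for x, continuous f}) /\
  forall c d, atlas M c -> atlas N d ->
    let D := U `&` chart_dom c `&` f @^-1` chart_dom d in
    exists t : 'rV[R]_3 -> 'rV[R]_3,
      class_Coo (c @` D) t /\ forall x, D x -> t (c x) = d (f x).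

Definition smooth (R : realType) (M N : atlas_space R) (f : M -> N) : Prop :=
  smooth_on setT f.

(* The equivalence says that c is a homeomorphism from its domain onto an
   open set. *)
Definition is_chart (R : realType) (M : topologicalType) (c : chart R M) :
    Prop :=
  [/\ open (chart_dom c), {in chart_dom c &, injective c} &
      forall A, A `<=` chart_dom c -> open A <-> open (c @` A)].

(* Smoothness of the identity is smoothness of all the changes of charts. *)
Definition manifold (R : realType) (M : atlas_space R) : Prop :=
  [/\ hausdorff_space M, @second_countable M,
      forall c, atlas M c -> is_chart c,
      forall x, exists2 c, atlas M c & chart_dom c x
    & smooth (fun x : M => x)].

Definition diffeomorphic (R : realType) (M N : atlas_space R) : Prop :=
  exists (f : M -> N) (g : N -> M),
    [/\ cancel f g, cancel g f, smooth f & smooth g].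

(* U is evenly covered by the k sheets s i @` U, on each of which p is
   a diffeomorphism onto U with inverse s i. *)
Definition finite_sheeted_cover (R : realType) (M' M : atlas_space R)
    (p : M' -> M) : Prop :=
  [/\ smooth p, forall y, exists x, p x = y
    & forall y, exists (U : set M) (k : nat) (s : 'I_k -> M -> M'),
      [/\ open U, U y,
          forall i, [/\ smooth_on U (s i), open (s i @` U) &
                        forall u, U u -> p (s i u) = u],
          trivIset setT (fun i => s i @` U)
        & p @^-1` U = \bigcup_i (s i @` U)]].

Definition commensurable (R : realType) (M N : atlas_space R) : Prop :=
  exists (M' N' : atlas_space R) (p : M' -> M) (q : N' -> N),
    [/\ manifold M', manifold N', finite_sheeted_cover p,
        finite_sheeted_cover q & diffeomorphic M' N'].

Record transf_group (X : Type) := TransfGroup {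
  transf :> set (X -> X);
  transf_id : transf id;
  transf_comp : forall f g, transf f -> transf g -> transf (f \o g);
  transf_inv : forall f, transf f ->
    exists2 g, transf g & cancel f g /\ cancel g f }.

Section Orbits.
Variables (X : Type) (G : transf_group X).

Definition orbit_rel : rel X :=
  fun x y => `[< exists2 g, transf G g & g x = y >].

Lemma orbit_rel_refl : reflexive orbit_rel.
Proof. by move=> x; apply/asboolP; exists id => //; exact: transf_id. Qed.

Lemma orbit_rel_sym : symmetric orbit_rel.
Proof.
suff H x y : orbit_rel x y -> orbit_rel y x by move=> x y; apply/idP/idP => /H.
move=> /asboolP[g Gg <-]; have [h Gh [gK _]] := transf_inv Gg.
by apply/asboolP; exists h => //; exact: gK.
Qed.

Lemma orbit_rel_trans : transitive orbit_rel.
Proof.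
move=> y x z /asboolP[g Gg <-] /asboolP[h Gh <-].
by apply/asboolP; exists (h \o g) => //; exact: transf_comp.
Qed.

Definition orbit_equiv : equiv_rel X :=
  EquivRel orbit_rel orbit_rel_refl orbit_rel_sym orbit_rel_trans.

End Orbits.

Definition orbit_space (X : topologicalType) (G : transf_group X) :
    topologicalType :=
  quotient_topology {eq_quot orbit_equiv G}.

Definition orbit_proj (X : topologicalType) (G : transf_group X) (x : X) :
    orbit_space G :=
  \pi_{eq_quot orbit_equiv G} x.

(* The charts of X/G are the charts of X, restricted to open sets on which
   the projection to X/G is injective. *)
Definition quotient (R : realType) (X : atlas_space R) (G : transf_group X) :
    atlas_space R :=
  @AtlasSpace R (orbit_space G)
    [set c | exists (d : chart R X) (V : set X),
      [/\ atlas X d, open V /\ V `<=` chart_dom d,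
          {in V &, injective (@orbit_proj X G)},
          chart_dom c = @orbit_proj X G @` V
        & forall x, V x -> c (orbit_proj G x) = d x]].

Definition acts_freely (X : Type) (G : set (X -> X)) : Prop :=
  forall g x, G g -> g x = x -> g = id.

Definition acts_properly_discontinuously (X : topologicalType)
    (G : set (X -> X)) : Prop :=
  forall K, compact K -> finite_set [set g | G g /\ g @` K `&` K !=set0].

(* Different elements of G must have almost disjoint translates. Asking this
   only for translates that differ as sets would make P = X a fundamental
   domain of any G. *)
Definition fundamental_domain (X : topologicalType) (G : set (X -> X))
    (P : set X) : Prop :=
  (forall x, exists2 g, G g & (g @` P) x) /\
  (forall g h, G g -> G h -> g <> h -> interior (g @` P `&` h @` P) = set0).

Inductive generated (X : Type) (S : set (X -> X)) : set (X -> X) :=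
| generated_gen f : S f -> generated S f
| generated_id : generated S id
| generated_comp f g : generated S f -> generated S g -> generated S (f \o g)
| generated_inv f g : generated S f -> cancel f g -> cancel g f ->
    generated S g.

Lemma generated_bij (X : Type) (S : set (X -> X)) :
  S `<=` [set f | bijective f] -> generated S `<=` [set f | bijective f].
Proof.
move=> Sbij f; elim=> {f} [f /Sbij//||f g _ bf _ bg|f g _ _ fK gK] /=.
- by exists id.
- exact: bij_comp.
- by exists f.
Qed.

Lemma generated_has_inv (X : Type) (S : set (X -> X)) :
  S `<=` [set f | bijective f] -> forall f, generated S f ->
  exists2 g, generated S g & cancel f g /\ cancel g f.
Proof.
move=> Sbij f Sf; have [g fK gK] := generated_bij Sbij Sf.
by exists g => //; exact: generated_inv Sf fK gK.
Qed.

Definition generated_group (X : Type) (S : set (X -> X))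
    (Sbij : S `<=` [set f | bijective f]) : transf_group X :=
  TransfGroup (@generated_id X S) (@generated_comp X S)
    (generated_has_inv Sbij).

Definition i1 : 'I_3 := @Ordinal 3 0 isT.
Definition i2 : 'I_3 := @Ordinal 3 1 isT.
Definition i3 : 'I_3 := @Ordinal 3 2 isT.

Definition vec3 (R : realType) (a b c : R) : 'rV[R]_3 :=
  \row_j [:: a; b; c]`_j.

Lemma vec3E (R : realType) (a b c : R) :
  (vec3 a b c 0 i1 = a) * (vec3 a b c 0 i2 = b) * (vec3 a b c 0 i3 = c).
Proof. by rewrite /vec3 !mxE. Qed.

Lemma vec3_eta (R : realType) (x : 'rV[R]_3) :
  vec3 (x 0 i1) (x 0 i2) (x 0 i3) = x.
Proof.
apply/rowP => -[[|[|[|//]]] j3]; rewrite mxE /=;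
  by congr (x _ _); apply: val_inj.
Qed.

Definition Sol (R : realType) : atlas_space R :=
  @AtlasSpace R 'rV[R]_3 [set Chart setT id].

(* The inner product of u and v at p for e^(-2z)dx^2 + e^(2z)dy^2 + dz^2, which
   is invariant under the left translations of the group law
   (x, y, z)(x', y', z') = (x + e^z x', y + e^(-z) y', z + z'). *)
Definition sol_metric (R : realType) (p u v : 'rV[R]_3) : R :=
  expR (- (2 * p 0 i3)) * (u 0 i1 * v 0 i1) +
  expR (2 * p 0 i3) * (u 0 i2 * v 0 i2) + u 0 i3 * v 0 i3.

Definition sol_isometry (R : realType) (f : Sol R -> Sol R) : Prop :=
  (exists g : Sol R -> Sol R,
     [/\ cancel f g, cancel g f, smooth f & smooth g]) /\
  forall p u v : 'rV[R]_3,
    sol_metric (f p) ('D_u (f : 'rV[R]_3 -> 'rV[R]_3) p)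
                     ('D_v (f : 'rV[R]_3 -> 'rV[R]_3) p)
    = sol_metric p u v.

Definition compact_sol_manifold (R : realType) (M : atlas_space R) : Prop :=
  [/\ manifold M, compact [set: M]
    & exists G : transf_group (Sol R),
      [/\ forall g, transf G g -> sol_isometry g, acts_freely G,
          acts_properly_discontinuously G & diffeomorphic M (quotient G)]].

Definition squarefree (n : nat) : Prop :=
  forall d : nat, (d ^ 2 %| n)%N -> d = 1%N.

Section QuadraticField.
Variables (R : realType) (n : nat).

Let sqrtn : R := Num.sqrt n%:R.

Definition quad_field : set R :=
  [set z | exists a b : rat, z = ratr a + ratr b * sqrtn].

Definition quad_int : set R :=
  [set z | quad_field z /\ integralOver (intr : int -> R) z].

(* Unspecified outside K. *)
Definition conjq (z : R) : R :=
  get [set w | exists a b : rat,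
    z = ratr a + ratr b * sqrtn /\ w = ratr a - ratr b * sqrtn].

Definition quad_unit : set R :=
  [set z | quad_int z /\ exists2 w, quad_int w & z * w = 1].

(* The default value 2 is only used when there is no fundamental unit, which
   does not happen when n >= 2 is squarefree. *)
Definition fund_unit : R :=
  xget 2 [set e | [/\ quad_unit e, 1 < e &
                      forall z, quad_unit z -> 1 < z -> e <= z]].

Lemma fund_unit_gt1 : 1 < fund_unit.
Proof. by rewrite /fund_unit; case: xgetP => [e _ []|_] //; rewrite ltr1n. Qed.

Let eps_gt0 : 0 < fund_unit := lt_trans ltr01 fund_unit_gt1.
Let eps_neq0 : fund_unit != 0 := lt0r_neq0 eps_gt0.

(* The coordinates are (x1, x2, k). *)
Definition upper : set 'rV[R]_3 := [set p | 0 < p 0 i3].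

Definition cusp_space : atlas_space R :=
  @AtlasSpace R (set_type upper) [set Chart setT set_val].

Lemma upper_gt0 (p : cusp_space) : 0 < set_val p 0 i3.
Proof. exact: (set_mem (valP p)). Qed.

Section Affine.
Variables (a b c u v : R) (c0 : 0 < c).

Let affine (x : 'rV[R]_3) : 'rV[R]_3 :=
  vec3 (a * x 0 i1 + u) (b * x 0 i2 + v) (c * x 0 i3).

Lemma affine_upper_subproof (p : cusp_space) : affine (set_val p) \in upper.
Proof.
by apply/mem_set; rewrite /upper/= /affine vec3E mulr_gt0// upper_gt0.
Qed.

(* The common form of tau_z and eta_1. *)
Definition affine_upper (p : cusp_space) : cusp_space :=
  exist _ (affine (set_val p)) (affine_upper_subproof p).

End Affine.

Definition tau (z : R) : cusp_space -> cusp_space :=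
  @affine_upper 1 1 1 z (conjq z) ltr01.

Definition eta : cusp_space -> cusp_space :=
  @affine_upper (fund_unit ^+ 2) (fund_unit ^- 2) (fund_unit ^+ 4) 0 0
    (exprn_gt0 4 eps_gt0).

Lemma affine_upper_bij (a b c u v : R) (c0 : 0 < c) :
  a != 0 -> b != 0 -> bijective (@affine_upper a b c u v c0).
Proof.
move=> a0 b0; have c'0 : 0 < c^-1 by rewrite invr_gt0.
have cn0 : c != 0 by rewrite gt_eqF.
exists (@affine_upper a^-1 b^-1 c^-1 (- (a^-1 * u)) (- (b^-1 * v)) c'0) => p;
  apply: val_inj; rewrite /= !set_valE /= !vec3E -[RHS]vec3_eta.
- by rewrite !mulrDr !addrK !mulKf.
- by rewrite !mulrBr !mulVKf// !subrK.
Qed.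

Definition cusp_gens : set (cusp_space -> cusp_space) :=
  [set g | (exists2 z, quad_int z & g = tau z) \/ g = eta].

Lemma cusp_gens_bij : cusp_gens `<=` [set g | bijective g].
Proof.
move=> g [[z _ ->]|->]; apply: affine_upper_bij; rewrite ?oner_eq0//.
- by rewrite expf_neq0.
- by rewrite invr_eq0 expf_neq0.
Qed.

Definition cusp_group : transf_group cusp_space :=
  generated_group cusp_gens_bij.

Definition cusp_section : atlas_space R := quotient cusp_group.

(* The starting value z'_1. *)
Definition omega : R :=
  if (n %% 4 == 1)%N then (1 + sqrtn) / 2 else sqrtn.

(* (z_{i+1}, z'_{i+1}), without the stopping condition. *)
Fixpoint zpair (i : nat) : R * R :=
  if i is j.+1 then
    let: (z, z') := zpair j in
    (z + z', if `|conjq z| < `|conjq z'| then z else z')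
  else (1, omega).

Definition stops (i : nat) : Prop :=
  [set (zpair i).1; (zpair i).2] =
  [set fund_unit ^+ 2 * 1; fund_unit ^+ 2 * omega].

Definition stop_index (m : nat) : Prop :=
  stops m /\ forall i, (i < m)%N -> ~ stops i.

Definition Llist : set R :=
  [set z | (exists m i, [/\ stop_index m, (i <= m)%N &
              exists2 w, w = (zpair i).1 \/ w = (zpair i).2 &
                         z = w \/ z = - w])
        \/ (n %% 4 == 1)%N /\ (z = conjq omega \/ z = - conjq omega)].

Definition region : set cusp_space :=
  [set p : cusp_space | let x1 := set_val p 0 i1 in let x2 := set_val p 0 i2 in
           let k := set_val p 0 i3 in
     1 <= k < fund_unit ^+ 4 /\
     forall z, Llist z ->
       0 <= 2 * z * x1 + z ^+ 2
            + k ^+ 2 * (2 * conjq z * x2 + conjq z ^+ 2)].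

End QuadraticField.

(* Main.v *)
Require Import Defs.
From HB Require Import structures.
From mathcomp Require Import all_boot all_order all_algebra.
From mathcomp Require Import all_classical all_reals all_analysis.
From mathcomp Require Import lra zify.

Set Implicit Arguments.
Unset Strict Implicit.
Unset Printing Implicit Defensive.

Import Order.TTheory GRing.Theory Num.Theory.
Import numFieldNormedType.Exports.

Local Open Scope classical_set_scope.
Local Open Scope ring_scope.

(* An isometry of Sol maps (x, y, z) to (u, v, h) with |grad h| = 1. Since h has
   vanishing Laplacian and Hessian of constant norm, Bochner's formula forces
   h = +-z + c, and the isometry is affine in x and y: (x, y, z) goes to
   (+-e^c x + a, +-e^(-c) y + b, z + c), or to the same with x and y exchanged
   and -z + c. A cocompact discrete group G of such isometries contains an
   element g with c > 0 that acts diagonally about some axis, and a translation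
   w = (p, q, 0) with p q <> 0. The translations in G form a discrete set stable
   under g, so by a pigeonhole argument on the vectors g^k w the trace t = mu + 1/mu
   of g, mu = e^c, is an integer. Hence mu is a unit of the quadratic field of
   discriminant t^2 - 4, a power of its fundamental unit, and the group generated
   by Z[mu] w and g^2 is both a subgroup of G and, after an affine change of
   coordinates, of the cusp group. It is cocompact, so of finite index in both.

   The region is a Dirichlet domain: on the slice k, translations act as a lattice
   for the norm x1^2 + k^2 x2^2, and the inequalities given by the six vectors of
   an obtuse superbase imply those of the whole lattice (Selling). The pairs
   (z_i, z'_i) are the bases of Z_K formed by a subtractive Euclidean algorithm; it
   ends because eps^2 (1, omega) has nonnegative coordinates in (1, omega). *)

(** * Smooth functions *)

(** An isometry is given here only as a smooth map with smooth inverse preserving [sol_metric], so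
    its normal form is derived from partial derivatives of its three coordinates, up to order three
    for the height. The square of [g] is taken because a cusp group element scales [x1] by an even
    power of [eps], whereas [mu = eps ^+ j] with [j] possibly odd. The unit [mu] also stands in for
    Pell's equation: it provides a unit greater than 1 in the field at hand, from which the
    existence of the fundamental unit follows by discreteness. The slice norm [x1^2 + k^2 x2^2] is,
    up to scale, the product hyperbolic metric [dx1^2 / y1^2 + dx2^2 / y2^2], since [k = y1 / y2];
    matching it with [e^(-2z) dx^2 + e^(2z) dy^2] gives [k = e^(2z)] for the passage from Sol to the
    cusp space. The domain cannot use one reduced basis of the integers for all [k]: the reduced
    basis changes with [k], and the list [L] collects those met while [k] runs through one period of
    [eta]. *)

Section ClassC.
Variables (R : realType).
Implicit Types (V W : normedModType R).

Lemma class_C_sub V W k (U U' : set V) (f : V -> W) :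
  U' `<=` U -> class_C k U f -> class_C k U' f.
Proof.
move=> sU; elim: k f => [|k IH] f /=; first by move=> h x /sU /h.
by move=> [h1 h2]; split => [x /sU /h1//|v]; exact: IH.
Qed.

(** Derivatives are taken in the ambient space, so regularity on a set is a conjunction over its
    points. A singleton, although not open, can then stand for a germ. *)
Lemma class_C_pointwise V W k (U : set V) (f : V -> W) :
  (forall x, U x -> class_C k [set x] f) -> class_C k U f.
Proof.
elim: k f => [|k IH] f /= h; first by move=> x /h; exact.
split=> [x /h [+ _]|v]; first exact.
by apply: IH => x /h [_]; exact.
Qed.

(** The zero linear map gives the expansion at [x]. Invariance of differentiability under equality
    of germs follows by adding [g - f]. *)
Lemma near0_differentiable V W (f : V -> W) x :
  (\forall y \near x, f y = 0) -> differentiable f x.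
Proof.
move=> f0; have fx := nbhs_singleton f0.
have h : f \o shift x = cst (f x) + (\0 : {linear V -> W}) +o_ 0 id.
  apply/eqaddoP => _/posnumP[e].
  have := f0; rewrite (near_shift 0 x) /= subr0 => H.
  near=> y; rewrite !fctE /= fx.
  have -> : f (y + x) = 0 by apply: (near H y).
  by rewrite addr0 subrr normr0 mulr_ge0.
have c0 : continuous (\0 : {linear V -> W}) by move=> y; exact: cvg_cst.
by apply/diff_locallyP; rewrite (diff_unique c0 h).
Unshelve. all: by end_near. Qed.

Lemma near_eq_differentiable V W (f g : V -> W) x :
  (\forall y \near x, f y = g y) -> differentiable f x -> differentiable g x.
Proof.
move=> fg df; have -> : g = f + (g - f) by rewrite addrC subrK.
apply: differentiableD => //; apply: near0_differentiable.
by near=> y; rewrite !fctE; apply/eqP; rewrite subr_eq0 eq_sym; apply/eqP; near: y.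
Unshelve. all: by end_near. Qed.

Lemma class_C_near V W k x (f g : V -> W) :
  (\forall y \near x, f y = g y) -> class_C k [set x] f -> class_C k [set x] g.
Proof.
elim: k f g => [|k IH] f g /= fg.
  move=> h _ ->; have cf := h x erefl.
  change (g @ x --> g x); rewrite -(nbhs_singleton fg).
  by apply: cvg_trans cf; apply: near_eq_cvg.
move=> [h1 h2]; split=> [_ ->|v].
  exact: near_eq_differentiable (h1 x erefl).
apply: IH (h2 v).
(* Equality of germs at [x] is equality of germs at all nearby [y], so directional derivatives again
   agree near [x]. *)
have : \forall y \near x, \forall z \near y, f z = g z by exact/near_join.
by apply: filterS => y /near_eq_derive.
Qed.

Lemma class_C_eqon V W k (U : set V) (f g : V -> W) : open U ->
  (forall x, U x -> f x = g x) -> class_C k U f -> class_C k U g.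
Proof.
move=> oU fg cf; apply: class_C_pointwise => x Ux.
apply: (@class_C_near _ _ _ _ f); last by apply: class_C_sub cf => _ ->.
by have : nbhs x U by [exact: open_nbhs_nbhs]; exact: filterS.
Qed.

Lemma class_CW V W k (U : set V) (f : V -> W) :
  class_C k.+1 U f -> class_C k U f.
Proof.
elim: k f => [|k IH] f; first by move=> [h _] x /h /differentiable_continuous.
by move=> [h1 h2]; split=> // v; apply: IH; exact: h2.
Qed.

Lemma class_C_cst V W k (U : set V) (c : W) : class_C k U (cst c).
Proof.
elim: k c => [|k IH] c; first by move=> x _; exact: cst_continuous.
split=> [x _|v]; first exact: differentiable_cst.
have -> : (fun x : V => 'D_v (cst c) x) = cst 0 by apply/funext => x; rewrite derive_cst.
exact: IH.
Qed.

Lemma class_CD V W k (U : set V) (f g : V -> W) : open U ->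
  class_C k U f -> class_C k U g -> class_C k U (f \+ g).
Proof.
move=> oU; elim: k f g => [|k IH] f g.
  by move=> cf cg x Ux; apply: continuousD; [exact: cf|exact: cg].
move=> [df cf] [dg cg]; split=> [x Ux|v].
  by apply: differentiableD; [exact: df|exact: dg].
apply: class_C_eqon (IH _ _ (cf v) (cg v)) => // x Ux.
by rewrite deriveD//; apply: diff_derivable; [exact: df|exact: dg].
Qed.

Lemma class_CM V k (U : set V) (f g : V -> R) : open U ->
  class_C k U f -> class_C k U g -> class_C k U (f \* g).
Proof.
move=> oU; elim: k f g => [|k IH] f g.
  by move=> cf cg x Ux; apply: continuousM; [exact: cf|exact: cg].
move=> cf0 cg0; have [df cf] := cf0; have [dg cg] := cg0; split=> [x Ux|v].
  by apply: differentiableM; [exact: df|exact: dg].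
apply: class_C_eqon (class_CD oU (IH _ _ (class_CW cf0) (cg v))
   (IH _ _ (class_CW cg0) (cf v))) => // x Ux.
by rewrite deriveM//; apply: diff_derivable; [exact: df|exact: dg].
Qed.

Lemma class_C_sum V k (U : set V) n (f : 'I_n -> V -> R) : open U ->
  (forall i, class_C k U (f i)) -> class_C k U (fun x => \sum_i f i x).
Proof.
move=> oU; elim: n f => [|n IH] f cf.
  have -> : (fun x => \sum_i f i x) = cst 0.
    by apply/funext => x; rewrite big_ord0.
  exact: class_C_cst.
have -> : (fun x => \sum_i f i x) =
    (f ord0 \+ (fun x => \sum_i f (lift ord0 i) x)).
  by apply/funext => x; rewrite big_ord_recl.
by apply: class_CD => //; exact: IH.
Qed.

Lemma class_CM_cst V k (U : set V) (c : R) (f : V -> R) : open U ->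
  class_C k U f -> class_C k U (fun x => c * f x).
Proof. by move=> oU; apply: class_CM => //; exact: class_C_cst. Qed.

Lemma rowE n (x : 'rV[R]_n) : x = \sum_j x 0 j *: delta_mx 0 j.
Proof. exact: row_sum_delta. Qed.

Lemma differentiable_rV V n (f : V -> 'rV[R]_n) x :
  (forall j, differentiable (fun y => f y 0 j) x) -> differentiable f x.
Proof.
move=> h; have -> : f = \sum_j (fun y => f y 0 j *: delta_mx 0 j).
  by apply/funext => y; rewrite fct_sumE -rowE.
by apply: differentiable_sum => j; exact: differentiableZl.
Qed.

Lemma derive_coord V n (f : V -> 'rV[R]_n) x v j :
  derivable f x v -> ('D_v f x) 0 j = 'D_v (fun y => f y 0 j) x.
Proof. by move=> /derive_mx ->; rewrite mxE. Qed.

Lemma cvg_rV T (F : set_system T) {FF : Filter F} n (f : T -> 'rV[R]_n) (l : 'rV[R]_n) :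
  (forall j, f x 0 j @[x --> F] --> l 0 j) -> f @ F --> l.
Proof.
move=> h; apply/cvgrPdist_le => /= e e0; near=> x.
rewrite /Num.Def.normr/= mx_normrE (bigmax_le _ (ltW e0))//= => -[i j] _ /=.
rewrite !mxE ord1; move: j; near: x; apply: filter_forall => j.
exact: ((cvgrPdist_le _ _).1 (h j)).
Unshelve. all: by end_near. Qed.

Lemma continuous_rV (T : topologicalType) n (f : T -> 'rV[R]_n) x :
  (forall j, {for x, continuous (fun y => f y 0 j)}) -> {for x, continuous f}.
Proof. by move=> h; apply: cvg_rV => j; exact: h. Qed.

Lemma class_C_rV V k (U : set V) n (f : V -> 'rV[R]_n) : open U ->
  (forall j, class_C k U (fun x => f x 0 j)) -> class_C k U f.
Proof.
move=> oU; elim: k f => [|k IH] f cf.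
  by move=> x Ux; apply: continuous_rV => j; exact: cf.
have df x : U x -> differentiable f x.
  by move=> Ux; apply: differentiable_rV => j; case: (cf j) => + _; exact.
split=> // v; apply: IH => j; case: (cf j) => _ /(_ v).
apply: class_C_eqon => // x Ux; rewrite derive_coord//; exact/diff_derivable/df.
Qed.

Lemma class_C_coord V k (U : set V) n (f : V -> 'rV[R]_n) j : open U ->
  class_C k U f -> class_C k U (fun x => f x 0 j).
Proof.
move=> oU; elim: k f => [|k IH] f.
  move=> cf x Ux; apply: (@continuous_comp _ _ _ f (fun y : 'rV[R]_n => y 0 j)).
    exact: cf.
  exact: coord_continuous.
move=> [df cf]; split=> [x Ux|v].
  apply: (@differentiable_comp _ _ _ _ f (fun y : 'rV[R]_n => y 0 j)).
    exact: df.
  exact: differentiable_coord.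
apply: class_C_eqon (IH _ (cf v)) => // x Ux.
by rewrite derive_coord//; exact/diff_derivable/df.
Qed.

Lemma derive_comp_rV V n (f : 'rV[R]_n -> R) (g : V -> 'rV[R]_n) x v :
  differentiable g x -> differentiable f (g x) ->
  'D_v (f \o g) x = \sum_j 'D_v (fun y => g y 0 j) x * 'D_(delta_mx 0 j) f (g x).
Proof.
move=> dg df; rewrite deriveE; last exact: differentiable_comp.
rewrite diff_comp//= [X in 'd f _ X]rowE linear_sum; apply: eq_bigr => j _.
by rewrite linearZ/= -!deriveE// derive_coord//; exact: diff_derivable.
Qed.

(** By the chain rule in coordinates, a directional derivative of the composite is a sum of products
    whose factors have one order of regularity less, which closes the induction. *)
Lemma class_C_comp_scalar V n k (U : set V) (W : set 'rV[R]_n)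
    (f : 'rV[R]_n -> R) (g : V -> 'rV[R]_n) : open U ->
  (forall x, U x -> W (g x)) ->
  class_C k W f -> class_C k U g -> class_C k U (f \o g).
Proof.
move=> oU UW; elim: k f g UW => [|k IH] f g UW.
  by move=> cf cg x Ux; apply: continuous_comp; [exact: cg|exact/cf/UW].
move=> [df cf] cg0; have [dg cg] := cg0; split=> [x Ux|v].
  by apply: differentiable_comp; [exact: dg|exact/df/UW].
pose h x := \sum_j 'D_v (fun y => g y 0 j) x * 'D_(delta_mx 0 j) f (g x).
apply: (@class_C_eqon _ _ _ _ h) => // [x Ux|].
  by rewrite derive_comp_rV//; [exact: dg|exact/df/UW].
apply: class_C_sum => // j; apply: class_CM => //.
  by have [_] := class_C_coord j oU cg0; exact.
exact: (IH ('D_(delta_mx 0 j) f) g UW (cf _) (class_CW cg0)).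
Qed.

Lemma class_C_comp V n m k (U : set V) (W : set 'rV[R]_n)
    (f : 'rV[R]_n -> 'rV[R]_m) (g : V -> 'rV[R]_n) : open U -> open W ->
  (forall x, U x -> W (g x)) ->
  class_C k W f -> class_C k U g -> class_C k U (f \o g).
Proof.
move=> oU oW UW cf cg; apply: class_C_rV => // j.
exact: (class_C_comp_scalar oU UW (class_C_coord j oW cf) cg).
Qed.

Lemma derive_comp1 V (f : R -> R) (g : V -> R) x v (f' : R) :
  differentiable g x -> is_derive (g x) 1 f f' ->
  differentiable (f \o g) x /\ 'D_v (f \o g) x = f' * 'D_v g x.
Proof.
move=> dg [/derivable1_diffP df <-]; have dfg := differentiable_comp dg df.
split=> //; rewrite deriveE// diff_comp//= (deriveE v dg) diff1E//.
by rewrite derive1E mulrC.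
Qed.

Lemma class_C_expR V k (U : set V) (g : V -> R) : open U ->
  class_C k U g -> class_C k U (expR \o g).
Proof.
move=> oU; elim: k g => [|k IH] g.
  by move=> cg x Ux; apply: continuous_comp; [exact: cg|exact: continuous_expR].
move=> cg0; have [dg cg] := cg0; split=> [x Ux|v].
  by have [] := derive_comp1 0 (dg x Ux) (is_derive_expR _).
apply: class_C_eqon (class_CM oU (IH _ (class_CW cg0)) (cg v)) => // x Ux.
by have [_ ->] := derive_comp1 v (dg x Ux) (is_derive_expR _).
Qed.

Lemma is_deriveV1 (y : R) : y != 0 -> is_derive y 1 (@GRing.inv R) (- y^-1 ^+ 2).
Proof.
move=> y0; have d : derivable id y (1 : R) by exact: derivable_id.
apply: DeriveDef; first exact: (@derivableV _ _ id).
by rewrite (@deriveV _ _ id)// derive_id exprVn [_ *: _]mulr1.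
Qed.

Lemma class_CV V k (U : set V) (g : V -> R) : open U ->
  (forall x, U x -> g x != 0) ->
  class_C k U g -> class_C k U (@GRing.inv R \o g).
Proof.
move=> oU g0; elim: k => [|k IH].
  by move=> cg x Ux; apply: cvgV; [exact: g0|exact: cg].
move=> cg0; have [dg cg] := cg0; split=> [x Ux|v].
  by have [] := derive_comp1 0 (dg x Ux) (is_deriveV1 (g0 x Ux)).
have cV := IH (class_CW cg0).
have c := class_CM_cst (-1) oU (class_CM oU (class_CM oU cV cV) (cg v)).
apply: class_C_eqon c => // x Ux; have [_ ->] := derive_comp1 v (dg x Ux) (is_deriveV1 (g0 x Ux)).
by rewrite /= expr2 mulN1r mulNr.
Qed.

Lemma class_C_ln V k (U : set V) (g : V -> R) : open U ->
  (forall x, U x -> 0 < g x) ->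
  class_C k U g -> class_C k U (@ln R \o g).
Proof.
(* A case analysis is enough: the derivative of [ln] is the inverse, which [class_CV] handles at
   every order. *)
move=> oU g0; case: k => [|k].
  move=> cg x Ux; apply: continuous_comp; first exact: cg.
  by apply: continuous_ln; exact: g0.
move=> cg0; have [dg cg] := cg0; split=> [x Ux|v].
  by have [] := derive_comp1 0 (dg x Ux) (is_derive1_ln (g0 x Ux)).
have cV : class_C k U (@GRing.inv R \o g).
  by apply: class_CV (class_CW cg0) => // x /g0; rewrite lt0r => /andP[].
apply: class_C_eqon (class_CM oU cV (cg v)) => // x Ux.
by have [_ ->] := derive_comp1 v (dg x Ux) (is_derive1_ln (g0 x Ux)).
Qed.

Lemma class_C_id V k (U : set V) : class_C k U (@id V).
Proof.
case: k => [|k]; first by move=> x _; exact: cvg_id.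
split=> [x _|v]; first exact: ex_diff.
have -> : (fun x : V => 'D_v id x) = cst v by apply/funext => x; rewrite derive_id.
exact: class_C_cst.
Qed.

End ClassC.

(** * Symmetry of second derivatives *)

Section Schwarz.
Variables (R : realType) (V : normedModType R).

Lemma is_derive_line (f : V -> R) (x v : V) (s : R) :
  differentiable f (x + s *: v) ->
  is_derive s 1 (fun s => f (x + s *: v)) ('D_v f (x + s *: v)).
Proof.
move=> df; pose l (s : R) : V := x + s *: v.
have dl : is_derive s 1 l v.
  have -> : l = cst x + (fun s : R => s *: v) by apply/funext.
  apply: DeriveDef.
    apply: derivableD; first exact: derivable_cst.
    apply: diff_derivable; exact: differentiableZl.
  rewrite deriveD; last 2 first.
  - exact: derivable_cst.
  - by apply: diff_derivable; exact: differentiableZl.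
  rewrite derive_cst add0r deriveE; last exact: differentiableZl.
  by rewrite diff_val scale1r.
have dl' : differentiable l s.
  by apply: differentiableD => //; exact: differentiableZl.
apply: DeriveDef.
  by apply: diff_derivable; exact: (@differentiable_comp _ _ _ _ l f).
rewrite -[LHS]/('D_1 (f \o l) s) deriveE; last exact: differentiable_comp.
by rewrite diff_comp//= -[X in 'd f _ X]deriveE// derive_val deriveE.
Qed.

(** Mean value theorem twice: along [u] for the increment of [f] in direction [h *: v], then along
    [v] for ['D_u f]. *)
Lemma second_difference (f : V -> R) (x u v : V) (h : R) : 0 < h ->
  (forall y, differentiable f y) -> (forall y, differentiable ('D_u f) y) ->
  exists s t, [/\ 0 <= s <= h, 0 <= t <= h &
  (f (x + h *: u + h *: v) - f (x + h *: u)) - (f (x + h *: v) - f x) =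
  h ^+ 2 * 'D_v ('D_u f) (x + s *: u + t *: v)].
Proof.
move=> h0 df ddf.
pose p s := f (x + h *: v + s *: u) - f (x + s *: u).
pose p' s := 'D_u f (x + h *: v + s *: u) - 'D_u f (x + s *: u).
have dp s : is_derive s (1 : R) p (p' s).
  by apply: is_deriveB; exact: is_derive_line.
have [s sh ps] : exists2 s, s \in `]0, h[ & p h - p 0 = p' s * (h - 0).
  apply: MVT => // s; apply: continuous_subspaceT => {}s.
  by apply: differentiable_continuous; apply/derivable1_diffP; case: (dp s).
pose q t := 'D_u f (x + s *: u + t *: v).
have dq t : is_derive t (1 : R) q ('D_v ('D_u f) (x + s *: u + t *: v)).
  exact: is_derive_line.
have [t th qt] : exists2 t, t \in `]0, h[ & q h - q 0 = 'D_v ('D_u f) (x + s *: u + t *: v) * (h - 0).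
  apply: MVT => // t; apply: continuous_subspaceT => {}t.
  by apply: differentiable_continuous; apply/derivable1_diffP; case: (dq t).
exists s, t; split.
- by move: sh; rewrite in_itv/= => /andP[/ltW -> /ltW ->].
- by move: th; rewrite in_itv/= => /andP[/ltW -> /ltW ->].
move: ps; rewrite /p /p' !scale0r !addr0 subr0 (addrAC x (h *: u)) => ->.
move: qt; rewrite /q !scale0r !addr0 subr0 (addrAC x (h *: v)) => ->.
by rewrite expr2; lra.
Qed.

(** The second difference is symmetric in [u] and [v], so the two iterated derivatives take a common
    value at two points arbitrarily close to [x]; both are continuous there. *)
Lemma derive_swap (f : V -> R) (u v x : V) : class_C 2 setT f ->
  'D_v ('D_u f) x = 'D_u ('D_v f) x.
Proof.
move=> [df /[dup] /(_ u)[ddu cu] /(_ v)[ddv cv]].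
have {}df y : differentiable f y by exact: df.
have {}ddu y : differentiable ('D_u f) y by exact: ddu.
have {}ddv y : differentiable ('D_v f) y by exact: ddv.
apply/eqP; rewrite -subr_eq0 -normr_le0; apply/ler_addgt0Pl => e e0; rewrite addr0.
have e2 : 0 < e / 2 by rewrite divr_gt0.
have /cvgrPdist_lt /(_ _ e2) /nbhs_ballP[r1 /= r10 c1] := cu v x I.
have /cvgrPdist_lt /(_ _ e2) /nbhs_ballP[r2 /= r20 c2] := cv u x I.
pose r := Num.min r1 r2; have r0 : 0 < r by rewrite lt_min r10.
pose N := `|u| + `|v| + 1; have N0 : 0 < N by rewrite ltr_wpDl// addr_ge0.
pose h := r / N; have h0 : 0 < h by rewrite divr_gt0.
have near s t : 0 <= s <= h -> 0 <= t <= h -> `|x - (x + s *: u + t *: v)| < r.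
  move=> /andP[s0 sh] /andP[t0 th]; rewrite -addrA opprD addrA subrr sub0r normrN.
  apply: le_lt_trans (ler_normD _ _) _; rewrite !normrZ (ger0_norm s0) (ger0_norm t0).
  apply: (@le_lt_trans _ _ (h * `|u| + h * `|v|)).
    by apply: lerD; apply: ler_wpM2r.
  by rewrite -mulrDr /h mulrAC ltr_pdivrMr// ltr_pM2l// /N ltrDl.
have [s [t [sh th E1]]] := @second_difference f x u v h h0 df ddu.
have [s' [t' [sh' th' E2]]] := @second_difference f x v u h h0 df ddv.
have h2 : h ^+ 2 != 0 by rewrite expf_neq0// gt_eqF.
have E : 'D_v ('D_u f) (x + s *: u + t *: v) = 'D_u ('D_v f) (x + s' *: v + t' *: u).
  apply: (mulfI h2); rewrite -E1 -E2 (addrAC x (h *: v)).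
  by rewrite opprB addrACA opprB [RHS]addrACA; congr (_ + _); rewrite addrC.
have n1 : `|x - (x + s *: u + t *: v)| < r1.
  by apply: lt_le_trans (near _ _ sh th) _; rewrite ge_min lexx.
have n2 : `|x - (x + s' *: v + t' *: u)| < r2.
  by rewrite (addrAC x); apply: lt_le_trans (near _ _ th' sh') _; rewrite ge_min lexx orbT.
have := c1 (x + s *: u + t *: v); rewrite -ball_normE /= => /(_ n1) b1.
have := c2 (x + s' *: v + t' *: u); rewrite -ball_normE /= => /(_ n2) b2.
rewrite -[X in X - _](subrK ('D_v ('D_u f) (x + s *: u + t *: v))) {2}E.
rewrite -addrA -[X in _ + X]opprB.
apply: le_trans (ler_normB _ _) _; rewrite [leRHS]splitr.
by apply: lerD; exact: ltW.
Qed.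

End Schwarz.

(** * Isometries of Sol *)

(** Locked so that simplification and [lra] see a partial derivative as an atom. *)
HB.lock Definition pd (R : realType) (i : 'I_3) (w : 'rV[R]_3 -> R) : 'rV[R]_3 -> R :=
  'D_(delta_mx 0 i) w.
Arguments pd {R} i w.

Section SmoothScalar.
Variable R : realType.
Notation E3 := 'rV[R]_3.

Definition cinf (w : E3 -> R) := forall k, class_C k setT w.

Definition pr (i : 'I_3) : E3 -> R := fun p => p 0 i.

Lemma cinf_cst c : cinf (cst c). Proof. by move=> k; exact: class_C_cst. Qed.

Lemma cinfD f g : cinf f -> cinf g -> cinf (f \+ g).
Proof. by move=> cf cg k; apply: class_CD => //; exact: openT. Qed.

Lemma cinfM f g : cinf f -> cinf g -> cinf (f \* g).
Proof. by move=> cf cg k; apply: class_CM => //; exact: openT. Qed.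

Lemma cinf_exp f : cinf f -> cinf (expR \o f).
Proof. by move=> cf k; apply: class_C_expR => //; exact: openT. Qed.

Lemma cinf_pd i f : cinf f -> cinf (pd i f).
Proof. by move=> cf k; rewrite pd.unlock; case: (cf k.+1) => _; exact. Qed.

Lemma cinf_pr i : cinf (pr i).
Proof. by move=> k; apply: (class_C_coord _ openT); exact: class_C_id. Qed.

Lemma cinf_diff f p : cinf f -> differentiable f p.
Proof. by move=> cf; case: (cf 1%N) => + _; apply. Qed.

Lemma cinf_derivable f p v : cinf f -> derivable f p v.
Proof. by move=> cf; exact/diff_derivable/cinf_diff. Qed.

Lemma pd_cst i (c : R) p : pd i (cst c) p = 0. Proof. by rewrite pd.unlock; exact: derive_cst. Qed.

Lemma pdD i f g p : cinf f -> cinf g -> pd i (f \+ g) p = pd i f p + pd i g p.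
Proof. by move=> cf cg; rewrite pd.unlock deriveD//; exact: cinf_derivable. Qed.

Lemma pdM i f g p : cinf f -> cinf g ->
  pd i (f \* g) p = f p * pd i g p + g p * pd i f p.
Proof. by move=> cf cg; rewrite pd.unlock deriveM//; exact: cinf_derivable. Qed.

Lemma pd_exp i f p : cinf f -> pd i (expR \o f) p = expR (f p) * pd i f p.
Proof.
by move=> cf; rewrite pd.unlock; have [_] := derive_comp1 (delta_mx 0 i) (cinf_diff p cf) (is_derive_expR
  _).
Qed.

Lemma pd_pr i j p : pd i (pr j) p = (i == j)%:R.
Proof.
rewrite pd.unlock -(@derive_coord R _ _ id)//.
by rewrite derive_id mxE eq_refl /= eq_sym.
Qed.

Lemma pd_swap i j f p : cinf f -> pd i (pd j f) p = pd j (pd i f) p.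
Proof. by move=> cf; rewrite pd.unlock; exact/derive_swap/cf. Qed.

Lemma pd0_cst f : cinf f -> (forall i p, pd i f p = 0) -> forall p, f p = f 0.
Proof.
move=> cf f0 p.
have d q v : 'D_v f q = 0.
  rewrite deriveE; last exact: cinf_diff.
  rewrite [v]rowE linear_sum big1// => j _; rewrite linearZ/= -deriveE; last exact: cinf_diff.
  by have := f0 j q; rewrite pd.unlock => ->; rewrite scaler0.
have [t t01] := @MVT R (fun s => f (0 + s *: p)) (fun s => 'D_p f (0 + s *: p)) 0 1 ltr01
   (fun s _ => is_derive_line (cinf_diff _ cf))
   (continuous_subspaceT (fun s => differentiable_continuous
      ((derivable1_diffP _ _).1 (@ex_derive _ _ _ _ _ _ _ (is_derive_line (cinf_diff _ cf)))))).
by rewrite d mul0r scale1r scale0r !add0r => /eqP; rewrite subr_eq0 => /eqP.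
Qed.

(** Differentiating the square gives [f * df = 0] with [f] nonvanishing, which excludes a change of
    sign without any connectedness argument. *)
Lemma sqr_cst f c : cinf f -> 0 < c -> (forall p, f p ^+ 2 = c) -> forall p, f p = f 0.
Proof.
move=> cf c0 fc; apply: pd0_cst => // i p.
have e : f \* f = cst c by apply/funext => q /=; rewrite -expr2.
have := pdM i p cf cf; rewrite e pd_cst.
have fp0 : f p != 0 by apply/eqP => f0; have := fc p; rewrite f0 expr0n/=; lra.
move=> /esym; rewrite -mulr2n => /eqP; rewrite mulrn_eq0/= mulf_eq0 (negbTE fp0)/=.
by move/eqP.
Qed.

Lemma sum3 (F : 'I_3 -> R) : \sum_i F i = F i1 + F i2 + F i3.
Proof.
rewrite !big_ord_recl big_ord0 addr0 addrA.
by congr (_ + _ + _); congr (F _); apply: val_inj.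
Qed.

Lemma I3P (P : 'I_3 -> Prop) : P i1 -> P i2 -> P i3 -> forall i, P i.
Proof.
move=> p1 p2 p3 i; have : [|| i == i1, i == i2 | i == i3] by case: i => [[|[|[]]]].
by case/or3P => /eqP ->.
Qed.

Lemma pd_affine f (a : 'I_3 -> R) : cinf f -> (forall i p, pd i f p = a i) ->
  forall p, f p = a i1 * p 0 i1 + a i2 * p 0 i2 + a i3 * p 0 i3 + f 0.
Proof.
move=> cf fa p.
pose g : E3 -> R := f \+ (cst (- a i1) \* pr i1 \+ cst (- a i2) \* pr i2 \+ cst (- a i3) \* pr i3).
have cM i : cinf (cst (- a i) \* pr i) by apply: cinfM; [exact: cinf_cst|exact: cinf_pr].
have cg : cinf g by do ![apply: cinfD => //].
have pr0 i : pr i 0 = 0 by rewrite /pr mxE.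
have : g p = g 0.
  apply: pd0_cst => // i q.
  rewrite !pdD//; last 2 first.
  - exact: cinfD.
  - by do ![apply: cinfD => //].
  rewrite !pdM; try by [exact: cinf_cst|exact: cinf_pr].
  by rewrite !pd_cst !pd_pr fa /=; move: i; apply: I3P => /=; lra.
by rewrite /g /= !pr0 /pr; lra.
Qed.

End SmoothScalar.

Ltac cinf := repeat (first [assumption | exact: cinf_cst | exact: cinf_pr | apply: cinfM
  | apply: cinfD | apply: cinf_exp | apply: cinf_pd]).

Section SolIsometry.
Variable R : realType.
Notation E3 := 'rV[R]_3.

(* From [A^T diag(P,Q,1) A = diag(p,q,1)] the inverse matrix gives
   [A diag(q,p,1) A^T = diag(Q,P,1)]. *)
Lemma gram_inverse (P Q p q : R) (u v h : 'I_3 -> R) :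
  P * Q = 1 -> p * q = 1 ->
  (forall i j, P * (u i * u j) + Q * (v i * v j) + h i * h j =
     p * ((i == i1)%:R * (j == i1)%:R) + q * ((i == i2)%:R * (j == i2)%:R) +
     (i == i3)%:R * (j == i3)%:R) ->
  let sp (a b : 'I_3 -> R) := q * (a i1 * b i1) + p * (a i2 * b i2) + a i3 * b i3 in
  [/\ sp u u = Q, sp v v = P & sp h h = 1] /\ [/\ sp u v = 0, sp u h = 0 & sp v h = 0].
Proof.
move=> PQ pq M sp.
pose A : 'M[R]_3 := \matrix_(i, j) (if i == i1 then u j else if i == i2 then v j else h j).
pose g (i : 'I_3) := if i == i1 then q else if i == i2 then p else 1.
pose D (i : 'I_3) := if i == i1 then P else if i == i2 then Q else 1.
pose L : 'M[R]_3 := \matrix_(i, j) (g i * (A j i * D j)).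
have LA : L *m A = 1%:M.
  apply/matrixP => i j; rewrite !mxE sum3 !mxE /D /=.
  have := M i j; rewrite /g.
  have ij : forall k : 'I_3, [|| k == i1, k == i2 | k == i3] by case=> [[|[|[]]]].
  case/or3P: (ij i) => /eqP ->; case/or3P: (ij j) => /eqP -> /=;
   rewrite !(mulr0,mulr1,mul0r,addr0,add0r,mulr0n,mulr1n) => e.
  - by rewrite -pq -e; lra.
  - by transitivity (q * 0); [rewrite -e; lra|lra].
  - by transitivity (q * 0); [rewrite -e; lra|lra].
  - by transitivity (p * 0); [rewrite -e; lra|lra].
  - by rewrite -pq mulrC -e; lra.
  - by transitivity (p * 0); [rewrite -e; lra|lra].
  - by rewrite -e; lra.
  - by rewrite -e; lra.
  - by lra.
have AL := mulmx1C LA.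
have e i j : A i i1 * (q * A j i1) * D j + A i i2 * (p * A j i2) * D j + A i i3 * A j i3 * D j = (i ==
  j)%:R.
  have := congr1 (fun B : 'M[R]_3 => B i j) AL; rewrite !mxE sum3 !mxE /g /=; lra.
have e11 := e i1 i1; have e12 := e i1 i2; have e13 := e i1 i3.
have e22 := e i2 i2; have e23 := e i2 i3; have e33 := e i3 i3.
move: e11 e12 e13 e22 e23 e33; rewrite !mxE /D /= => e11 e12 e13 e22 e23 e33.
have P0 : P != 0 by apply/eqP => P0; move: PQ; rewrite P0; lra.
have Q0 : Q != 0 by apply/eqP => Q0; move: PQ; rewrite Q0; lra.
rewrite /sp; split; split.
- by apply: (mulfI P0); rewrite PQ; lra.
- by apply: (mulfI Q0); rewrite (mulrC Q P) PQ; lra.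
- lra.
- by apply: (mulfI Q0); lra.
- lra.
- lra.
Qed.

Variables (f : E3 -> E3).
Hypothesis fC : class_Coo setT f.
Hypothesis fg : forall p u v : E3,
  sol_metric (f p) ('D_u f p) ('D_v f p) = sol_metric p u v.

Let u : E3 -> R := fun p => f p 0 i1.
Let v : E3 -> R := fun p => f p 0 i2.
Let h : E3 -> R := fun p => f p 0 i3.

Let cu : cinf u. Proof. by move=> k; exact/(class_C_coord _ openT)/fC. Qed.
Let cv : cinf v. Proof. by move=> k; exact/(class_C_coord _ openT)/fC. Qed.
Let ch : cinf h. Proof. by move=> k; exact/(class_C_coord _ openT)/fC. Qed.

Let P : E3 -> R := expR \o (cst (-2) \* h).
Let Q : E3 -> R := expR \o (cst 2 \* h).
Let p_ : E3 -> R := expR \o (cst (-2) \* pr i3).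
Let q_ : E3 -> R := expR \o (cst 2 \* pr i3).

Let cQ : cinf Q. Proof. by rewrite /Q; cinf. Qed.

(** Derivatives and exponentials become variables, after which the goal is linear over the monomials
    that occur. *)
Ltac plra := repeat match goal with H : _ = _ |- _ => revert H end; simpl;
 repeat match goal with |- context [pd ?i ?w ?x] => let y := fresh "y" in move: (pd i w x) => y end;
 repeat match goal with
 | |- context [P ?x] => let y := fresh "y" in move: (P x) => y
 | |- context [Q ?x] => let y := fresh "y" in move: (Q x) => y
 | |- context [p_ ?x] => let y := fresh "y" in move: (p_ x) => y
 | |- context [q_ ?x] => let y := fresh "y" in move: (q_ x) => y end;
 intros; lra.

Let PQ x : P x * Q x = 1.
Proof. by rewrite /P /Q /= -expRD mulNr addNr expR0. Qed.
Let pq x : p_ x * q_ x = 1.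
Proof. by rewrite /p_ /q_ /= -expRD mulNr addNr expR0. Qed.
Let P_gt0 x : 0 < P x. Proof. exact: expR_gt0. Qed.
Let Q_gt0 x : 0 < Q x. Proof. exact: expR_gt0. Qed.
Let p_gt0 x : 0 < p_ x. Proof. exact: expR_gt0. Qed.
Let q_gt0 x : 0 < q_ x. Proof. exact: expR_gt0. Qed.

Let pdP k x : pd k P x = -2 * P x * pd k h x.
Proof. by rewrite pd_exp; [rewrite pdM; [rewrite -[expR _]/(P x) pd_cst; plra|cinf|cinf]|cinf]. Qed.
Let pdQ k x : pd k Q x = 2 * Q x * pd k h x.
Proof. by rewrite pd_exp; [rewrite pdM; [rewrite -[expR _]/(Q x) pd_cst; plra|cinf|cinf]|cinf]. Qed.
Let pdp k x : pd k p_ x = -2 * p_ x * (k == i3)%:R.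
Proof. by rewrite pd_exp; [rewrite pdM; [rewrite -[expR _]/(p_ x) pd_cst pd_pr; plra|cinf|cinf]|cinf]. Qed.
Let pdq k x : pd k q_ x = 2 * q_ x * (k == i3)%:R.
Proof. by rewrite pd_exp; [rewrite pdM; [rewrite -[expR _]/(q_ x) pd_cst pd_pr; plra|cinf|cinf]|cinf]. Qed.

Let de (i j : 'I_3) : R := (i == j)%:R.

Lemma metric_coord i j x :
  P x * (pd i u x * pd j u x) + Q x * (pd i v x * pd j v x) + pd i h x * pd j h x
  = p_ x * (de i i1 * de j i1) + q_ x * (de i i2 * de j i2) + de i i3 * de j i3.
Proof.
have dc l c : ('D_(delta_mx 0 l) f x) 0 c = pd l (fun y => f y 0 c) x.
  by rewrite pd.unlock; apply: derive_coord; apply: diff_derivable; case: (fC 1%N) => + _; apply.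
have := fg x (delta_mx 0 i) (delta_mx 0 j); move: (dc i) (dc j).
move: ('D_(delta_mx 0 i) f x) ('D_(delta_mx 0 j) f x) => a b ai bj.
have ec l c : (delta_mx 0 l : E3) 0 c = de l c by rewrite mxE eq_refl /= eq_sym.
move: (ec i) (ec j); move: (delta_mx 0 i : E3) (delta_mx 0 j : E3) => a' b' ai' bj'.
rewrite /sol_metric !ai !bj !ai' !bj' => e.
have -> : P x = expR (- (2 * f x 0 i3)) by rewrite /P /=; congr expR; rewrite mulNr.
have -> : Q x = expR (2 * f x 0 i3) by [].
have -> : p_ x = expR (- (2 * x 0 i3)) by rewrite /p_ /=; congr expR; rewrite mulNr.
exact: e.
Qed.

Lemma metric_coord_fun i j :
  P \* (pd i u \* pd j u) \+ Q \* (pd i v \* pd j v) \+ pd i h \* pd j h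
  = p_ \* cst (de i i1 * de j i1) \+ q_ \* cst (de i i2 * de j i2) \+ cst (de i i3 * de j i3).
Proof. by apply/funext => x; exact: metric_coord. Qed.

(** Ingredients of the derivative of the pulled back metric: [T] is half the derivative of its
    coefficients with respect to the target height, [S i j k] pairs the second derivative [i j] of
    the map with its first derivative [k], and [G k i j] is the derivative along [k] of the
    coefficient [i j] of the source metric. *)
Let T i j x := - P x * (pd i u x * pd j u x) + Q x * (pd i v x * pd j v x).
Let S i j k x := P x * (pd i (pd j u) x * pd k u x) +
  Q x * (pd i (pd j v) x * pd k v x) + pd i (pd j h) x * pd k h x.
Let G k i j x := -2 * de k i3 * p_ x * (de i i1 * de j i1) +
   2 * de k i3 * q_ x * (de i i2 * de j i2).

Lemma metric_coord_pd k i j x :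
  2 * pd k h x * T i j x + S k i j x + S k j i x = G k i j x.
Proof.
have := congr1 (fun w => pd k w x) (metric_coord_fun i j).
rewrite !(pdD, pdM); try by cinf.
by rewrite !pd_cst pdP pdQ pdp pdq /T /S /G /de; plra.
Qed.

Lemma S_sym i j k x : S i j k x = S j i k x.
Proof. by rewrite /S (pd_swap i j x cu) (pd_swap i j x cv) (pd_swap i j x ch). Qed.

(** Koszul's permutation trick: [S] is symmetric in its first two indices, so three instances of
    [metric_coord_pd] isolate one value of it. *)
Lemma koszul i j k x : 2 * S i j k x = G i j k x + G j i k x - G k i j x
   - 2 * (pd i h x * T j k x + pd j h x * T i k x - pd k h x * T i j x).
Proof.
have := metric_coord_pd i j k x; have := metric_coord_pd j i k x.
have := metric_coord_pd k i j x; rewrite (S_sym j i) (S_sym k i) (S_sym k j); plra.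
Qed.

Let gram x := @gram_inverse (P x) (Q x) (p_ x) (q_ x) (pd^~ u^~ x) (pd^~ v^~ x) (pd^~ h^~ x)
  (PQ x) (pq x) (fun i j => metric_coord i j x).

(** By [gram] the gradients of [u], [v] and [h] are orthogonal for the dual source metric and that
    of [h] has norm 1. Contracting [S i j k] over [k] with the gradient of [h] therefore leaves the
    second derivative of [h], while the Koszul formula turns the contraction into [T i j] plus the
    Christoffel term of the source. *)
Lemma hessian i j x : pd i (pd j h) x = T i j x +
  (q_ x * (pd i1 h x * (G i j i1 x + G j i i1 x - G i1 i j x)) +
   p_ x * (pd i2 h x * (G i j i2 x + G j i i2 x - G i2 i j x)) +
   pd i3 h x * (G i j i3 x + G j i i3 x - G i3 i j x)) / 2.
Proof.
have [[_ _ /= hh] [_ /= uh vh]] := gram x.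
have K1 := koszul i j i1 x; have K2 := koszul i j i2 x; have K3 := koszul i j i3 x.
have E : q_ x * (pd i1 h x * S i j i1 x) + p_ x * (pd i2 h x * S i j i2 x)
   + pd i3 h x * S i j i3 x = pd i (pd j h) x.
  rewrite /S.
  transitivity (P x * pd i (pd j u) x * (q_ x * (pd i1 u x * pd i1 h x) + p_ x * (pd i2 u x * pd i2 h x)
    + pd i3 u x * pd i3 h x)
   + Q x * pd i (pd j v) x * (q_ x * (pd i1 v x * pd i1 h x) + p_ x * (pd i2 v x * pd i2 h x) + pd i3 v x
     * pd i3 h x)
   + pd i (pd j h) x * (q_ x * (pd i1 h x * pd i1 h x) + p_ x * (pd i2 h x * pd i2 h x) + pd i3 h x * pd
     i3 h x)); first plra.
  by rewrite uh vh hh; plra.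
(* The gradient of [h] is in the kernel of [T], which is built from the differentials of [u] and [v]
   alone. *)
have F j' : q_ x * (pd i1 h x * T j' i1 x) + p_ x * (pd i2 h x * T j' i2 x)
   + pd i3 h x * T j' i3 x = 0.
  transitivity (- P x * pd j' u x * (q_ x * (pd i1 u x * pd i1 h x) + p_ x * (pd i2 u x * pd i2 h x) + pd
    i3 u x * pd i3 h x)
   + Q x * pd j' v x * (q_ x * (pd i1 v x * pd i1 h x) + p_ x * (pd i2 v x * pd i2 h x) + pd i3 v x * pd
     i3 h x)).
    by rewrite /T; plra.
  by rewrite uh vh; plra.
have Fi := congr1 (fun y => pd i h x * y) (F j).
have Fj := congr1 (fun y => pd j h x * y) (F i).
have Hh := congr1 (fun y => T i j x * y) hh.
move: K1 K2 K3 Fi Fj Hh; rewrite -E /=.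
move: (S i j i1 x) (S i j i2 x) (S i j i3 x) (T i i1 x) (T i i2 x) (T i i3 x)
 (T j i1 x) (T j i2 x) (T j i3 x) (T i j x) => S1 S2 S3 Ti1 Ti2 Ti3 Tj1 Tj2 Tj3 Tij.
move=> K1 K2 K3 Fi Fj Hh.
have := congr1 (fun y => q_ x * pd i1 h x * y) K1.
have := congr1 (fun y => p_ x * pd i2 h x * y) K2.
have := congr1 (fun y => pd i3 h x * y) K3.
move: (G i j i1 x) (G j i i1 x) (G i1 i j x) (G i j i2 x) (G j i i2 x) (G i2 i j x) (G i j i3 x) (G j i
  i3 x) (G i3 i j x) => g1 g2 g3 g4 g5 g6 g7 g8 g9.
move: K1 K2 K3 Fi Fj Hh; plra.
Qed.

Lemma eikonal : q_ \* (pd i1 h \* pd i1 h) \+ p_ \* (pd i2 h \* pd i2 h) \+ pd i3 h \* pd i3 h = cst 1.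
Proof. by apply/funext => x; have [[_ _ /= hh] _] := gram x. Qed.

(** The trace of [T] is [- P * Q + Q * P = 0], and the Christoffel terms of the two horizontal
    directions cancel. *)
Lemma laplacian : q_ \* pd i1 (pd i1 h) \+ p_ \* pd i2 (pd i2 h) \+ pd i3 (pd i3 h) = cst 0.
Proof.
apply/funext => x /=; have [[/= uu vv _] _] := gram x.
rewrite (hessian i1 i1) (hessian i2 i2) (hessian i3 i3) /T /G /de /=.
have := congr1 (fun y => P x * y) uu; have := congr1 (fun y => Q x * y) vv.
by have := PQ x; have := pq x; plra.
Qed.

Lemma hess_coord x :
  [/\ pd i1 (pd i1 h) x = p_ x * pd i3 h x + T i1 i1 x,
      pd i2 (pd i2 h) x = - q_ x * pd i3 h x + T i2 i2 x
    & pd i3 (pd i3 h) x = T i3 i3 x] /\ [/\ pd i1 (pd i2 h) x = T i1 i2 x,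
      pd i1 (pd i3 h) x = - pd i1 h x + T i1 i3 x
    & pd i2 (pd i3 h) x = pd i2 h x + T i2 i3 x].
Proof.
have e := pq x; have e1 := congr1 (fun y => pd i1 h x * y) e.
have e2 := congr1 (fun y => pd i2 h x * y) e.
split; split; rewrite hessian /G /de /=.

plra. plra. plra. plra. plra. plra.
Qed.

Lemma eikonal_pd i : q_ \* (cst (2 * de i i3) \* (pd i1 h \* pd i1 h) \+ cst 2 \* (pd i1 h \* pd i (pd i1
  h)))
  \+ p_ \* (cst (- 2 * de i i3) \* (pd i2 h \* pd i2 h) \+ cst 2 \* (pd i2 h \* pd i (pd i2 h)))
  \+ cst 2 \* (pd i3 h \* pd i (pd i3 h)) = cst 0.
Proof.
apply/funext => x; have := congr1 (fun w => pd i w x) eikonal.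
rewrite !(pdD, pdM); try by cinf.
by rewrite !pd_cst pdp pdq /de; plra.
Qed.

(** Half the second derivative of [eikonal] along [i], with the third derivatives ordered so that
    they cancel against those of [laplacian_pd]. *)
Lemma eikonal_pd2 i x :
  q_ x * (2 * de i i3 * pd i1 h x ^+ 2 + 4 * de i i3 * pd i1 h x * pd i (pd i1 h) x
     + pd i (pd i1 h) x ^+ 2 + pd i1 h x * pd i1 (pd i (pd i h)) x)
  + p_ x * (2 * de i i3 * pd i2 h x ^+ 2 - 4 * de i i3 * pd i2 h x * pd i (pd i2 h) x
     + pd i (pd i2 h) x ^+ 2 + pd i2 h x * pd i2 (pd i (pd i h)) x)
  + pd i (pd i3 h) x ^+ 2 + pd i3 h x * pd i3 (pd i (pd i h)) x = 0.
Proof.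
have sw j : pd j (pd i (pd i h)) x = pd i (pd i (pd j h)) x.
  have -> : pd i (pd j h) = pd j (pd i h) by apply/funext => y; exact: pd_swap.
  by apply: pd_swap; cinf.
rewrite !sw; have := congr1 (fun w => pd i w x) (eikonal_pd i).
rewrite !(pdD, pdM); try by cinf.
have d2 : de i i3 * de i i3 = de i i3 by rewrite /de; case: eqP; rewrite ?mulr1 ?mulr0.
have d3 y : de i i3 * (de i i3 * y) = de i i3 * y by rewrite mulrA d2.
rewrite !pd_cst pdp pdq -/(de i i3).
have := d3 (q_ x * pd i1 h x * pd i1 h x); have := d3 (p_ x * pd i2 h x * pd i2 h x).
by move: (de i i3) => d; plra.
Qed.

Lemma laplacian_pd j x :
  q_ x * (2 * de j i3 * pd i1 (pd i1 h) x + pd j (pd i1 (pd i1 h)) x)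
  + p_ x * (- 2 * de j i3 * pd i2 (pd i2 h) x + pd j (pd i2 (pd i2 h)) x)
  + pd j (pd i3 (pd i3 h)) x = 0.
Proof.
have := congr1 (fun w => pd j w x) laplacian.
rewrite !(pdD, pdM); try by cinf.
by rewrite !pd_cst pdp pdq -/(de j i3); move: (de j i3) => d; plra.
Qed.

(** The squared norm of [T = - P du^2 + Q dv^2] is [P^2 |du|^4 + Q^2 |dv|^4 - 2 P Q <du, dv>^2],
    where [|du|^2 = Q], [|dv|^2 = P], [<du, dv> = 0] and [P Q = 1]. *)
Lemma hess_sqr_norm x : q_ x * (q_ x * T i1 i1 x ^+ 2) + p_ x * (p_ x * T i2 i2 x ^+ 2)
  + T i3 i3 x ^+ 2 + 2 * (T i1 i2 x ^+ 2) + 2 * (q_ x * T i1 i3 x ^+ 2) + 2 * (p_ x * T i2 i3 x ^+ 2) = 2.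
Proof.
have [[/= uu vv _] [/= uv _ _]] := gram x.
transitivity (P x ^+ 2 * Q x ^+ 2 + Q x ^+ 2 * P x ^+ 2 - 2 * (P x * Q x) * 0 ^+ 2); last first.
  by rewrite -!exprMn PQ (mulrC (Q x)) PQ; lra.
have := congr1 (fun y => P x ^+ 2 * y ^+ 2) uu; have := congr1 (fun y => Q x ^+ 2 * y ^+ 2) vv.
by have := congr1 (fun y => P x * Q x * y ^+ 2) uv;
have := congr1 (fun y => y * T i1 i2 x ^+ 2) (pq x); rewrite /T; clear uu vv uv; plra.
Qed.

(* Bochner's formula for [h], whose gradient has norm 1, whose Laplacian
   vanishes and whose Hessian has norm 2, in a metric of Ricci tensor [-2 dz^2]. *)
Lemma pd3_sqr x : pd i3 h x ^+ 2 = 1.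
Proof.
(* The trace of [eikonal_pd2], minus the contraction of [laplacian_pd] with the gradient, is free of
   third derivatives and reduces to [2 - 2 * pd i3 h x ^+ 2 = 0]. *)
have e1 := congr1 (fun y => q_ x * y) (eikonal_pd2 i1 x).
have e2 := congr1 (fun y => p_ x * y) (eikonal_pd2 i2 x).
have e3 := eikonal_pd2 i3 x.
have l1 := congr1 (fun y => q_ x * pd i1 h x * y) (laplacian_pd i1 x).
have l2 := congr1 (fun y => p_ x * pd i2 h x * y) (laplacian_pd i2 x).
have l3 := congr1 (fun y => pd i3 h x * y) (laplacian_pd i3 x).
have n2 := hess_sqr_norm x.
have eik := congr1 (fun w => w x) eikonal.
have [[h11 h22 h33] [h12 h13 h23]] := hess_coord x.
have a1 : q_ x * pd i1 (pd i1 h) x = pd i3 h x + q_ x * T i1 i1 x.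
  by have := congr1 (fun y => y * pd i3 h x) (pq x); rewrite h11; plra.
have a2 : p_ x * pd i2 (pd i2 h) x = - pd i3 h x + p_ x * T i2 i2 x.
  by have := congr1 (fun y => y * pd i3 h x) (pq x); rewrite h22; plra.
have s1 := congr1 (fun y => y ^+ 2) a1; have s2 := congr1 (fun y => y ^+ 2) a2.
have t1 := congr1 (fun y => pd i3 h x * y) a1; have t2 := congr1 (fun y => pd i3 h x * y) a2.
have pq12 := congr1 (fun y => y * T i1 i2 x ^+ 2) (pq x).
move: e1 e2 e3 l1 l2 l3; rewrite /de /= (pd_swap i2 i1 x ch) (pd_swap i3 i1 x ch) (pd_swap i3 i2 x ch).
rewrite h33 h12 h13 h23 => e1 e2 e3 l1 l2 l3.
move: {h11 h22 h33 h12 h13 h23} n2 a1 a2 s1 s2 t1 t2 pq12 e1 e2 e3 l1 l2 l3.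
move: (T i1 i1 x) (T i2 i2 x) (T i3 i3 x) (T i1 i2 x) (T i1 i3 x) (T i2 i3 x) => *.
plra.
Qed.

Lemma pd12 x : pd i1 h x = 0 /\ pd i2 h x = 0.
Proof.
have := congr1 (fun w => w x) eikonal => /=; have := pd3_sqr x; rewrite expr2 => -> e.
have q1 : 0 <= q_ x * (pd i1 h x * pd i1 h x).
  by apply: mulr_ge0; [exact: ltW|rewrite -expr2; exact: sqr_ge0].
have q2 : 0 <= p_ x * (pd i2 h x * pd i2 h x).
  by apply: mulr_ge0; [exact: ltW|rewrite -expr2; exact: sqr_ge0].
move: e q1 q2; move: (pd i1 h x) (pd i2 h x) => y1 y2 e q1 q2.
have /eqP : q_ x * (y1 * y1) = 0 by lra.
have /eqP : p_ x * (y2 * y2) = 0 by lra.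
by rewrite !mulf_eq0 (gt_eqF (p_gt0 x)) (gt_eqF (q_gt0 x)) !orFb !orbb => /eqP -> /eqP ->.
Qed.

Lemma height_affine : exists s c : R, s ^+ 2 = 1 /\ forall x, h x = s * x 0 i3 + c /\ pd i3 h x = s.
Proof.
have h3 : forall x, pd i3 h x = pd i3 h 0.
  by apply: (@sqr_cst _ _ 1); [cinf|lra|exact: pd3_sqr].
exists (pd i3 h 0), (h 0); split=> [|x]; first exact: pd3_sqr.
split=> //; rewrite (@pd_affine _ h (fun i => if i == i3 then pd i3 h 0 else 0)) //=; first lra.
by apply: I3P => y /=; [have [] := pd12 y|have [] := pd12 y|exact: h3].
Qed.

(** As [h] depends on [z] alone, its horizontal second derivatives vanish and [hess_coord] evaluates
    [T]. Together with the metric this gives both the sum and the difference of the contributions of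
    [u] and [v]. *)
Lemma gram_entries x (s := pd i3 h x) :
  [/\ P x * pd i1 u x ^+ 2 + Q x * pd i1 v x ^+ 2 = p_ x,
      P x * pd i2 u x ^+ 2 + Q x * pd i2 v x ^+ 2 = q_ x,
      pd i3 u x = 0 & pd i3 v x = 0] /\
  [/\ - P x * pd i1 u x ^+ 2 + Q x * pd i1 v x ^+ 2 = - p_ x * s
    & - P x * pd i2 u x ^+ 2 + Q x * pd i2 v x ^+ 2 = q_ x * s].
Proof.
have [h1 h2] := pd12 x.
have m1 := metric_coord i1 i1 x; have m2 := metric_coord i2 i2 x; have m3 := metric_coord i3 i3 x.
move: m1 m2 m3; rewrite /de /= h1 h2 -[pd i3 h x * _]expr2 pd3_sqr => m1 m2 m3.
have [[h11 h22 _] _] := hess_coord x.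
have z1 : pd i1 h = cst 0 by apply/funext => y; case: (pd12 y).
have z2 : pd i2 h = cst 0 by apply/funext => y; case: (pd12 y).
move: h11 h22; rewrite z1 z2 !pd_cst /T => h11 h22.
split; split.
- by plra.
- by plra.
- have a1 : 0 <= P x * (pd i3 u x * pd i3 u x).
    by apply: mulr_ge0; [exact: ltW|rewrite -expr2; exact: sqr_ge0].
  have a2 : 0 <= Q x * (pd i3 v x * pd i3 v x).
    by apply: mulr_ge0; [exact: ltW|rewrite -expr2; exact: sqr_ge0].
  have /eqP : P x * (pd i3 u x * pd i3 u x) = 0 by move: a1 a2; plra.
  by rewrite !mulf_eq0 (gt_eqF (P_gt0 x)) orFb orbb => /eqP.
- have a1 : 0 <= P x * (pd i3 u x * pd i3 u x).
    by apply: mulr_ge0; [exact: ltW|rewrite -expr2; exact: sqr_ge0].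
  have a2 : 0 <= Q x * (pd i3 v x * pd i3 v x).
    by apply: mulr_ge0; [exact: ltW|rewrite -expr2; exact: sqr_ge0].
  have /eqP : Q x * (pd i3 v x * pd i3 v x) = 0 by move: a1 a2; plra.
  by rewrite !mulf_eq0 (gt_eqF (Q_gt0 x)) orFb orbb => /eqP.
- by rewrite /s; plra.
- by rewrite /s; plra.
Qed.

(** With [s = 1] the sums and differences in [gram_entries] kill the derivatives of [u] along [y]
    and of [v] along [x]; with [s = -1] they kill the other two. The surviving derivatives have
    constant squares, hence are constant. *)
Lemma isometry_normal_form : exists s1 s2 a b c : R, [/\ s1 ^+ 2 = 1, s2 ^+ 2 = 1 &
  (forall x, f x = vec3 (s1 * expR c * x 0 i1 + a) (s2 * expR (- c) * x 0 i2 + b) (x 0 i3 + c)) \/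
  (forall x, f x = vec3 (s1 * expR c * x 0 i2 + a) (s2 * expR (- c) * x 0 i1 + b) (- x 0 i3 + c))].
Proof.
have [s [c [s1 hE]]] := height_affine.
have PE x : P x = expR (-2 * (s * x 0 i3 + c)) by rewrite /P /= (hE x).1.
have QE x : Q x = expR (2 * (s * x 0 i3 + c)) by rewrite /Q /= (hE x).1.
have pE x : p_ x = expR (-2 * x 0 i3) by [].
have qE x : q_ x = expR (2 * x 0 i3) by [].
have e2 d : expR (2 * d) = expR d ^+ 2 :> R by rewrite expr2 -expRD; congr expR; lra.
have Q0 x : Q x != 0 by rewrite gt_eqF.
have P0 x : P x != 0 by rewrite gt_eqF.
have fE x : f x = vec3 (u x) (v x) (h x) by rewrite vec3_eta.
have sg (w : E3 -> R) d : cinf w -> (forall x, w x ^+ 2 = expR d ^+ 2) ->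
    exists2 s' : R, s' ^+ 2 = 1 & forall x, w x = s' * expR d.
  move=> cw wd; have d0 : expR d != 0 :> R by rewrite gt_eqF// expR_gt0.
  exists (w 0 / expR d); first by rewrite expr_div_n wd divff// expf_neq0.
  by move=> x; rewrite divfK//; apply: sqr_cst (wd) x => //; rewrite exprn_gt0// expR_gt0.
have s01 : s = 1 \/ s = -1.
  have /eqP : (s - 1) * (s + 1) = 0 by move: s1; rewrite expr2; lra.
  by rewrite mulf_eq0 subr_eq0 addr_eq0 => /orP[] /eqP; [left|right].
case: s01 => sE; move: hE PE QE; rewrite {}sE => hE PE QE.
- have v1 x : pd i1 v x = 0.
    have [[e1 _ _ _] [e3 _]] := gram_entries x; move: e1 e3; rewrite (hE x).2 => e1 e3.
    have /eqP : Q x * pd i1 v x ^+ 2 = 0 by move: e1 e3; plra.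
    by rewrite mulf_eq0 (negbTE (Q0 x))/= expf_eq0/= => /eqP.
  have u2 x : pd i2 u x = 0.
    have [[_ e1 _ _] [_ e3]] := gram_entries x; move: e1 e3; rewrite (hE x).2 => e1 e3.
    have /eqP : P x * pd i2 u x ^+ 2 = 0 by move: e1 e3; plra.
    by rewrite mulf_eq0 (negbTE (P0 x))/= expf_eq0/= => /eqP.
  have u1 x : pd i1 u x ^+ 2 = expR c ^+ 2.
    have [[e1 _ _ _] _] := gram_entries x; move: e1; rewrite v1 expr0n mulr0 addr0 => e1.
    apply: (mulfI (P0 x)); rewrite e1 PE pE -e2 -expRD; congr expR; lra.
  have v2 x : pd i2 v x ^+ 2 = expR (- c) ^+ 2.
    have [[_ e1 _ _] _] := gram_entries x; move: e1; rewrite u2 expr0n mulr0 add0r => e1.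
    apply: (mulfI (Q0 x)); rewrite e1 QE qE -e2 -expRD; congr expR; lra.
  have [r1 r11 ur] := sg _ _ (cinf_pd i1 cu) u1.
  have [r2 r21 vr] := sg _ _ (cinf_pd i2 cv) v2.
  exists r1, r2, (u 0), (v 0), c; split=> //; left => x; rewrite fE (hE x).1 mul1r; congr vec3.
  + rewrite (@pd_affine _ u (fun i => if i == i1 then r1 * expR c else 0)) //=; first lra.
    by apply: I3P => y /=; [exact: ur|exact: u2|have [[]] := gram_entries y].
  + rewrite (@pd_affine _ v (fun i => if i == i2 then r2 * expR (- c) else 0)) //=; first lra.
    by apply: I3P => y /=; [exact: v1|exact: vr|have [[]] := gram_entries y].
- have u1 x : pd i1 u x = 0.
    have [[e1 _ _ _] [e3 _]] := gram_entries x; move: e1 e3; rewrite (hE x).2 => e1 e3.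
    have /eqP : P x * pd i1 u x ^+ 2 = 0 by move: e1 e3; plra.
    by rewrite mulf_eq0 (negbTE (P0 x))/= expf_eq0/= => /eqP.
  have v2 x : pd i2 v x = 0.
    have [[_ e1 _ _] [_ e3]] := gram_entries x; move: e1 e3; rewrite (hE x).2 => e1 e3.
    have /eqP : Q x * pd i2 v x ^+ 2 = 0 by move: e1 e3; plra.
    by rewrite mulf_eq0 (negbTE (Q0 x))/= expf_eq0/= => /eqP.
  have u2 x : pd i2 u x ^+ 2 = expR c ^+ 2.
    have [[_ e1 _ _] _] := gram_entries x; move: e1; rewrite v2 expr0n mulr0 addr0 => e1.
    apply: (mulfI (P0 x)); rewrite e1 PE qE -e2 -expRD; congr expR; lra.
  have v1 x : pd i1 v x ^+ 2 = expR (- c) ^+ 2.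
    have [[e1 _ _ _] _] := gram_entries x; move: e1; rewrite u1 expr0n mulr0 add0r => e1.
    apply: (mulfI (Q0 x)); rewrite e1 QE pE -e2 -expRD; congr expR; lra.
  have [r1 r11 ur] := sg _ _ (cinf_pd i2 cu) u2.
  have [r2 r21 vr] := sg _ _ (cinf_pd i1 cv) v1.
  exists r1, r2, (u 0), (v 0), c; split=> //; right => x; rewrite fE (hE x).1 mulN1r; congr vec3.
  + rewrite (@pd_affine _ u (fun i => if i == i2 then r1 * expR c else 0)) //=; first lra.
    by apply: I3P => y /=; [exact: u1|exact: ur|have [[]] := gram_entries y].
  + rewrite (@pd_affine _ v (fun i => if i == i1 then r2 * expR (- c) else 0)) //=; first lra.
    by apply: I3P => y /=; [exact: vr|exact: v2|have [[]] := gram_entries y].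
Qed.

End SolIsometry.

(** * Smooth maps in charts *)

Section Smooth.
Variable R : realType.
Implicit Types (M N P : atlas_space R).

Definition good_atlas M := forall c, atlas M c -> is_chart c.

Lemma open_preimage_on (T T' : topologicalType) (f : T -> T') (U : set T) (B : set T') :
  open U -> open B -> (forall x, U x -> {for x, continuous f}) -> open (U `&` f @^-1` B).
Proof.
rewrite !openE => oU oB cf x [Ux Bfx]; apply: filterI; first exact: oU.
by apply: (cf x Ux); exact: oB.
Qed.

Lemma chart_open (M : topologicalType) (c : chart R M) (A : set M) :
  is_chart c -> A `<=` chart_dom c -> open A -> open (c @` A).
Proof. by move=> [_ _ cA] sA oA; exact/(cA _ sA).1. Qed.

Lemma chart_continuous (M : topologicalType) (c : chart R M) x : is_chart c ->
  chart_dom c x -> {for x, continuous c}.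
Proof.
move=> [oc ic cA] cx B; rewrite /= nbhsE => -[B' [oB' B'cx] sB'B].
have oc' : open (c @` chart_dom c) by apply/(cA _ _).1.
have E : c @` (chart_dom c `&` c @^-1` B') = c @` chart_dom c `&` B'.
  apply/seteqP; split => [_ [y [cy By] <-]|_ [[y cy <-] By]]; last by exists y.
  by split=> //; exists y.
have : open (chart_dom c `&` c @^-1` B').
  apply/(cA _ _).2; first by move=> y [].
  by rewrite E; exact: openI.
rewrite openE => /(_ x (conj cx B'cx)); apply: filterS => y [_]; exact: sB'B.
Qed.

(* Local coordinate expressions of a map are glued into the global one that
   [smooth_on] asks for. *)
Lemma smooth_onP M N (U : set M) (f : M -> N) : good_atlas M -> open U ->
  (forall x, U x -> {for x, continuous f}) ->
  (forall x c d, U x -> atlas M c -> atlas N d -> chart_dom c x -> chart_dom d (f x) ->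
    exists (B0 : set M) (t : 'rV[R]_3 -> 'rV[R]_3), [/\ open B0, B0 x, B0 `<=` chart_dom c,
      class_Coo (c @` B0) t & forall y, B0 y -> t (c y) = d (f y)]) ->
  smooth_on U f.
Proof.
move=> gM oU cf loc; split=> // c d Mc Nd /=.
set D := _ `&` _ `&` _.
have [oc ic cA] := gM _ Mc.
(* The inverse of the chart needs a default point, hence the separate treatment of an empty
   domain. *)
have [[x0 Dx0]|D0] := pselect (D !=set0); last first.
  have D0' : D = set0 by apply/seteqP; split => // x Dx; apply: D0; exists x.
  exists id; split; last by move=> x Dx; case: D0; exists x.
  by rewrite D0' image_set0 => k; exact: class_C_pointwise.
pose cinv z := xget x0 [set x | chart_dom c x /\ c x = z].
have cinvK x : chart_dom c x -> cinv (c x) = x.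
  move=> cx; rewrite /cinv; case: xgetP => [y _ [cy /ic]|/(_ x) []//].
  by apply; rewrite inE.
exists (fun z => d (f (cinv z))); split; last by move=> x [[_ cx] _]; rewrite cinvK.
move=> k; apply: class_C_pointwise => _ [x [[Ux cx] dfx] <-].
have [B0 [t [oB0 B0x B0c ct tE]]] := loc x c d Ux Mc Nd cx dfx.
have ocO : open (c @` B0) by exact/(cA _ B0c).1.
apply: (@class_C_sub _ _ _ _ (c @` B0)); first by move=> _ ->; exists x.
apply: class_C_eqon (ct k) => // _ [y B0y <-].
by rewrite tE// cinvK//; exact: B0c.
Qed.

Lemma smooth_on_local M N (U : set M) (f : M -> N) : good_atlas M -> good_atlas N -> open U ->
  (forall x, U x -> exists2 V, open V /\ V x & smooth_on V f) -> smooth_on U f.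
Proof.
move=> gM gN oU loc; apply: smooth_onP => // [x /loc[V [oV Vx]] [cf _]|]; first exact: cf.
move=> x c d Ux Mc Nd cx dfx; have [V [oV Vx] [cf sf]] := loc x Ux.
have [t [ct tE]] := sf c d Mc Nd.
exists (V `&` chart_dom c `&` f @^-1` chart_dom d), t; split=> //.
- apply: open_preimage_on.
  + by apply: openI => //; case: (gM _ Mc).
  + by case: (gN _ Nd).
  + by move=> y [Vy _]; exact: cf.
- by move=> y [[]].
Qed.

Lemma smooth_on_eq M N (U : set M) (f g : M -> N) : open U ->
  (forall x, U x -> f x = g x) -> smooth_on U f -> smooth_on U g.
Proof.
move=> oU fg [cf sf]; split=> [x Ux|c d Mc Nd].
  have fgx : \forall y \near x, f y = g y.
    by have : nbhs x U by [exact: open_nbhs_nbhs]; exact: filterS.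
  change (g @ x --> g x); rewrite -(fg x Ux).
  by apply: cvg_trans (cf x Ux); exact: near_eq_cvg.
have [t [ct tE]] := sf c d Mc Nd; exists t => /=.
have -> : U `&` chart_dom c `&` g @^-1` chart_dom d = U `&` chart_dom c `&` f @^-1` chart_dom d.
  by apply/seteqP; split=> y [[Uy cy] dy]; split=> //; move: dy; rewrite /preimage /= fg.
split=> // y [[Uy cy] dgy]; rewrite -(fg y Uy) tE//; split=> //.
by move: dgy; rewrite /preimage /= fg.
Qed.

Lemma smooth_on_sub M N (U V : set M) (f : M -> N) : good_atlas M -> good_atlas N -> open U ->
  open V -> V `<=` U -> smooth_on U f -> smooth_on V f.
Proof.
move=> gM gN oU oV VU sf; have [cf tf] := sf; apply: smooth_onP => // [x /VU /cf//|x c d Vx Mc Nd cx dfx].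
have [t [ct tE]] := tf c d Mc Nd.
exists (U `&` chart_dom c `&` f @^-1` chart_dom d), t; split=> //.
- apply: open_preimage_on.
  + by apply: openI => //; case: (gM _ Mc).
  + by case: (gN _ Nd).
  + by move=> y [Vy _]; exact: cf.
- by split=> //; split=> //; exact: VU.
- by move=> y [[]].
Qed.

Lemma smooth_on_comp M N P (U : set M) (W : set N) (f : M -> N) (g : N -> P) :
  good_atlas M -> good_atlas N -> good_atlas P ->
  (forall x, exists2 d, atlas N d & chart_dom d x) -> open U -> open W ->
  (forall x, U x -> W (f x)) -> smooth_on U f -> smooth_on W g -> smooth_on U (g \o f).
Proof.
move=> gM gN gP cN oU oW UW [cf sf] [cg sg]; apply: smooth_onP => // [x Ux|].
  by apply: continuous_comp; [exact: cf|exact/cg/UW].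
move=> x c e Ux Mc Pe cx egx; have [d Nd dfx] := cN (f x).
have [oc ic cA] := gM _ Mc; have [od id dA] := gN _ Nd; have [oe _ _] := gP _ Pe.
have [t [ct tE]] := sf c d Mc Nd; have [s [cs sE]] := sg d e Nd Pe.
set D1 := _ `&` _ `&` _ in ct tE; set D2 := _ `&` _ `&` _ in cs sE.
have oD1 : open D1 by apply: open_preimage_on => //; [exact: openI|move=> y [/cf]].
have oD2 : open D2 by apply: open_preimage_on => //; [exact: openI|move=> y [/cg]].
have D1c : D1 `<=` chart_dom c by move=> y [[]].
have D2d : D2 `<=` chart_dom d by move=> y [[]].
pose B0 := D1 `&` f @^-1` D2.
have oB0 : open B0 by apply: open_preimage_on => // y [[/cf]].
have B0c : B0 `<=` chart_dom c by move=> y [/D1c].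
exists B0, (s \o t); split=> //.
- by split; do ![split=> //]; exact: UW.
- move=> k; apply: (class_C_comp (W := d @` D2)).
  + exact/(cA _ B0c).1.
  + exact/(dA _ D2d).1.
  + by move=> _ [y [D1y D2y] <-]; rewrite tE//; exists (f y).
  + exact: cs.
  + by apply: class_C_sub (ct k); apply: image_subset => y [].
- by move=> y [D1y D2y] /=; rewrite tE// sE.
Qed.

End Smooth.

(** * Spaces with a single global chart *)

Section OneChart.
Variable R : realType.

Definition one_chart (X : atlas_space R) (iota : X -> 'rV[R]_3) :=
  atlas X = [set Chart setT iota] /\ is_chart (Chart setT iota).

Variables (X : atlas_space R) (iota : X -> 'rV[R]_3).
Hypothesis X1 : one_chart iota.

Lemma one_chart_good : good_atlas X.
Proof. by move=> c; case: X1 => -> ? ->. Qed.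

Lemma one_chart_cover (x : X) : exists2 d, atlas X d & chart_dom d x.
Proof. by exists (Chart setT iota) => //; case: X1 => ->. Qed.

Lemma one_chart_inj : injective iota.
Proof. by case: X1 => _ [_ ic _] x y; apply: ic; rewrite inE. Qed.

Lemma one_chart_cont : continuous iota.
Proof. by move=> x; apply: (@chart_continuous R X (Chart setT iota)) => //; case: X1. Qed.

Lemma one_chart_open (A : set X) : open A -> open (iota @` A).
Proof. by apply: (@chart_open R X (Chart setT iota)) => //; case: X1. Qed.

Lemma one_chart_hausdorff : hausdorff_space X.
Proof.
rewrite open_hausdorff => x y xy.
have ixy : iota x != iota y by apply: contra_neq xy => /one_chart_inj.
have : hausdorff_space 'rV[R]_3 by exact: norm_hausdorff.
rewrite open_hausdorff => /(_ _ _ ixy) [[A B] /= [Ax By] [oA oB AB]].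
exists (iota @^-1` A, iota @^-1` B); split=> /=.
- by move: Ax; rewrite !inE.
- by move: By; rewrite !inE.
- by apply: open_comp => // z _; exact: one_chart_cont.
- by apply: open_comp => // z _; exact: one_chart_cont.
- by rewrite -preimage_setI (eqP AB) preimage_set0.
Qed.

(** A closed ball inside the open image of the chart is carried back by the inverse, continuous
    because the chart is open. These are the compact sets fed to proper discontinuity. *)
Lemma one_chart_compact_nbhs (x : X) : exists2 K : set X, compact K & nbhs x K.
Proof.
have /= := one_chart_open openT; rewrite openE => /(_ (iota x) (ex_intro2 _ _ x I erefl)).
move=> /nbhs_ballP[r /= r0 sr].
pose K := iota @^-1` closed_ball (iota x) (r / 2).
have r2 : 0 < r / 2 by rewrite divr_gt0.
have sb : closed_ball (iota x) (r / 2) `<=` range iota.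
  by move=> y /closed_ball_subset - /(_ r r2 _)/sr; apply; rewrite ltr_pdivrMr// ltr_pMr// ltr1n.
exists K; last first.
  apply: one_chart_cont; apply: (filterS (@subset_closed_ball _ _ _ _)).
  exact: nbhsx_ballx.
pose inv z := xget x [set y | iota y = z].
have invK y : inv (iota y) = y.
  by rewrite /inv; case: xgetP => [y' _ /= /one_chart_inj //|/(_ y)/= /(_ erefl)].
have KE : K = inv @` closed_ball (iota x) (r / 2).
  apply/seteqP; split=> [y Ky|_ [z bz <-]]; first by exists (iota y); rewrite ?invK.
  by have [y _ yz] := sb _ bz; rewrite -yz invK /K /= yz.
rewrite KE; apply: continuous_compact; last first.
  apply: bounded_closed_compact; last exact: closed_ball_closed.
  rewrite closed_ballE//; exists (`|iota x| + r); split=> [|M hM z /=]; first exact: num_real.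
  rewrite /closed_ball_ /= => xz.
  rewrite (le_trans _ (ltW hM))// -[z](subrK (iota x)) (le_trans (ler_normD _ _))// addrC lerD2l.
  by rewrite distrC (le_trans xz)//; lra.
apply: continuous_in_subspaceT => _ /set_mem /sb [y _ <-] A /=.
rewrite invK nbhsE => -[B [oB By] BA].
have : open (iota @` B) by exact: one_chart_open.
rewrite openE => /(_ (iota y) (ex_intro2 _ _ y By erefl)); apply: filterS => _ [y' By' <-].
by rewrite /= invK; exact: BA.
Qed.

Lemma second_countable_rV : @second_countable 'rV[R]_3.
Proof.
pose ctr (q : 'rV[rat]_3) : 'rV[R]_3 := map_mx ratr q.
pose b (qr : 'rV[rat]_3 * rat) : set 'rV[R]_3 := ball (ctr qr.1) (ratr qr.2).
exists [set b qr | qr in [set qr | 0 < qr.2]].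
  by apply: card_le_trans (card_image_le _ _) _; exact: countableP.
split=> [_ [[q r] /= r0 <-]|x A /=].
  by apply: ball_open; rewrite /= ltr0q.
move=> /nbhs_ballP[e /= e0 eA].
have e4 : 0 < e / 2 by rewrite divr_gt0.
have [r] := rat_in_itvoo e4; rewrite in_itv/= => /andP[r0 re].
have rlt i : ratr (R:=R) r + x 0 i > x 0 i by rewrite ltrDr.
(* Each coordinate of the centre is rounded up to a rational by less than [r]. *)
pose q : 'rV[rat]_3 := \row_i projT1 (cid (rat_in_itvoo (rlt i))).
have qE i : x 0 i < ratr (q 0 i) < ratr r + x 0 i.
  by rewrite /q mxE; case: cid => y /=; rewrite in_itv.
clearbody q; have xq : `|ctr q - x| < ratr r.
  rewrite /Num.Def.normr/= mx_normrE; apply/bigmax_ltP; split=> // -[i j] _ /=.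
  rewrite !mxE ord1; have /andP[h1 h2] := qE j.
  by rewrite ger0_norm ?subr_ge0 ?(ltW h1)// ltrBlDr.
exists (b (q, r)); last first.
  move=> y; rewrite /b /= -ball_normE /= => qy; apply: eA; rewrite -ball_normE /=.
  rewrite -(subrK (ctr q) x) -addrA (le_lt_trans (ler_normD _ _))// [ltRHS]splitr.
  by rewrite ltrD ?(lt_trans qy)// distrC (lt_trans xq).
split; first by exists (q, r) => //=; rewrite -(ltr0q R).
by rewrite /b -ball_normE.
Qed.

Lemma one_chart_second_countable : @second_countable X.
Proof.
have [B cB [oB bB]] := second_countable_rV.
exists [set iota @^-1` b | b in B].
  exact: card_le_trans (card_image_le _ _) cB.
split=> [_ [b Bb <-]|x A].
  by apply: open_comp => [z _|]; [exact: one_chart_cont|exact: oB].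
rewrite nbhsE => -[A' [oA' A'x] sA'].
have : nbhs (iota x) (iota @` A').
  by apply: open_nbhs_nbhs; split; [exact: one_chart_open|exists x].
move=> /bB [b [Bb bx] sb]; exists (iota @^-1` b).
  by split=> //; exists b.
by move=> y /sb /= [y' A'y' /one_chart_inj <-]; exact: sA'.
Qed.

End OneChart.

(** * Quotient manifolds *)

Section OrbitSpace.
Variables (X : topologicalType) (G : transf_group X).
Local Open Scope quotient_scope.

Lemma orbit_projP (x y : X) : orbit_proj G x = orbit_proj G y <-> exists2 g, transf G g & g x = y.
Proof.
split=> [/eqmodP/asboolP//|[g Gg gx]].
by apply/eqmodP/asboolP; exists g.
Qed.

Lemma orbit_proj_surj (y : orbit_space G) : exists x, orbit_proj G x = y.
Proof. by exists (repr y); exact: reprK. Qed.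

Lemma orbit_proj_transf g x : transf G g -> orbit_proj G (g x) = orbit_proj G x.
Proof. by move=> Gg; apply/esym/orbit_projP; exists g. Qed.

Lemma orbit_proj_continuous : continuous (@orbit_proj X G).
Proof. exact: pi_continuous. Qed.

Lemma open_orbit_space (B : set (orbit_space G)) : open (@orbit_proj X G @^-1` B) -> open B.
Proof. by []. Qed.

Lemma orbit_proj_open (A : set X) : (forall g, transf G g -> continuous g) ->
  open A -> open (@orbit_proj X G @` A).
Proof.
move=> cG oA; apply: open_orbit_space.
have -> : @orbit_proj X G @^-1` (@orbit_proj X G @` A) = \bigcup_(g in transf G) (g @^-1` A).
  apply/seteqP; split=> [x [a Aa /esym/orbit_projP[g Gg gx]]|x [g Gg gx]].
    by exists g => //; rewrite /preimage /= gx.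
  by exists (g x) => //; rewrite orbit_proj_transf.
by apply: bigcup_open => g Gg; apply: open_comp => // y _; exact: cG.
Qed.

End OrbitSpace.

Lemma finite_set_near (I T : Type) (A : set I) (F : set_system T) (P : I -> T -> Prop) :
  Filter F -> finite_set A -> (forall i, A i -> \forall x \near F, P i x) ->
  \forall x \near F, forall i, A i -> P i x.
Proof.
move=> FF fA AP; pose I' : choiceType := {classic I}.
have fA' : finite_set (A : set I') by [].
have [s sE] := (@finite_seqP I' A).1 fA'.
have : \forall x \near F, forall i, i \in s -> P i x.
  have : forall i, i \in s -> \forall x \near F, P i x.
    by move=> i si; apply: AP; rewrite sE.
  elim: s {sE} => [|a s IH] h; first by near=> x.
  have h1 := h a (mem_head a s); have h2 := IH (fun i si => h i (mem_behead (s := a :: s) si)).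
  near=> x => i; rewrite inE => /orP[/eqP ->|]; first by near: x.
  by move: i; near: x.
by apply: filterS => x h i Ai; apply: h; rewrite sE in Ai.
Unshelve. all: by end_near. Qed.

Section ProperAction.
Variables (R : realType) (X : atlas_space R) (iota : X -> 'rV[R]_3).
Hypothesis X1 : one_chart iota.
Variable G : transf_group X.
Hypothesis Gs : forall g, transf G g -> smooth g.

Lemma transf_continuous g : transf G g -> continuous g.
Proof. by move=> /Gs [+ _] x; apply. Qed.

Lemma quotient_pi_open A : open A -> open (@orbit_proj X G @` A).
Proof. exact/orbit_proj_open/transf_continuous. Qed.

Lemma quotient_good : good_atlas (quotient G).
Proof.
move=> c [d [V [Xd [oV sV] iV dc cE]]].
have gd := one_chart_good X1 Xd; have [od injd dA] := gd.
split.
- by rewrite dc; exact: quotient_pi_open.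
- move=> a b /set_mem ca /set_mem; move: ca; rewrite dc => -[x Vx <-] [y Vy <-].
  by rewrite !cE// => dxy; congr orbit_proj; apply: injd => //; rewrite inE; exact: sV.
- move=> A; rewrite dc => sA.
  pose A' := V `&` @orbit_proj X G @^-1` A.
  have AE : A = @orbit_proj X G @` A'.
    apply/seteqP; split=> [y Ay|_ [x [_ Ax] <-]//].
    by have [x Vx xy] := sA _ Ay; exists x => //; split=> //; rewrite /preimage /= xy.
  have cAE : c @` A = d @` A'.
    rewrite AE; apply/seteqP; split=> [_ [_ [x A'x <-] <-]|_ [x A'x <-]].
      by exists x => //; rewrite cE//; case: A'x.
    by exists (orbit_proj G x); [exists x|rewrite cE//; case: A'x].
  have sA' : A' `<=` chart_dom d by move=> x [/sV].
  rewrite cAE; split=> [oA|oA].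
    by apply/(dA _ sA').1; exact: openI.
  by rewrite AE; apply: quotient_pi_open; exact/(dA _ sA').2.
Qed.

Lemma transf_smooth_chart g : transf G g -> exists t : 'rV[R]_3 -> 'rV[R]_3,
  class_Coo (range iota) t /\ forall x, t (iota x) = iota (g x).
Proof.
case: X1 => aX _ /Gs [_ /(_ (Chart setT iota) (Chart setT iota))].
rewrite aX => /(_ erefl erefl) /= [t].
rewrite preimage_setT !setIT => -[ct tE]; exists t; split=> // x; exact: tE.
Qed.

(** A chart of the quotient around the orbit of [x] is read on the translate [g x] lying in its
    sheet [V], so the coordinate expression is that of [g]. *)
Lemma orbit_proj_smooth : smooth (@orbit_proj X G : X -> quotient G).
Proof.
apply: (smooth_onP (one_chart_good X1) openT) => [x _|x c d _].
  exact: orbit_proj_continuous.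
have [aX _] := X1; rewrite aX => -> [e [V [/= Xe [oV sV] iV dd dE]]] _.
move: Xe; rewrite aX => eE; rewrite {}eE in sV dE; rewrite dd => -[v Vv /esym/orbit_projP[g Gg gx]].
have [t [ct tE]] := transf_smooth_chart Gg.
exists (g @^-1` V), t; split=> //.
- by apply: open_comp => // y _; exact: transf_continuous.
- by rewrite /preimage /= gx.
- by move=> k; apply: class_C_sub (ct k) => _ [y _ <-]; exists y.
- by move=> y Vgy; rewrite tE /= -(orbit_proj_transf y Gg) dE.
Qed.

Lemma section_smooth (V : set X) (s : quotient G -> X) : open V ->
  {in V &, injective (@orbit_proj X G)} -> (forall x, V x -> s (orbit_proj G x) = x) ->
  @smooth_on R (quotient G) X (@orbit_proj X G @` V) s.
Proof.
move=> oV iV sK; apply: (smooth_onP quotient_good).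
- exact: quotient_pi_open.
- move=> _ [x Vx <-] A /=; rewrite sK// nbhsE => -[B [oB Bx] BA].
  have : nbhs (orbit_proj G x) (@orbit_proj X G @` (V `&` B)).
    by apply: open_nbhs_nbhs; split; [apply: quotient_pi_open; exact: openI|exists x].
  by apply: filterS => _ [y [Vy By] <-]; rewrite /= sK//; exact: BA.
move=> _ d c [x Vx <-] [e [V' [/= Xe [oV' sV'] iV' dd dE]]].
have [aX iX] := X1; rewrite aX => ->; move: Xe; rewrite aX => eE; rewrite {}eE in sV' dE; rewrite dd sK//
  => -[x' V'x' /orbit_projP[g Gg gx']] _.
have [t [ct tE]] := transf_smooth_chart Gg.
pose B := V' `&` g @^-1` V.
have oB : open B.
  by apply: openI => //; apply: open_comp => // y _; exact: transf_continuous.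
exists (@orbit_proj X G @` B), t; split.
- exact: quotient_pi_open.
- exists x'; last by apply/orbit_projP; exists g.
  by split=> //; rewrite /preimage /= gx'.
- by apply: image_subset => y [].
- move=> k; apply: class_C_sub (ct k) => _ [_ [y [V'y _] <-] <-].
  by rewrite dE//=; exists y.
- by move=> _ [y [V'y Vgy] <-]; rewrite dE//= tE -(orbit_proj_transf y Gg) sK.
Qed.

Hypothesis Gfree : acts_freely G.
Hypothesis Gpd : acts_properly_discontinuously G.

(** Inside compact neighbourhoods of [x] and [y] only finitely many elements of [G] can relate
    points, and each that does not send [x] to [y] is excluded by the Hausdorff property. Taking
    [y = x] gives small open sets, and taking points of distinct orbits gives separation in the
    quotient. *)
Lemma orbits_separated (x y : X) : exists A B : set X, [/\ open A, A x, open B, B y &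
  forall g, transf G g -> g x <> y -> forall a b, A a -> B b -> g a <> b].
Proof.
have [K1 cK1 nK1] := one_chart_compact_nbhs X1 x.
have [K2 cK2 nK2] := one_chart_compact_nbhs X1 y.
have fF := Gpd (compactU cK1 cK2).
have sep g : transf G g -> g x <> y -> \forall z \near (x, y), g z.1 <> z.2.
  move=> Gg gxy; have : hausdorff_space X by exact: one_chart_hausdorff X1.
  rewrite open_hausdorff => /(_ (g x) y) [|[A B] /= [/set_mem Ax /set_mem By] [oA oB /eqP AB]].
    exact/eqP.
  exists (g @^-1` A, B) => /=.
    split; last by exact: open_nbhs_nbhs.
    by apply: transf_continuous => //; exact: open_nbhs_nbhs.
  by move=> [a b] [/= Aga Bb] gab; have : (A `&` B) b by [split=> //; rewrite -gab]; rewrite AB.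
have sep' g : [set g | transf G g /\ g @` (K1 `|` K2) `&` (K1 `|` K2) !=set0] g ->
    \forall z \near (x, y), g x <> y -> g z.1 <> z.2.
  move=> [Gg _]; have [gxy|gxy] := pselect (g x = y); first by near=> z.
  by apply: filterS (sep g Gg gxy).
have [[A B] /= [nA nB] AB] := finite_set_near _ fF sep'.
have nA' : nbhs x (A `&` K1) by exact: filterI.
have nB' : nbhs y (B `&` K2) by exact: filterI.
move: nA' nB'; rewrite !nbhsE => -[A' [oA' A'x] sA'] [B' [oB' B'y] sB'].
exists A', B'; split=> // g Gg gxy a b /sA' [Aa Ka] /sB' [Bb Kb] gab.
apply: (AB (a, b) (conj Aa Bb) g _ gxy gab); split=> //.
by exists b; split; [exists a => //; left|right].
Unshelve. all: by end_near. Qed.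

Lemma small_open (x : X) : exists V : set X, [/\ open V, V x &
  forall g, transf G g -> g <> id -> forall a b, V a -> V b -> g a <> b].
Proof.
have [A [B [oA Ax oB Bx AB]]] := orbits_separated x x.
exists (A `&` B); split=> //; first exact: openI.
move=> g Gg gid a b [Aa _] [_ Bb]; apply: (AB g Gg) => // gx.
by apply: gid; exact: Gfree gx.
Qed.

Lemma small_open_inj (V : set X) :
  (forall g, transf G g -> g <> id -> forall a b, V a -> V b -> g a <> b) ->
  {in V &, injective (@orbit_proj X G)}.
Proof.
move=> Vg a b /set_mem Va /set_mem Vb /orbit_projP[g Gg gab].
have [gid|gid] := pselect (g = id); first by rewrite -gab gid.
by case: (Vg g Gg gid a b).
Qed.

Lemma quotient_cover (y : quotient G) : exists2 c, atlas (quotient G) c & chart_dom c y.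
Proof.
have [x <-] := orbit_proj_surj y; have [V [oV Vx Vg]] := small_open x.
pose inv z := xget x [set v | V v /\ orbit_proj G v = z].
have iV := small_open_inj Vg.
exists (@Chart R (quotient G) (@orbit_proj X G @` V) (iota \o inv)); last by exists x.
exists (Chart setT iota), V; split=> //; first by case: X1 => ->.
move=> v Vv /=; congr iota; rewrite /inv; case: xgetP => [w _ [Vw]|/(_ v)/=].
  by apply: iV; rewrite inE.
by case.
Qed.

Lemma quotient_manifold : manifold (quotient G).
Proof.
split.
- rewrite open_hausdorff => y1 y2; have [x1 <-] := orbit_proj_surj y1.
  have [x2 <-] := orbit_proj_surj y2 => xy.
  have [A [B [oA Ax oB Bx AB]]] := orbits_separated x1 x2.
  exists (@orbit_proj X G @` A, @orbit_proj X G @` B); split=> /=.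
  + by rewrite inE; exists x1.
  + by rewrite inE; exists x2.
  + exact: quotient_pi_open.
  + exact: quotient_pi_open.
  + apply/eqP/seteqP; split=> // _ [[a Aa <-] [b Bb /esym/orbit_projP[g Gg gab]]].
    apply: (AB g Gg _ a b) => // gx; move/eqP: xy; apply; apply/orbit_projP; by exists g.
- have [B cB [oB bB]] := one_chart_second_countable X1.
  exists [set @orbit_proj X G @` b | b in B]; first exact: card_le_trans (card_image_le _ _) cB.
  split=> [_ [b Bb <-]|y A]; first exact/quotient_pi_open/oB.
  have [x <-] := orbit_proj_surj y => nA.
  have /bB [b [Bb bx] sb] := @orbit_proj_continuous X G x A nA.
  exists (@orbit_proj X G @` b); first by split; [exists b|exists x].
  by move=> _ [z /sb Az <-].
- exact: quotient_good.
- exact: quotient_cover.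
(* The identity is locally the projection composed with a smooth section. *)
- apply: (smooth_on_local quotient_good quotient_good openT) => y _.
  have [x <-] := orbit_proj_surj y; have [V [oV Vx Vg]] := small_open x.
  have iV := small_open_inj Vg.
  pose s z := xget x [set v | V v /\ orbit_proj G v = z].
  have sK v : V v -> s (orbit_proj G v) = v.
    move=> Vv; rewrite /s; case: xgetP => [w _ [Vw]|/(_ v)/=[//]].
    by apply: iV; rewrite inE.
  exists (@orbit_proj X G @` V); first by split; [exact: quotient_pi_open|exists x].
  apply: (@smooth_on_eq _ _ _ _ (@orbit_proj X G \o s : quotient G -> quotient G)).
  + exact: quotient_pi_open.
  + by move=> _ [v Vv <-] /=; rewrite sK.
  + apply: (smooth_on_comp quotient_good (one_chart_good X1) quotient_good
      (one_chart_cover X1) _ openT _ (section_smooth oV iV sK) orbit_proj_smooth) => //.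
    exact: quotient_pi_open.
Qed.

End ProperAction.

(** * Covers between quotients *)

Section Induced.
Variables (R : realType) (X Y : atlas_space R) (iota : X -> 'rV[R]_3) (kappa : Y -> 'rV[R]_3).
Hypotheses (X1 : one_chart iota) (Y1 : one_chart kappa).
Variables (G : transf_group X) (H : transf_group Y).
Hypotheses (Gs : forall g, transf G g -> smooth g) (Hs : forall g, transf H g -> smooth g).
Hypotheses (Gfree : acts_freely G) (Gpd : acts_properly_discontinuously G).

Lemma induced_smooth_on (U : set (quotient G)) (F : quotient G -> quotient H) : open U ->
  (forall y, U y -> exists x (V : set X) (phi : X -> Y), [/\ orbit_proj G x = y, open V, V x,
     smooth phi & forall x', V x' -> F (orbit_proj G x') = orbit_proj H (phi x')]) ->
  smooth_on U F.
Proof.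
move=> oU FU.
have gG := quotient_good X1 Gs; have gH := quotient_good Y1 Hs.
have gX := one_chart_good X1; have gY := one_chart_good Y1.
apply: smooth_on_local => // y Uy.
have [x [V' [phi [xy oV' V'x sphi Fphi]]]] := FU y Uy.
have [W [oW Wx Wg]] := small_open X1 Gs Gfree Gpd x.
pose V := V' `&` W; have oV : open V by exact: openI.
have iV : {in V &, injective (@orbit_proj X G)}.
  by apply: small_open_inj => g Gg gid a b [_ Wa] [_ Wb]; exact: (Wg g).
pose s z := xget x [set v | V v /\ orbit_proj G v = z].
have sK v : V v -> s (orbit_proj G v) = v.
  move=> Vv; rewrite /s; case: xgetP => [w _ [Vw]|/(_ v)/=[//]].
  by apply: iV; rewrite inE.
have opV : @open (quotient G) (@orbit_proj X G @` V) by exact: (quotient_pi_open Gs).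
exists (@orbit_proj X G @` V); first by split=> //; exists x.
apply: (@smooth_on_eq _ _ _ _ ((@orbit_proj Y H : Y -> quotient H) \o (phi \o (s : quotient G -> X)))) =>
  //.
  by move=> _ [v Vv <-] /=; rewrite sK// Fphi//; case: Vv.
apply: (smooth_on_comp gG gY gH (one_chart_cover Y1) opV openT _ _ (orbit_proj_smooth Y1 Hs)) => //.
apply: (smooth_on_comp gG gX gY (one_chart_cover X1) opV openT _ (section_smooth X1 Gs oV iV sK) sphi) =>
  //.
Qed.

End Induced.

(** Greedy selection along an enumeration of [A]; the cosets [H g] that index the sheets of a cover
    are obtained in this way. *)
Lemma equiv_representatives (T : Type) (E : T -> T -> Prop) (A : set T) :
  (forall a, E a a) -> (forall a b, E a b -> E b a) -> finite_set A ->
  exists k (r : 'I_k -> T), (forall i j, E (r i) (r j) -> i = j) /\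
    (forall i, A (r i)) /\ forall a, A a -> exists i, E (r i) a.
Proof.
move=> Er Es fA; pose T' : choiceType := {classic T}.
have fA' : finite_set (A : set T') by [].
have [s sE] := (@finite_seqP T' A).1 fA'.
have [r [rs rp rE]] : exists r : seq T', [/\ {subset r <= s},
    pairwise (fun a b => ~~ `[< E a b >]) r & forall a, a \in s -> exists2 g, g \in r & E g a].
  elim: s {sE} => [|a s [r [rs rp rE]]]; first by exists [::].
  have [[g gr ga]|nr] := pselect (exists2 g, g \in r & E g a).
    exists r; split=> // [x /rs xs|b]; first by rewrite inE xs orbT.
    by rewrite inE => /orP[/eqP ->|/rE//]; exists g.
  exists (a :: r); split=> [x||b].
  - by rewrite !inE => /orP[->//|/rs ->]; rewrite orbT.
  - rewrite /= rp andbT; apply/(@allP T' _ r) => g gr; apply/asboolPn => ag.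
    by apply: nr; exists g => //; exact: Es.
  - rewrite inE => /orP[/eqP ->|/rE [g gr gb]].
      by exists a => //; rewrite mem_head.
    by exists g => //; rewrite inE gr orbT.
exists (size r), (fun i => tnth (in_tuple r) i); split; last split.
- have lt (i j : 'I_(size r)) : (i < j)%N -> E (tnth (in_tuple r) i) (tnth (in_tuple r) j) -> False.
    rewrite (tnth_nth (tnth (in_tuple r) i)) [X in E _ X](tnth_nth (tnth (in_tuple r) i)) => ij eij.
    have /(pairwiseP (tnth (in_tuple r) i)) /(_ i j) := rp.
    by rewrite !inE !ltn_ord => /(_ isT isT ij) /asboolPn; apply.
  move=> i j eij; apply/val_inj; case: (ltngtP i j) => // ij.
    by case: (lt _ _ ij).
  by case: (lt _ _ ij); exact: Es.
- by move=> i; have := rs _ (mem_tnth i (in_tuple r)); rewrite sE.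
- move=> a; rewrite sE => /rE [g gr ga].
  have gr' : (index g r < size r)%N by rewrite index_mem.
  by exists (Ordinal gr'); rewrite (tnth_nth g) /= nth_index.
Qed.

Section Covers.
Variables (R : realType) (X : atlas_space R) (iota : X -> 'rV[R]_3).
Hypothesis X1 : one_chart iota.
Variables (G H : transf_group X).
Hypothesis Gs : forall g, transf G g -> smooth g.
Hypotheses (Gfree : acts_freely G) (Gpd : acts_properly_discontinuously G).
Hypothesis HG : transf H `<=` transf G.

Let Hs h : transf H h -> smooth h. Proof. by move=> /HG; exact: Gs. Qed.

Lemma subgroup_free : acts_freely H.
Proof. by move=> g x /HG; exact: Gfree. Qed.

Lemma subgroup_pd : acts_properly_discontinuously H.
Proof.
by move=> K /Gpd; apply: sub_finite_set => g [/HG Gg ne].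
Qed.

Definition subgroup_proj (y : quotient H) : quotient G :=
  orbit_proj G (repr (y : {eq_quot orbit_equiv H}%qT)).

Lemma subgroup_projE x : subgroup_proj (orbit_proj H x) = orbit_proj G x.
Proof.
rewrite /subgroup_proj; apply/orbit_projP.
have /orbit_projP[h /HG Gh hx] : orbit_proj H (repr (orbit_proj H x : {eq_quot orbit_equiv H}%qT)) =
  orbit_proj H x.
  exact: reprK.
by exists h.
Qed.

(* The compact set [K] forces [H] to have finite index in [G]. *)
Lemma subgroup_cover (K : set X) : compact K ->
  (forall x, exists2 h, transf H h & K (h x)) -> finite_sheeted_cover subgroup_proj.
Proof.
move=> cK HK.
have pis x : orbit_proj G x = subgroup_proj (orbit_proj H x) by rewrite subgroup_projE.
have sid : smooth (@id X).
  have [aX iX] := X1; split=> [x _|c d]; first exact: cvg_id.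
  rewrite aX => -> -> /=; exists id; split=> // k; exact: class_C_id.
split.
- apply: (induced_smooth_on X1 X1 Hs Gs subgroup_free subgroup_pd openT) => y _.
  have [x <-] := orbit_proj_surj y; exists x, setT, id; split=> //; exact: openT.
- by move=> y; have [x <-] := orbit_proj_surj y; exists (orbit_proj H x); rewrite subgroup_projE.
move=> y; have [x0 x0y] := orbit_proj_surj y.
have [V [oV Vx0 Vg]] := small_open X1 Gs Gfree Gpd x0.
have iV := small_open_inj Vg.
pose s z := xget x0 [set v | V v /\ orbit_proj G v = z].
have sK v : V v -> s (orbit_proj G v) = v.
  move=> Vv; rewrite /s; case: xgetP => [w _ [Vw]|/(_ v)/=[//]].
  by apply: iV; rewrite inE.
(* Every coset [H g] has an element sending [x0] into [K], and only finitely many elements of [G] do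
   so. *)
pose A := [set g | transf G g /\ K (g x0)].
have fA : finite_set A.
  (* With [x0] added to the compact set, [K (g x0)] becomes a self-intersection under [g]. *)
  have c1 : compact [set x0] by exact: compact_set1.
  apply: sub_finite_set (Gpd (compactU cK c1)) => g [Gg Kg]; split=> //.
  by exists (g x0); split; [exists x0 => //; right|left].
pose E (g f : X -> X) := exists2 h, transf H h & h \o g = f.
have Er g : E g g by exists id => //; exact: transf_id.
have Es g f : E g f -> E f g.
  move=> [h Hh <-]; have [h' Hh' [hh' _]] := transf_inv Hh.
  by exists h' => //; apply/funext => x /=; rewrite hh'.
have [k [r [rE [rA rall]]]] := equiv_representatives Er Es fA.
have Gr i : transf G (r i) by case: (rA i).
exists (@orbit_proj X G @` V), k, (fun i z => orbit_proj H (r i (s z))).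
have opV : @open (quotient G) (@orbit_proj X G @` V) by exact: (quotient_pi_open Gs).
have sheetE i : (fun z => orbit_proj H (r i (s z))) @` (@orbit_proj X G @` V) = @orbit_proj X H @` (r i
  @` V).
  apply/seteqP; split=> [_ [_ [v Vv <-] <-]|_ [_ [v Vv <-] <-]].
    by rewrite sK//; exists (r i v) => //; exists v.
  by exists (orbit_proj G v); [exists v|rewrite sK].
split=> //.
- by exists x0.
- move=> i; split.
  + apply: (induced_smooth_on X1 X1 Gs Hs Gfree Gpd opV) => _ [v Vv <-].
    exists v, V, (r i); split=> //; first exact: Gs.
    by move=> x' Vx'; rewrite sK.
  + rewrite sheetE; apply: (quotient_pi_open Hs).
    have [g Gg [rg gr]] := transf_inv (Gr i).
    have -> : r i @` V = g @^-1` V.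
      apply/seteqP; split=> [_ [v Vv <-]|x Vgx]; first by rewrite /preimage /= rg.
      by exists (g x); rewrite // gr.
    by apply: open_comp => // z _; exact: (transf_continuous Gs).
  + by move=> _ [v Vv <-]; rewrite sK// subgroup_projE orbit_proj_transf.
- move=> i j _ _ [z []]; rewrite !sheetE => -[_ [v Vv <-] <-] [_ [w Vw <-] /orbit_projP[h Hh hE]].
  have [g Gg [rg gr]] := transf_inv (Gr i).
  have Gghr : transf G (g \o (h \o r j)).
    by apply: transf_comp => //; apply: transf_comp => //; exact: HG.
  (* When two sheets meet, this element moves a point of the small set [V] into [V]; being then the
     identity, it puts [r i] and [r j] in the same coset. *)
  have ghr : g \o (h \o r j) = id.
    apply: contrapT => nid; apply: (Vg _ Gghr nid w v) => //=.
    by rewrite hE rg.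
  apply/esym/rE; exists h => //; apply/funext => x.
  by rewrite -[LHS]gr; congr (r i _); exact: (congr1 (fun f => f x) ghr).
- apply/seteqP; split=> [z /= [v Vv]|z [i _]].
  + have [x <-] := orbit_proj_surj z; rewrite subgroup_projE => /orbit_projP[g Gg gv].
    have [h Hh Khg] := HK (g x0).
    have [i [h' Hh' h'r]] : exists i, E (r i) (h \o g).
      by apply: rall; split=> //; apply: transf_comp => //; exact: HG.
    exists i => //; rewrite sheetE; exists (r i v); first by exists v.
    rewrite -(orbit_proj_transf (r i v) Hh') -(orbit_proj_transf x Hh) -gv.
    by congr orbit_proj; exact: (congr1 (fun f => f v) h'r).
  + rewrite sheetE => -[_ [v Vv <-] <-].
    by exists v => //; rewrite subgroup_projE orbit_proj_transf.
Qed.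

End Covers.

Lemma cover_diffeo (R : realType) (M' N M : atlas_space R) (p : M' -> N) (f : N -> M) (g : M -> N) :
  manifold M' -> manifold N -> manifold M ->
  finite_sheeted_cover p -> cancel f g -> cancel g f -> smooth f -> smooth g ->
  finite_sheeted_cover (f \o p).
Proof.
move=> [_ _ gM' cM' _] [_ _ gN cN _] [_ _ gM cM _] [sp surj ev] fg gf sf sg.
have cg : continuous g by move=> x; case: sg => + _; apply.
split.
- exact: (smooth_on_comp gM' gN gM cN openT openT _ sp sf).
- by move=> y; have [x xy] := surj (g y); exists x; rewrite /= xy gf.
move=> y; have [U [k [s [oU Uy si tr pU]]]] := ev (g y).
exists (g @^-1` U), k, (fun i => s i \o g).
have E i : (s i \o g) @` (g @^-1` U) = s i @` U.
  apply/seteqP; split=> [_ [x Ux <-]|_ [u Uu <-]]; first by exists (g x).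
  by exists (f u); rewrite /preimage /= fg.
have ogU : open (g @^-1` U) by apply: open_comp => // x _; exact: cg.
split=> //.
- move=> i; have [ss os ps] := si i; split.
  + apply: (smooth_on_comp gM gN gM' cN ogU oU _ _ ss) => //.
    exact: (smooth_on_sub gM gN openT ogU _ sg).
  + by rewrite E.
  + by move=> u gu /=; rewrite ps// gf.
- by move=> i j _ _; rewrite !E; exact: tr.
- have -> : (f \o p) @^-1` (g @^-1` U) = p @^-1` U.
    by apply/seteqP; split=> x; rewrite /preimage /= fg.
  by rewrite pU; apply: eq_bigcupr => i _; rewrite E.
Qed.

(** * Quotients by conjugate groups *)

Section Conjugation.
Variables (X Y : Type) (phi : X -> Y) (psi : Y -> X).
Hypotheses (phiK : cancel phi psi) (psiK : cancel psi phi).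
Variable H : transf_group X.

Definition conj_set : set (Y -> Y) := [set g | exists2 h, transf H h & g = phi \o h \o psi].

Lemma conj_id : conj_set id.
Proof. by exists id; [exact: transf_id|apply/funext => y /=; rewrite psiK]. Qed.

Lemma conj_comp f g : conj_set f -> conj_set g -> conj_set (f \o g).
Proof.
move=> [h Hh ->] [h' Hh' ->]; exists (h \o h'); first exact: transf_comp.
by apply/funext => y /=; rewrite phiK.
Qed.

Lemma conj_inv f : conj_set f -> exists2 g, conj_set g & cancel f g /\ cancel g f.
Proof.
move=> [h Hh ->]; have [h' Hh' [hh' h'h]] := transf_inv Hh.
exists (phi \o h' \o psi); first by exists h'.
by split=> y /=; rewrite phiK ?hh' ?h'h psiK.
Qed.

Definition conj_group : transf_group Y := TransfGroup conj_id conj_comp conj_inv.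

End Conjugation.

Section ConjugateQuotients.
Variables (R : realType) (X Y : atlas_space R) (iota : X -> 'rV[R]_3) (kappa : Y -> 'rV[R]_3).
Hypotheses (X1 : one_chart iota) (Y1 : one_chart kappa).
Variables (phi : X -> Y) (psi : Y -> X).
Hypotheses (phiK : cancel phi psi) (psiK : cancel psi phi).
Hypotheses (sphi : smooth phi) (spsi : smooth psi).
Variable H : transf_group X.
Let H' := conj_group phiK psiK H.
Hypotheses (Hs : forall h, transf H h -> smooth h) (H's : forall h, transf H' h -> smooth h).
Hypotheses (Hfree : acts_freely H) (Hpd : acts_properly_discontinuously H).
Hypotheses (H'free : acts_freely H') (H'pd : acts_properly_discontinuously H').

Lemma conj_quotient_diffeomorphic : diffeomorphic (quotient H) (quotient H').
Proof.
pose F (y : quotient H) : quotient H' := orbit_proj H' (phi (repr (y : {eq_quot orbit_equiv H}%qT))).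
pose B (y : quotient H') : quotient H := orbit_proj H (psi (repr (y : {eq_quot orbit_equiv H'}%qT))).
have FE x : F (orbit_proj H x) = orbit_proj H' (phi x).
  have /orbit_projP[h Hh hx] : orbit_proj H (repr (orbit_proj H x : {eq_quot orbit_equiv H}%qT)) =
    orbit_proj H x.
    exact: reprK.
  apply/orbit_projP; exists (phi \o h \o psi); first by exists h.
  by rewrite /= phiK hx.
have BE x : B (orbit_proj H' x) = orbit_proj H (psi x).
  have /orbit_projP[_ [h Hh ->] hx] : orbit_proj H' (repr (orbit_proj H' x : {eq_quot orbit_equiv
    H'}%qT)) = orbit_proj H' x.
    exact: reprK.
  by apply/orbit_projP; exists h => //; rewrite -[in RHS]hx /= phiK.
exists F, B; split.
- by move=> y; have [x <-] := orbit_proj_surj y; rewrite FE BE phiK.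
- by move=> y; have [x <-] := orbit_proj_surj y; rewrite BE FE psiK.
- apply: (induced_smooth_on X1 Y1 Hs H's Hfree Hpd openT) => y _.
  by have [x <-] := orbit_proj_surj y; exists x, setT, phi; split=> //; exact: openT.
- apply: (induced_smooth_on Y1 X1 H's Hs H'free H'pd openT) => y _.
  by have [x <-] := orbit_proj_surj y; exists x, setT, psi; split=> //; exact: openT.
Qed.

End ConjugateQuotients.

(** * Units of real quadratic fields *)

(** Rational root theorem: clearing denominators in a monic equation makes [denq r] divide a power
    of [numq r], to which it is coprime. *)
Lemma integral_rat (R : realType) (r : rat) :
  integralOver (intr : int -> R) (ratr r) -> exists m : int, r = m%:~R.
Proof.
move=> [p pm /rootP]; pose a := numq r; pose b := denq r.
have b0 : (b%:~R : R) != 0 by rewrite intr_eq0 denq_neq0.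
have rab : ratr r = a%:~R / b%:~R :> R by [].
have [m szp] : exists m, size p = m.+1.
  by exists (size p).-1; rewrite prednK// lt0n size_poly_eq0 monic_neq0.
rewrite horner_coef size_map_inj_poly ?rmorph0//; last exact: intr_inj.
rewrite szp => e.
have {}e : \sum_(i < m.+1) p`_i * a ^+ i * b ^+ (m - i) = 0.
  apply: (@intr_inj R); rewrite rmorph_sum /= rmorph0.
  transitivity (b%:~R ^+ m * \sum_(i < m.+1) (map_poly (intr : int -> R) p)`_i * ratr r ^+ i); last by
    rewrite e mulr0.
  rewrite mulr_sumr; apply: eq_bigr => i _; rewrite !rmorphM !rmorphXn /= coef_map /= rab expr_div_n.
  have im : (i <= m)%N by rewrite -ltnS.
  have -> : (b%:~R : R) ^+ m = b%:~R ^+ (m - i) * b%:~R ^+ i by rewrite -exprD subnK.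
  have bi : (b%:~R : R) ^+ i != 0 by rewrite expf_neq0.
  move: (b%:~R ^+ i : R) (b%:~R ^+ (m - i) : R) (a%:~R ^+ i : R) ((p`_i)%:~R : R) bi => x y z t x0.
  have : x / x = 1 by rewrite divff.
  by move=> /(congr1 (fun w => y * z * t * w)) /=; lra.
have bd : (b %| a ^+ m)%Z.
  move: e; rewrite big_ord_recr /= subnn mulr1.
  have -> : p`_m = 1 by move/monicP: pm; rewrite lead_coefE szp.
  rewrite mul1r => /eqP; rewrite addrC addr_eq0 => /eqP ->; rewrite rpredN.
  by apply: rpred_sum => i _; rewrite dvdz_mull// -(subnSK (ltn_ord i)) exprS dvdz_mulr.
have ab : coprime `|a| `|b| by exact: coprime_num_den.
exists a; apply/eqP; rewrite rat_eqE; apply/eqP.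
have b1 : `|b|%N = 1%N.
  have c : coprime (`|a| ^ m) `|b| by rewrite coprimeXl.
  have : (`|b| %| gcdn (`|a| ^ m) `|b|)%N.
    by rewrite dvdn_gcd dvdnn andbT -abszX -dvdzE.
  by rewrite (eqP c) dvdn1 => /eqP.
have b1' : b = 1 by rewrite -[b]gez0_abs ?denq_ge0// b1.
by rewrite -/b b1' numq_int denq_int eqxx -/a eqxx.
Qed.

Section Quadratic.
Variables (R : realType) (n : nat).
Hypotheses (n2 : (2 <= n)%N) (sfn : squarefree n).

Let s : R := Num.sqrt n%:R.

Lemma sqrtn2 : s * s = n%:R.
Proof. by rewrite -expr2 sqr_sqrtr// ler0n. Qed.

Lemma sqrtn_gt1 : 1 < s.
Proof.
rewrite -[X in X < _](@sqrtr1 R) ltr_sqrt ?ltr1n//.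
by rewrite ltr0n (ltn_trans _ n2).
Qed.

(** The square of the denominator of [B] divides [n] times the square of its numerator, hence
    divides [n]. *)
Lemma squarefree_sqr_int (B : rat) (c : int) : n%:R * B ^+ 2 = c%:~R -> exists m : int, B = m%:~R.
Proof.
move=> e; pose p := numq B; pose q := denq B.
have q0 : (q%:~R : rat) != 0 by rewrite intr_eq0 denq_neq0.
have E : n%:Z * p ^+ 2 = c * q ^+ 2.
  rewrite !expr2; apply: (@intr_inj rat); rewrite !intrM -e -[in RHS](divq_num_den B) -/p -/q.
  have := mulfV q0; move: (q%:~R : rat) ((q%:~R)^-1 : rat) (p%:~R : rat) => x i y xi.
  have : n%:~R * y * y * (x * i) * (x * i) = n%:~R * y * y :> rat by rewrite xi !mulr1.
  by rewrite expr2 -pmulrn; lra.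
have q2n : (`|q| ^ 2 %| n)%N.
  have : (`|q| ^ 2 %| n * `|p| ^ 2)%N.
    have /(congr1 absz) := E; rewrite abszM [X in _ = X]abszM !abszX absz_nat => ->.
    exact: dvdn_mull.
  by rewrite Gauss_dvdl// coprimeXl// coprimeXr// coprime_sym; exact: coprime_num_den.
have q1 := sfn q2n; exists p.
have q1' : q = 1 by rewrite -[q]gez0_abs ?denq_ge0// q1.
by rewrite -[LHS]divq_num_den -/p -/q q1' divr1.
Qed.

Lemma sqrtn_irr (a b : rat) : ratr a + ratr b * s = 0 -> a = 0 /\ b = 0.
Proof.
move=> e; have [b0|b0] := eqVneq b 0.
  by move: e; rewrite b0 rmorph0 mul0r addr0 => /eqP; rewrite fmorph_eq0 => /eqP.
exfalso; have bR : ratr b != 0 :> R by rewrite fmorph_eq0.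
have sE : ratr b * s = - ratr a by apply/eqP; rewrite -addr_eq0 addrC e.
have E : n%:R * b ^+ 2 = a ^+ 2.
  apply: (@fmorph_inj _ R ratr); rewrite rmorphM !rmorphXn /= rmorph_nat -sqrtn2.
  by rewrite -[RHS]sqrrN -sE; lra.
have a0 : a != 0.
  apply: contra_neq b0 => a0; move: E; rewrite a0 expr0n /= => /eqP.
  by rewrite mulf_eq0 expf_eq0/= pnatr_eq0; case: n n2 => //= k _ /eqP.
(* From [n * (b / a) ^+ 2 = 1] the quotient is an integer, and then [n >= 2] would divide 1. *)
have [m bm] : exists m : int, b / a = m%:~R.
  by apply: (@squarefree_sqr_int _ 1); rewrite expr_div_n mulrA E divff// expf_neq0.
have : n%:Z * m ^+ 2 = 1.
  apply: (@intr_inj rat); rewrite rmorphM rmorphXn /= -bm expr_div_n mulrA E divff//.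
  by rewrite expf_neq0.
by move=> /(congr1 absz); rewrite abszM absz_nat /= => /eqP; rewrite muln_eq1; case: n n2 => [|[]].
Qed.

Lemma quad_coord_inj (a b c d : rat) : ratr a + ratr b * s = ratr c + ratr d * s -> a = c /\ b = d.
Proof.
move=> e; have [] := @sqrtn_irr (a - c) (b - d).
  by rewrite !rmorphB /=; lra.
by move=> /eqP; rewrite subr_eq0 => /eqP -> /eqP; rewrite subr_eq0 => /eqP.
Qed.

Lemma conjqE (a b : rat) : conjq n (ratr a + ratr b * s) = ratr a - ratr b * s.
Proof.
rewrite /conjq; case: xgetP => [w _ [c [d [/quad_coord_inj[-> ->] ->]]]//|/(_ (ratr a - ratr b * s))].
by case; exists a, b.
Qed.

Notation K := (@quad_field R n).

Lemma conjqD x y : K x -> K y -> conjq n (x + y) = conjq n x + conjq n y.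
Proof.
move=> [a [b ->]] [c [d ->]]; rewrite !conjqE.
have -> : ratr a + ratr b * Num.sqrt n%:R + (ratr c + ratr d * Num.sqrt n%:R) =
  ratr (a + c) + ratr (b + d) * s by rewrite !rmorphD /= /s; lra.
by rewrite conjqE !rmorphD /=; lra.
Qed.

Lemma conjqM x y : K x -> K y -> conjq n (x * y) = conjq n x * conjq n y.
Proof.
move=> [a [b ->]] [c [d ->]]; rewrite !conjqE -/s.
have e z : z * s * s = z * n%:R by rewrite -mulrA sqrtn2.
have -> : (ratr a + ratr b * s) * (ratr c + ratr d * s) =
  ratr (a * c + b * d * n%:R) + ratr (a * d + b * c) * s.
  rewrite !(rmorphD, rmorphM) /= rmorph_nat; have := e (ratr b * ratr d); lra.
rewrite conjqE !(rmorphD, rmorphM) /= rmorph_nat; have := e (ratr b * ratr d); lra.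
Qed.

Lemma quad_fieldD x y : K x -> K y -> K (x + y).
Proof.
move=> [a [b ->]] [c [d ->]]; exists (a + c), (b + d); rewrite !rmorphD /=; lra.
Qed.

Lemma quad_fieldM x y : K x -> K y -> K (x * y).
Proof.
move=> [a [b ->]] [c [d ->]]; exists (a * c + b * d * n%:R), (a * d + b * c).
rewrite !(rmorphD, rmorphM) /= rmorph_nat -/s.
by have := congr1 (fun x => ratr b * ratr d * x) sqrtn2; rewrite /= -/s; lra.
Qed.

Lemma quad_field_rat r : K (ratr r).
Proof. by exists r, 0; rewrite rmorph0 mul0r addr0. Qed.

Lemma quad_field_int (m : int) : K m%:~R.
Proof. by rewrite -ratr_int; exact: quad_field_rat. Qed.

Lemma quad_field_sqrt : K s.
Proof. by exists 0, 1; rewrite rmorph0 rmorph1 mul1r add0r. Qed.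

Lemma conjq_rat r : conjq n (ratr r) = ratr r :> R.
Proof. by rewrite -[X in conjq n X]addr0 -(mul0r s) -(rmorph0 ratr) conjqE rmorph0 mul0r subr0. Qed.

Lemma conjq_int (m : int) : conjq n m%:~R = m%:~R :> R.
Proof. by rewrite -ratr_int conjq_rat. Qed.

Lemma conjq_sqrt : conjq n s = - s.
Proof. by rewrite -[X in conjq n X]add0r -[X in 0 + X]mul1r -(rmorph0 ratr) -(rmorph1 ratr) conjqE
  rmorph0 rmorph1 mul1r sub0r. Qed.

Lemma omega_field : K (omega R n).
Proof.
rewrite /omega -/s; case: ifP => _; last exact: quad_field_sqrt.
have -> : (1 + s) / 2 = ratr 2^-1 * (1%:~R + s) by rewrite fmorphV rmorph_nat mulrC.
apply: quad_fieldM; first exact: quad_field_rat.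
by apply: quad_fieldD; [exact: quad_field_int|exact: quad_field_sqrt].
Qed.

Lemma conjq_omega : conjq n (omega R n) = if (n %% 4 == 1)%N then (1 - s) / 2 else - s.
Proof.
rewrite /omega -/s; case: ifP => _; last exact: conjq_sqrt.
have -> : (1 + s) / 2 = ratr 2^-1 + ratr 2^-1 * s by rewrite fmorphV rmorph_nat; lra.
by rewrite conjqE fmorphV rmorph_nat; lra.
Qed.

(* [omega] is a root of [X^2 - tr X - nm]. *)
Definition omega_tr : nat := (n %% 4 == 1)%N.
Definition omega_nm : nat := if (n %% 4 == 1)%N then (n %/ 4)%N else n.

Lemma omega_sum : omega R n + conjq n (omega R n) = omega_tr%:R.
Proof. by rewrite conjq_omega /omega /omega_tr -/s; case: ifP => _; rewrite ?mulr1n ?mulr0n; lra. Qed.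

Lemma omega_prod : omega R n * conjq n (omega R n) = - omega_nm%:R.
Proof.
rewrite conjq_omega /omega /omega_nm -/s; case: ifP => [/eqP n4|_]; last by have := sqrtn2; lra.
have nE : n%:R = 4 * (n %/ 4)%N%:R + 1 :> R.
  by rewrite {1}(divn_eq n 4) n4 natrD natrM mulrC.
by have := sqrtn2; rewrite nE; lra.
Qed.

Lemma omega_sqr : omega R n * omega R n = omega_tr%:R * omega R n + omega_nm%:R.
Proof. have := omega_prod; have := congr1 (fun x => x * omega R n) omega_sum; rewrite /=; lra. Qed.

Lemma omega_gt1 : 1 < omega R n.
Proof.
rewrite /omega -/s; case: ifP => [/eqP n4|_]; last exact: sqrtn_gt1.
by have := sqrtn_gt1; lra.
Qed.

Lemma conj_omega_lt0 : conjq n (omega R n) < 0.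
Proof.
rewrite conjq_omega; have := sqrtn_gt1; case: ifP => _; lra.
Qed.

Lemma omega_integral : integralOver (intr : int -> R) (omega R n).
Proof.
pose p : {poly int} := 'X^2 - (omega_tr%:R *: 'X + omega_nm%:R%:P).
have sz : (size (omega_tr%:R *: 'X + omega_nm%:R%:P : {poly int})%R < 3)%N.
  apply: leq_ltn_trans (size_polyD _ _) _; rewrite gtn_max; apply/andP; split.
    by rewrite ltnS (leq_trans (size_scale_leq _ _))// size_polyX.
  by rewrite ltnS (leq_trans (size_polyC_leq1 _)).
exists p.
  by rewrite monicE lead_coefDl ?lead_coefXn// size_polyXn size_polyN.
apply/rootP; rewrite /p rmorphB rmorphD /= map_polyXn map_polyZ map_polyX map_polyC /=.
by rewrite !hornerE /= !rmorph_nat expr2 omega_sqr subrr.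
Qed.

(** Conjugation is additive and multiplicative on [K] only, so the induction on [p] carries
    membership in [K] along with the identity. *)
Lemma conjq_root (p : {poly int}) z : K z -> root (map_poly intr p) z ->
  root (map_poly (intr : int -> R) p) (conjq n z).
Proof.
move=> Kz /rootP pz; apply/rootP.
suff [Kp <-] : K (map_poly intr p).[z] /\ conjq n (map_poly intr p).[z] = (map_poly intr p).[conjq n z].
  by rewrite pz (conjq_int 0).
elim/poly_ind: p {pz} => [|p c [Kp IH]]; first by rewrite rmorph0 !horner0 (conjq_int 0); split=> //;
  exact: (quad_field_int 0).
rewrite rmorphD rmorphM /= map_polyX map_polyC /= !hornerE.
split; first by apply: quad_fieldD; [exact: quad_fieldM|exact: quad_field_int].
by rewrite conjqD ?conjqM ?conjq_int ?IH//; [exact: quad_fieldM|exact: quad_field_int].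
Qed.

(** The trace and norm of an integral element are integers. With [A = 2a] and [B = 2b] this reads
    [A^2 - n B^2 = 4 N], where [B] is an integer because [n] is squarefree; the parities of [A] and
    [B] are then settled modulo 4, the residue 0 of [n] being excluded. *)
Lemma quad_intP z : quad_int n z <-> exists a b : int, z = a%:~R + b%:~R * omega R n.
Proof.
split=> [[Kz iz]|[a [b ->]]]; last first.
  split.
    apply: quad_fieldD; first exact: quad_field_int.
    by apply: quad_fieldM; [exact: quad_field_int|exact: omega_field].
  apply: integral_add; first exact: integral_id.
  by apply: integral_mul; [exact: integral_id|exact: omega_integral].
have iz' : integralOver (intr : int -> R) (conjq n z).
  by case: iz => p pm pz; exists p => //; exact: conjq_root.
have [a [b zE]] := Kz; move: iz iz'; rewrite zE conjqE -/s => iz iz'.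
have [A aA] : exists A : int, 2 * a = A%:~R.
  apply: (@integral_rat R).
  have -> : ratr (2 * a) = (ratr a + ratr b * s) + (ratr a - ratr b * s) :> R.
    by rewrite rmorphM /= rmorph_nat; lra.
  exact: integral_add.
have [N aN] : exists N : int, a ^+ 2 - n%:R * b ^+ 2 = N%:~R.
  apply: (@integral_rat R).
  have -> : ratr (a ^+ 2 - n%:R * b ^+ 2) = (ratr a + ratr b * s) * (ratr a - ratr b * s) :> R.
    rewrite !expr2 !(rmorphB, rmorphM) /= rmorph_nat.
    by have := congr1 (fun x => ratr b * ratr b * x) sqrtn2; rewrite /=; lra.
  exact: integral_mul.
have [B bB] : exists B : int, 2 * b = B%:~R.
  apply: (@squarefree_sqr_int _ (A ^+ 2 - 4 * N)).
  by rewrite !expr2 !(rmorphB, rmorphM) /= -aA -aN; lra.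
have E : A ^+ 2 - n%:Z * B ^+ 2 = 4 * N.
  rewrite !expr2; apply: (@intr_inj rat); rewrite !(rmorphB, rmorphM) /= -aA -aN -bB -pmulrn; lra.
have aR : ratr a = A%:~R / 2 :> R.
  by rewrite -(ratr_int R A) -aA rmorphM /= rmorph_nat mulrC mulKf.
have bR : ratr b = B%:~R / 2 :> R.
  by rewrite -(ratr_int R B) -bB rmorphM /= rmorph_nat mulrC mulKf.
have n4 : (n %% 4 != 0)%N.
  by apply/eqP => n4; have /sfn : (2 ^ 2 %| n)%N by rewrite /dvdn n4.
rewrite -/s aR bR /omega -/s; case: ifP => [/eqP n41|n41].
  have [C AC] : exists C : int, A = B + 2 * C.
    exists ((A - B) %/ 2)%Z; have nE := divn_eq n 4; rewrite n41 in nE.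
    have : exists k : int, A ^+ 2 - B ^+ 2 = 4 * k.
      exists (N + (n %/ 4)%N%:Z * B ^+ 2); move: E; rewrite {1}nE; lia.
    move=> [k]; nia.
  exists C, B; rewrite AC rmorphD rmorphM /=; lra.
have [[C AC] [D BD]] : (exists C : int, A = 2 * C) /\ (exists D : int, B = 2 * D).
  have [C [x [xE AC]]] : exists C x : int, (x = 0 \/ x = 1) /\ A = 2 * C + x.
    by exists (A %/ 2)%Z, (A %% 2)%Z; lia.
  have [D [y [yE BD]]] : exists D y : int, (y = 0 \/ y = 1) /\ B = 2 * D + y.
    by exists (B %/ 2)%Z, (B %% 2)%Z; lia.
  have [k [r [rE nE]]] : exists k r : int, (r = 2 \/ r = 3) /\ n%:Z = 4 * k + r.
    exists (n %/ 4)%N, (n %% 4)%N; move/eqP: n41; move/eqP: n4; lia.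
  move: E; rewrite nE AC BD !expr2 => E.
  suff [-> ->] : x = 0 /\ y = 0 by split; [exists C|exists D]; lra.
  by case: xE E => ->; case: yE => ->; case: rE => -> E; split=> //; exfalso; lia.
by exists C, D; rewrite AC BD !rmorphM /=; lra.
Qed.

Lemma quad_int_field (z : R) : quad_int n z -> K z. Proof. by case. Qed.

Lemma quad_int_int (m : int) : quad_int n (m%:~R : R).
Proof. by apply/quad_intP; exists m, 0; rewrite mul0r addr0. Qed.

Lemma quad_int_omega : quad_int n (omega R n).
Proof. by apply/quad_intP; exists 0, 1; rewrite mul1r add0r. Qed.

Lemma quad_intD (x y : R) : quad_int n x -> quad_int n y -> quad_int n (x + y).
Proof. by move=> [Kx ix] [Ky iy]; split; [exact: quad_fieldD|exact: integral_add]. Qed.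

Lemma quad_intM (x y : R) : quad_int n x -> quad_int n y -> quad_int n (x * y).
Proof. by move=> [Kx ix] [Ky iy]; split; [exact: quad_fieldM|exact: integral_mul]. Qed.

Lemma quad_intN (x : R) : quad_int n x -> quad_int n (- x).
Proof. by move=> ix; rewrite -mulN1r; apply: quad_intM => //; exact: (quad_int_int (-1)). Qed.

Lemma quad_intB (x y : R) : quad_int n x -> quad_int n y -> quad_int n (x - y).
Proof. by move=> ix iy; apply: quad_intD => //; exact: quad_intN. Qed.

Lemma quad_intX (x : R) k : quad_int n x -> quad_int n (x ^+ k).
Proof.
move=> ix; elim: k => [|k IH]; first exact: (quad_int_int 1).
by rewrite exprS; exact: quad_intM.
Qed.

Lemma conjqN x : K x -> conjq n (- x) = - conjq n x.
Proof.
by move=> Kx; rewrite -mulN1r conjqM ?(conjq_int (-1)) ?mulN1r//; exact: (quad_field_int (-1)).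
Qed.

Lemma conjqB x y : K x -> K y -> conjq n (x - y) = conjq n x - conjq n y.
Proof.
move=> Kx Ky; rewrite conjqD ?conjqN//.
by rewrite -mulN1r; apply: quad_fieldM => //; exact: (quad_field_int (-1)).
Qed.

Lemma quad_fieldX x k : K x -> K (x ^+ k).
Proof.
move=> ix; elim: k => [|k IH]; first exact: (quad_field_int 1).
by rewrite exprS; exact: quad_fieldM.
Qed.

Lemma conjqX x k : K x -> conjq n (x ^+ k) = conjq n x ^+ k.
Proof.
move=> Kx; elim: k => [|k IH]; first exact: (conjq_int 1).
by rewrite !exprS conjqM ?IH//; exact: quad_fieldX.
Qed.

Lemma conjq_coord (a b : int) :
  conjq n (a%:~R + b%:~R * omega R n) = a%:~R + b%:~R * conjq n (omega R n).
Proof.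
have Ko := omega_field; rewrite conjqD ?conjqM ?conjq_int//; try exact: quad_field_int.
by apply: quad_fieldM => //; exact: quad_field_int.
Qed.

Lemma omega_diff_gt1 : 1 < omega R n - conjq n (omega R n).
Proof. by rewrite conjq_omega /omega -/s; have := sqrtn_gt1; case: ifP => _; lra. Qed.

Lemma conjq_inj x y : K x -> K y -> conjq n x = conjq n y -> x = y.
Proof.
move=> [a [b ->]] [c [d ->]]; rewrite !conjqE => e.
have [] := @quad_coord_inj a (- b) c (- d); first by rewrite !rmorphN /=; lra.
by move=> -> /oppr_inj ->.
Qed.

Lemma finite_int (C : R) : finite_set [set m : int | `|m%:~R| <= C :> R].
Proof.
have [N CN] : exists N : nat, C <= N%:R.
  by exists (Num.bound `|C|); apply: le_trans (ler_norm C) (ltW (archi_boundP (normr_ge0 C))).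
apply: (@sub_finite_set _ _ ([set k%:Z | k in `I_N.+1] `|` [set - k%:Z | k in `I_N.+1])).
  move=> m /= mC; have : `|m| <= N%:Z.
    by rewrite -(ler_int R) intr_norm (le_trans mC).
  case: (leP 0 m) => m0 mN; [left|right]; exists `|m|%N => //=; lia.
by rewrite finite_setU; split; apply: finite_image; exact: finite_II.
Qed.

(** The integers form a lattice in the plane under the two real embeddings: the difference of the
    two images is [b * (omega - conj omega)] with [omega - conj omega > 1], so bounds on the images
    bound [b], then [a]. *)
Lemma quad_int_discrete (C : R) :
  finite_set [set z : R | [/\ quad_int n z, `|z| <= C & `|conjq n z| <= C]].
Proof.
pose f (ab : int * int) : R := ab.1%:~R + ab.2%:~R * omega R n.
pose D := C + 2 * C * omega R n.
apply: (@sub_finite_set _ _ (f @` ([set m : int | `|m%:~R| <= D :> R] `*` [set m : int | `|m%:~R| <= 2 *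
  C :> R]))); last first.
  by apply: finite_image; apply: finite_setX; exact: finite_int.
move=> z /= [/(quad_intP z).1 [a [b ->]]]; rewrite conjq_coord => zC zC'.
exists (a, b) => //; have o1 := omega_gt1; have od := omega_diff_gt1.
have bC : `|b%:~R| <= 2 * C :> R.
  apply: (@le_trans _ _ (`|b%:~R * (omega R n - conjq n (omega R n))|)).
    by rewrite normrM ler_peMr// ger0_norm; lra.
  have -> : b%:~R * (omega R n - conjq n (omega R n)) =
    (a%:~R + b%:~R * omega R n) - (a%:~R + b%:~R * conjq n (omega R n)) by lra.
  by rewrite (le_trans (ler_normB _ _))//; lra.
split=> //=.
have -> : (a%:~R : R) = (a%:~R + b%:~R * omega R n) - b%:~R * omega R n by lra.
apply: le_trans (ler_normB _ _) _; rewrite /D lerD// normrM (@ger0_norm _ (omega R n)); last lra.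
by rewrite ler_pM2r//; lra.
Qed.

(** The norm is multiplicative with integer values, so the norm of a unit is a unit of the
    integers. *)
Lemma conj_unit (u : R) : quad_unit n u -> `|u * conjq n u| = 1.
Proof.
have norm_int (x : R) : quad_int n x -> exists m : int, x * conjq n x = m%:~R.
  move=> /(quad_intP x).1 [a [b ->]]; rewrite conjq_coord.
  exists (a * a + a * b * omega_tr%:Z - b * b * omega_nm%:Z).
  rewrite !(rmorphB, rmorphD, rmorphM) /= -!pmulrn -omega_sum.
  by have := congr1 (fun x => b%:~R * b%:~R * x) omega_prod; rewrite /=; lra.
move=> [iu [w iw uw]]; have [m um] := norm_int u iu; have [k wk] := norm_int w iw.
have : m * k = 1.
  apply: (@intr_inj R); rewrite rmorphM /= -um -wk mulrACA uw mul1r -conjqM ?uw ?(conjq_int 1)//.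
    exact: quad_int_field.
  exact: quad_int_field.
move=> /(congr1 absz); rewrite abszM => /eqP; rewrite muln_eq1 => /andP[/eqP m1 _].
by rewrite um -intr_norm -abszE m1.
Qed.

Lemma unit_norm_conj (u : R) : quad_unit n u -> 1 < u -> `|conjq n u| = u^-1.
Proof.
move=> /conj_unit + u1; have u0 : 0 < u by exact: lt_trans u1.
by rewrite normrM gtr0_norm// => e; apply: (mulfI (lt0r_neq0 u0)); rewrite e divff// gt_eqF.
Qed.

Lemma quad_unitM (u v : R) : quad_unit n u -> quad_unit n v -> quad_unit n (u * v).
Proof.
move=> [iu [u' iu' uu']] [iv [v' iv' vv']]; split; first exact: quad_intM.
by exists (u' * v'); [exact: quad_intM|rewrite mulrACA uu' vv' mulr1].
Qed.

Lemma quad_unitV (u : R) : quad_unit n u -> quad_unit n u^-1.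
Proof.
move=> [iu [u' iu' uu']]; have u0 : u != 0.
  by apply/eqP => u0; move: uu'; rewrite u0 mul0r => /esym/eqP; rewrite oner_eq0.
have -> : u^-1 = u' by apply: (mulfI u0); rewrite uu' divff.
by split=> //; exists u => //; rewrite mulrC.
Qed.

Lemma quad_unit1 : quad_unit n (1 : R).
Proof. by split; [exact: (quad_int_int 1)|exists 1; [exact: (quad_int_int 1)|rewrite mulr1]]. Qed.

Lemma quad_unitX (u : R) k : quad_unit n u -> quad_unit n (u ^+ k).
Proof.
move=> iu; elim: k => [|k IH]; first exact: quad_unit1.
by rewrite exprS; exact: quad_unitM.
Qed.

Lemma finite_set_min (A : set R) : finite_set A -> A !=set0 ->
  exists2 m, A m & forall x, A x -> m <= x.
Proof.
move=> /finite_seqP[t ->]; elim: t => [|a t IH] [x0]; first by [].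
move=> _; have [[y yt]|t0] := pselect ([set` t] !=set0); last first.
  exists a; first by rewrite /= mem_head.
  by move=> x; rewrite /= inE => /orP[/eqP ->//|xt]; case: t0; exists x.
have [m mt mle] := IH (ex_intro _ y yt); have [am|ma] := leP a m.
  exists a; first by rewrite /= mem_head.
  by move=> x; rewrite /= inE => /orP[/eqP ->//|/mle]; exact: le_trans.
exists m; first by rewrite /= inE mt orbT.
by move=> x; rewrite /= inE => /orP[/eqP ->|/mle//]; exact: ltW.
Qed.

(** * The fundamental unit, from a given unit greater than 1 *)

Section FundamentalUnit.
Variable l : R.
Hypotheses (ul : quad_unit n l) (l1 : 1 < l).

(** Units in []1, l]] have conjugates of absolute value less than 1, so [quad_int_discrete] leaves
    finitely many of them, and [l] is one. Their minimum is the fundamental unit. *)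
Lemma fund_unitP : [/\ quad_unit n (fund_unit R n), 1 < fund_unit R n &
  forall z, quad_unit n z -> 1 < z -> fund_unit R n <= z].
Proof.
have fin : finite_set [set u : R | [/\ quad_unit n u, 1 < u & u <= l]].
  apply: sub_finite_set (quad_int_discrete l) => u [uu u1 ul'].
  split; first by case: uu.
    by rewrite gtr0_norm// (lt_trans ltr01).
  rewrite unit_norm_conj// (le_trans _ (ltW l1))// invf_le1 ?ltW//.
  exact: lt_trans u1.
have [e [ue e1 el] emin] := finite_set_min fin (ex_intro _ l (And3 ul l1 (lexx l))).
have : [set e | [/\ quad_unit n e, 1 < e & forall z, quad_unit n z -> 1 < z -> e <= z]] e.
  split=> // z uz z1; have [zl|lz] := leP z l; first exact: emin.
  exact: le_trans el (ltW lz).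
by move=> he; rewrite /fund_unit; case: xgetP => [//|/(_ e)].
Qed.

(** If [e ^+ j.+1] is the first power above [l], then [l / e ^+ j] is a unit in [[1, e[], hence
    equals 1. *)
Lemma unit_power_fund_unit : exists2 j : nat, (0 < j)%N & l = fund_unit R n ^+ j.
Proof.
have [ue e1 emin] := fund_unitP; set e := fund_unit R n in ue e1 emin *.
have e0 : 0 < e by exact: lt_trans e1.
have [N lN] : exists N, l < e ^+ N.
  have d0 : 0 < e - 1 by lra.
  exists (Num.bound (l / (e - 1))).
  have := @archi_boundP _ (l / (e - 1)); set N := Num.bound _ => /(_ _).
  have l0 : 0 <= l / (e - 1) by rewrite divr_ge0 ?ltW// (lt_trans _ l1).
  move=> /(_ l0); rewrite ltr_pdivrMr// => h; apply: (lt_le_trans h).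
  have -> : e ^+ N = (1 + (e - 1)) ^+ N by congr (_ ^+ _); lra.
  (* Bernoulli's inequality. *)
  elim: {h} N => [|N IH]; first by rewrite mul0r.
  have X1 : 1 <= (1 + (e - 1)) ^+ N by apply: exprn_ege1; lra.
  rewrite exprS -natr1; move: IH X1; move: ((1 + (e - 1)) ^+ N) => X IH X1.
  have : 0 <= (e - 1) * (X - 1) by apply: mulr_ge0; lra.
  by lra.
have [j lj jmin] := ex_minnP (ex_intro (fun N => l < e ^+ N) N lN).
case: j lj jmin => [|j] lj jmin; first by exfalso; move: lj; rewrite expr0 => lj; have := lt_trans l1 lj;
  rewrite ltxx.
have ej0 : 0 < e ^+ j by exact: exprn_gt0.
have ejl : e ^+ j <= l.
  by rewrite leNgt; apply/negP => /jmin; rewrite ltnn.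
have uq : quad_unit n (l / e ^+ j) by apply: quad_unitM => //; exact/quad_unitV/quad_unitX.
have lE : l = e ^+ j.
  apply: contrapT => ne; have : e <= l / e ^+ j.
    apply: emin => //; rewrite ltr_pdivlMr// mul1r lt_neqAle ejl andbT eq_sym.
    exact/eqP.
  by rewrite ler_pdivlMr// -exprS leNgt lj.
exists j => //; rewrite lt0n; apply/eqP => j0; move: lE l1; rewrite j0 expr0 => ->.
by rewrite ltxx.
Qed.

End FundamentalUnit.

End Quadratic.

(** * The cusp group *)

Lemma smooth_one_chart (R : realType) (X Y : atlas_space R) (iota : X -> 'rV[R]_3)
    (kappa : Y -> 'rV[R]_3) (phi : X -> Y) (t : 'rV[R]_3 -> 'rV[R]_3) :
  one_chart iota -> one_chart kappa -> class_Coo (range iota) t ->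
  (forall x, t (iota x) = kappa (phi x)) -> smooth phi.
Proof.
move=> X1 Y1 ct tE.
have oX : open (range iota) by exact: (one_chart_open X1 openT).
have cphi : continuous phi.
  apply/continuousP => B oB.
  have -> : phi @^-1` B = iota @^-1` (range iota `&` t @^-1` (kappa @` B)).
    apply/seteqP; split=> x; rewrite /preimage /=.
      by move=> Bx; split; [exists x|exists (phi x)].
    by move=> [_ [y By]]; rewrite tE => /(one_chart_inj Y1) <-.
  apply: open_comp => [x _|]; first exact: (one_chart_cont X1).
  apply: open_preimage_on => //; first exact: (one_chart_open Y1).
  exact: (ct 0%N).
split=> [x _|c d]; first exact: cphi.
have [-> _] := X1; have [-> _] := Y1 => -> -> /=; exists t; split=> //.
by move=> k; apply: class_C_sub (ct k) => _ [x _ <-]; exists x.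
Qed.

Lemma class_Coo_affine (R : realType) (U : set 'rV[R]_3) (a b c u v w : R) : open U ->
  class_Coo U (fun x : 'rV[R]_3 => vec3 (a * x 0 i1 + u) (b * x 0 i2 + v) (c * x 0 i3 + w)).
Proof.
move=> oU k; apply: class_C_rV => // j.
have aff d (e : R) i : class_C k U (fun x : 'rV[R]_3 => d * x 0 i + e).
  apply: (class_CD oU); last exact: class_C_cst.
  by apply: class_CM_cst => //; apply: class_C_coord => //; exact: class_C_id.
move: j; apply: I3P.
- by apply: class_C_eqon (aff a u i1) => // x _; rewrite vec3E.
- by apply: class_C_eqon (aff b v i2) => // x _; rewrite vec3E.
- by apply: class_C_eqon (aff c w i3) => // x _; rewrite vec3E.
Qed.

Lemma compact_bound (R : realType) (T : topologicalType) (K : set T) (f : T -> R) :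
  compact K -> continuous f -> exists C, forall x, K x -> `|f x| <= C.
Proof.
move=> cK cf; have : compact (f @` K).
  by apply: continuous_compact => //; exact: continuous_subspaceT.
move=> /compact_bounded [M [_ hM]]; exists (M + 1) => x Kx.
by apply: (hM (M + 1)); [rewrite ltrDl|exists x].
Qed.

Section CuspGroup.
Variable R : realType.
Notation X := (cusp_space R).
Notation iota := (set_val : X -> 'rV[R]_3).

Lemma upper_open : open (@upper R).
Proof.
have -> : @upper R = (fun p : 'rV[R]_3 => p 0 i3) @^-1` [set y | 0 < y] by [].
by apply: open_comp; [move=> x _; exact: coord_continuous|exact: open_gt].
Qed.

Lemma range_iota : range iota = @upper R.
Proof.
apply/seteqP; split=> [_ [p _ <-]|p up]; first exact: upper_gt0.
by exists (exist _ p (mem_set up)).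
Qed.

Lemma cusp_space_one_chart : one_chart iota.
Proof.
split=> //; split=> /=; [exact: openT|by move=> x y _ _; exact: val_inj|].
move=> A _; split.
  move=> [B oB <-].
  have -> : iota @` (iota @^-1` B) = B `&` @upper R.
    apply/seteqP; split=> [_ [x Bx <-]|x [Bx ux]]; first by split=> //; exact: upper_gt0.
    by exists (exist _ x (mem_set ux)).
  by apply: openI => //; exact: upper_open.
move=> oA; exists (iota @` A) => //.
by apply/seteqP; split=> [x [y Ay /val_inj <-]//|x Ax]; exists x.
Qed.

Variable n : nat.
Hypotheses (n2 : (2 <= n)%N) (sfn : squarefree n).
Notation eps := (fund_unit R n).
(** [fund_unit] has a default value, so being a unit is carried as a hypothesis; [fund_unitP]
    provides it once the unit [mu] is at hand. *)
Hypothesis ueps : quad_unit n eps.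
Notation conj := (@conjq R n).

Let e1 : 1 < eps := fund_unit_gt1 R n.
Let e0 : 0 < eps := lt_trans ltr01 e1.
Let E : R := eps ^+ 2.

Lemma E_gt1 : 1 < E. Proof. by rewrite /E expr2 mulr_egt1. Qed.
Lemma E_gt0 : 0 < E. Proof. exact: lt_trans E_gt1. Qed.
Lemma E_neq0 : E != 0. Proof. by rewrite gt_eqF// E_gt0. Qed.

Lemma E_int : quad_int n E. Proof. by apply: quad_intX => //; case: ueps. Qed.

(** Squaring removes a sign: [eps] may have norm [-1], but [E] has norm 1. *)
Lemma conj_E : conj E = E^-1.
Proof.
rewrite /E conjqX//; last by apply: quad_int_field; case: ueps.
by rewrite -real_normK ?num_real// unit_norm_conj// exprVn.
Qed.

Lemma EV_int : quad_int n E^-1.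
Proof. by have := quad_unitV (quad_unitX n2 sfn 2 ueps); case. Qed.

Lemma conj_EV : conj E^-1 = E.
Proof.
have KE := quad_int_field E_int; have KEV := quad_int_field EV_int.
have := conjqM n2 sfn KE KEV; rewrite divff ?E_neq0// conj_E (conjq_int R n2 sfn 1).
move=> h; apply: (mulfI (invr_neq0 E_neq0)); rewrite -h mulVf//; exact: E_neq0.
Qed.

Lemma Ez_gt0 (j : int) : 0 < E ^ j. Proof. exact/exprz_gt0/E_gt0. Qed.

Lemma EzD (i j : int) : E ^ (i + j) = E ^ i * E ^ j.
Proof. by rewrite expfzDr// E_neq0. Qed.

Lemma EzN (j : int) : E ^ (- j) = (E ^ j)^-1.
Proof. by rewrite -invr_expz. Qed.

Lemma Ez_quad (j : int) : quad_int n (E ^ j) /\ conj (E ^ j) = E ^ (- j).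
Proof.
case: j => m.
  split; first exact: quad_intX E_int.
  by rewrite -exprnP conjqX ?conj_E ?exprVn ?EzN//; exact/quad_int_field/E_int.
rewrite NegzE EzN opprK -exprnP -exprVn; split; first exact: quad_intX EV_int.
by rewrite conjqX ?conj_EV//; exact/quad_int_field/EV_int.
Qed.

Lemma Ez_eq1 (j : int) : E ^ j = 1 -> j = 0.
Proof.
have P (m : nat) : E ^+ m.+1 != 1 by rewrite gt_eqF// exprn_egt1// E_gt1.
case: j => [[|m]|m] //; first by move/eqP; rewrite -exprnP (negbTE (P m)).
rewrite NegzE EzN -exprnP => h; have := P m.
by rewrite -(invrK (E ^+ m.+1)) h invr1 eqxx.
Qed.

(** The product of [tau z] and the [j]-th power of [eta]. These normal forms exhaust the cusp group
    because the integers are stable under multiplication by powers of [E]. *)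
Definition celem (z : R) (j : int) : X -> X :=
  @affine_upper R (E ^ j) (E ^ (- j)) (E ^ j * E ^ j) z (conj z) (mulr_gt0 (Ez_gt0 j) (Ez_gt0 j)).

Lemma celemE z j p : iota (celem z j p) =
  vec3 (E ^ j * iota p 0 i1 + z) (E ^ (- j) * iota p 0 i2 + conj z) (E ^ j * E ^ j * iota p 0 i3).
Proof. by []. Qed.

Lemma fun_upper_eq (f g : X -> X) : (forall p, iota (f p) = iota (g p)) -> f = g.
Proof. by move=> fg; apply/funext => p; apply: val_inj; exact: fg. Qed.

Lemma conj0 : conj 0 = 0. Proof. exact: (conjq_int R n2 sfn 0). Qed.

Lemma tauE z p : iota (tau n z p) =
  vec3 (1 * iota p 0 i1 + z) (1 * iota p 0 i2 + conj z) (1 * iota p 0 i3).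
Proof. by []. Qed.

Lemma etaE p : iota (@Defs.eta R n p) = vec3 (eps ^+ 2 * iota p 0 i1 + 0) (eps ^- 2 * iota p 0 i2 + 0)
  (eps ^+ 4 * iota p 0 i3).
Proof. by []. Qed.

Lemma celem_tau z : tau n z = celem z 0.
Proof.
by apply: fun_upper_eq => p; rewrite celemE tauE oppr0 expr0z mulr1.
Qed.

Lemma celem_eta : @Defs.eta R n = celem 0 1.
Proof.
apply: fun_upper_eq => p; rewrite celemE etaE EzN !expr1z conj0.
by rewrite /E -exprD.
Qed.

Lemma celem_id : id = celem 0 0.
Proof.
by apply: fun_upper_eq => p; rewrite celemE oppr0 expr0z conj0 !mul1r !addr0 vec3_eta.
Qed.

Lemma celem_comp z w i j : quad_int n z -> quad_int n w ->
  celem z i \o celem w j = celem (z + E ^ i * w) (i + j).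
Proof.
move=> iz iw; have [iE cE] := Ez_quad i.
apply: fun_upper_eq => p; rewrite /= !celemE !vec3E conjqD//; last 2 first.
- exact: quad_int_field.
- by apply: quad_fieldM => //; exact: quad_int_field.
rewrite conjqM//; [|exact: quad_int_field|exact: quad_int_field].
by rewrite cE opprD !EzD; congr vec3; lra.
Qed.

Lemma celem_inv z j : quad_int n z -> celem (- (E ^ (- j) * z)) (- j) \o celem z j = id /\
  celem z j \o celem (- (E ^ (- j) * z)) (- j) = id.
Proof.
move=> iz; have [iE _] := Ez_quad (- j).
have iw : quad_int n (- (E ^ (- j) * z)) by apply: quad_intN => //; exact: quad_intM.
rewrite !celem_comp// addNr subrr addNr mulrN mulrA -EzD subrr expr0z mul1r subrr.
by rewrite -celem_id.
Qed.

Lemma cusp_groupP g : transf (cusp_group R n) g <->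
  exists z j, quad_int n z /\ g = celem z j.
Proof.
split.
  elim=> {g} [f [[z iz ->]|->]||f g _ [z [i [iz ->]]] _ [w [j [iw ->]]]|f g _ [z [j [iz ->]]] fK gK].
  - by exists z, 0; rewrite celem_tau.
  - by exists 0, 1; rewrite celem_eta; split=> //; exact: (quad_int_int R n2 sfn 0).
  - by exists 0, 0; rewrite celem_id; split=> //; exact: (quad_int_int R n2 sfn 0).
  - exists (z + E ^ i * w), (i + j); rewrite celem_comp//; split=> //.
    apply: quad_intD => //; apply: quad_intM => //; by have [] := Ez_quad i.
  - exists (- (E ^ (- j) * z)), (- j); split.
      by apply: quad_intN => //; apply: quad_intM => //; have [] := Ez_quad (- j).
    have [_ h] := celem_inv j iz; apply/funext => p.
    by rewrite -[in RHS](gK p) -[RHS]/((celem _ _ \o celem _ _) (g p)); have [-> _] := celem_inv j iz.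
move=> [z [j [iz ->]]].
have i0 : quad_int n (0 : R) by exact: (quad_int_int R n2 sfn 0).
have -> : celem z j = tau n z \o celem 0 j.
  by rewrite celem_tau celem_comp// mulr0 addr0 add0r.
apply: generated_comp; first by apply: generated_gen; left; exists z.
have pos (m : nat) : generated (@cusp_gens R n) (celem 0 m).
  elim: m => [|m IH]; first by rewrite -celem_id; exact: generated_id.
  have -> : celem 0 m.+1 = @Defs.eta R n \o celem 0 m.
    by rewrite celem_eta celem_comp// mulr0 addr0 intS.
  by apply: generated_comp => //; apply: generated_gen; right.
case: j => m; first exact: pos.
rewrite NegzE; have [h1 h2] := celem_inv m.+1 i0.
move: h1 h2; rewrite mulr0 oppr0 => h1 h2.
by apply: (generated_inv (pos m.+1)) => p; [exact: (congr1 (fun f => f p) h1)|exact: (congr1 (fun f => f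
  p) h2)].
Qed.

Lemma celem_fix z j p : celem z j p = p -> z = 0 /\ j = 0.
Proof.
move=> /(congr1 iota); rewrite celemE => h.
have := congr1 (fun v : 'rV[R]_3 => v 0 i3) h; rewrite /= vec3E => h3.
have k0 := upper_gt0 p.
have E2 : E ^ j * E ^ j = 1 by apply: (mulIf (lt0r_neq0 k0)); rewrite h3 mul1r.
have j0 : j = 0.
  have /Ez_eq1 : E ^ (j + j) = 1 by rewrite EzD.
  by move=> jj; lia.
have := congr1 (fun v : 'rV[R]_3 => v 0 i1) h; rewrite /= vec3E j0 expr0z => h1.
by split=> //; lra.
Qed.

Lemma cusp_free : acts_freely (cusp_group R n).
Proof.
move=> g p /cusp_groupP[z [j [_ ->]]] /celem_fix[-> ->].
by rewrite -celem_id.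
Qed.

Lemma cusp_smooth g : transf (cusp_group R n) g -> smooth g.
Proof.
move=> /cusp_groupP[z [j [_ ->]]].
apply: (smooth_one_chart cusp_space_one_chart cusp_space_one_chart
  (@class_Coo_affine R (range iota) (E ^ j) (E ^ (- j)) (E ^ j * E ^ j) z (conj z) 0 _)).
  by rewrite range_iota; exact: upper_open.
by move=> p; rewrite celemE addr0.
Qed.

Lemma cusp_coord_bound (K : set X) : compact K -> exists2 C : R, 0 < C &
  forall p, K p -> [/\ `|iota p 0 i1| <= C, `|iota p 0 i2| <= C, iota p 0 i3 <= C & (iota p 0 i3)^-1 <= C].
Proof.
move=> cK; have ci := one_chart_cont cusp_space_one_chart.
have cc (i : 'I_3) : continuous (fun p : X => iota p 0 i).
  by move=> p; apply: (@continuous_comp _ _ _ iota (fun v : 'rV[R]_3 => v 0 i)); [exact: ci|exact: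
    coord_continuous].
have [C1 h1] := compact_bound cK (cc i1); have [C2 h2] := compact_bound cK (cc i2).
have [C3 h3] := compact_bound cK (cc i3).
have cV : continuous (fun p : X => (iota p 0 i3)^-1).
  by move=> p; have k0 := lt0r_neq0 (upper_gt0 p); exact: (cvgV k0 (cc i3 p)).
have [C4 h4] := compact_bound cK cV.
exists (`|C1| + `|C2| + `|C3| + `|C4| + 1) => [|p Kp].
  by rewrite ltr_wpDl// !addr_ge0.
have := h1 p Kp; have := h2 p Kp; have := h3 p Kp; have := h4 p Kp.
have := ler_norm C1; have := ler_norm C2; have := ler_norm C3; have := ler_norm C4.
have := normr_ge0 C1; have := normr_ge0 C2; have := normr_ge0 C3; have := normr_ge0 C4.
have := ler_norm (iota p 0 i3); have := ler_norm (iota p 0 i3)^-1.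
move: (`|C1|) (`|C2|) (`|C3|) (`|C4|) => c1 c2 c3 c4 *; split; lra.
Qed.

Lemma cusp_pd : acts_properly_discontinuously (cusp_group R n).
Proof.
move=> K cK; have [C C0 KC] := cusp_coord_bound cK.
pose D := C + C * C.
pose A := [set z : R | [/\ quad_int n z, `|z| <= D & `|conj z| <= D]].
have fA : finite_set A by exact: quad_int_discrete.
(* An element is encoded by the pair [(E ^ j, z)], from which [xget] recovers [j]. Both entries are
   integers of [K] bounded together with their conjugates, so there are finitely many such pairs. *)
pose B (yz : R * R) : X -> X := celem yz.2 (xget 0 [set j : int | yz.1 = E ^ j]).
apply: (@sub_finite_set _ _ (B @` (A `*` A))); last by apply: finite_image; exact: finite_setX.
move=> g [/cusp_groupP[z [j [iz gE]]] [_ [[p Kp <-] Kgp]]].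
have [p1 p2 p3 p3'] := KC _ Kp; have := KC _ Kgp; rewrite gE celemE !vec3E => -[q1 q2 q3 q3'].
have k0 := upper_gt0 p; set k := iota p 0 i3 in p3 p3' q3 q3' k0.
have y0 := Ez_gt0 j; have y0' := Ez_gt0 (- j).
have sq_le y : 0 < y -> y * y <= C * C -> y <= C.
  by move=> y_0 yC; rewrite leNgt; apply/negP => Cy; have := ltr_pM (ltW C0) (ltW C0) Cy Cy; lra.
have yC : E ^ j <= C.
  apply: sq_le => //; apply: le_trans (_ : C * k^-1 <= _); last by apply: ler_wpM2l => //; exact: ltW.
  by rewrite ler_pdivlMr.
have yC' : E ^ (- j) <= C.
  apply: sq_le => //; apply: le_trans (_ : C * k <= _); last by apply: ler_wpM2l => //; exact: ltW.
  move: q3'; rewrite !EzN invfM -/k; set y := (E ^ j)^-1 => q3'.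
  rewrite -ler_pdivrMr//; move: q3'; rewrite invfM -/y; lra.
have CC0 : 0 < C * C by exact: mulr_gt0.
have zD y x : 0 < y -> y <= C -> `|x| <= C -> `|y * x| <= C * C.
  move=> y_0 y_C xC; rewrite normrM (gtr0_norm y_0).
  by apply: ler_pM => //; exact: ltW.
exists (E ^ j, z).
  split; split=> //=.
  - by have [] := Ez_quad j.
  - by rewrite gtr0_norm// /D; lra.
  - by have [_ ->] := Ez_quad j; rewrite gtr0_norm// /D; lra.
  - have -> : z = (E ^ j * iota p 0 i1 + z) - E ^ j * iota p 0 i1 by lra.
    by apply: le_trans (ler_normB _ _) _; rewrite /D lerD// zD.
  - have -> : conj z = (E ^ (- j) * iota p 0 i2 + conj z) - E ^ (- j) * iota p 0 i2 by lra.
    by apply: le_trans (ler_normB _ _) _; rewrite /D lerD// zD.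
rewrite /B /=; case: xgetP => [i _ /= Ei|/(_ j)/(_ erefl)//]; congr celem; apply/eqP; rewrite eq_sym
  -subr_eq0; apply/eqP/Ez_eq1.
by rewrite EzD Ei -EzD subrr expr0z.
Qed.

Lemma cusp_manifold : manifold (cusp_section R n).
Proof. exact: (quotient_manifold cusp_space_one_chart cusp_smooth cusp_free cusp_pd). Qed.

End CuspGroup.

(** * The fundamental domain *)

Section Selling.
Variable R : realType.
Variables x1 x2 k : R.

(* Nonnegative iff [(x1, x2)] is at least as close to [0] as to [(- z, - z')]
   for the norm [x1^2 + k^2 x2^2]. *)
Definition dirichlet (z z' : R) : R := 2 * z * x1 + z ^+ 2 + k ^+ 2 * (2 * z' * x2 + z' ^+ 2).

Ltac ring_lra := repeat match goal with H : is_true _ |- _ => clear H end; lra.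

Definition inner (u u' v v' : R) : R := u * v + k ^+ 2 * (u' * v').

(** With [|u|^2 = inner u u' u u'], the value is [a] times that at [u] plus [b] times that at [v],
    plus [(a^2 - a) |u|^2 + (b^2 - b) |v|^2 + 2 a b <u, v>]; for natural coefficients the remaining
    terms are nonnegative. *)
Lemma dirichlet_cone (u u' v v' : R) (a b : nat) :
  0 <= dirichlet u u' -> 0 <= dirichlet v v' -> 0 <= inner u u' v v' ->
  0 <= dirichlet (a%:R * u + b%:R * v) (a%:R * u' + b%:R * v').
Proof.
rewrite /dirichlet /inner => du dv uv.
have sq (m : nat) : (m%:R : R) <= m%:R ^+ 2.
  case: m => [|m]; first by rewrite expr0n.
  by rewrite expr2 ler_peMr// ?ler1n.
have nu : 0 <= u ^+ 2 + k ^+ 2 * u' ^+ 2 by apply: addr_ge0; [exact: sqr_ge0|apply: mulr_ge0; exact: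
  sqr_ge0].
have nv : 0 <= v ^+ 2 + k ^+ 2 * v' ^+ 2 by apply: addr_ge0; [exact: sqr_ge0|apply: mulr_ge0; exact:
  sqr_ge0].
have a0 : 0 <= a%:R :> R by []; have b0 : 0 <= b%:R :> R by [].
have h1 := mulr_ge0 a0 du; have h2 := mulr_ge0 b0 dv; have h3 := mulr_ge0 (mulr_ge0 a0 b0) uv.
have a2 : 0 <= a%:R ^+ 2 - a%:R :> R by rewrite subr_ge0.
have b2 : 0 <= b%:R ^+ 2 - b%:R :> R by rewrite subr_ge0.
have h4 := mulr_ge0 a2 nu; have h5 := mulr_ge0 b2 nv.
move: h1 h2 h3 h4 h5; rewrite !expr2; lra.
Qed.

(* The six vectors of an obtuse superbase [u, v, - u - v] cut the plane into
   six acute cones. *)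
Lemma dirichlet_superbase (u u' v v' : R) (a b : int) :
  0 <= dirichlet u u' -> 0 <= dirichlet (- u) (- u') ->
  0 <= dirichlet v v' -> 0 <= dirichlet (- v) (- v') ->
  0 <= dirichlet (u + v) (u' + v') -> 0 <= dirichlet (- (u + v)) (- (u' + v')) ->
  inner u u' v v' <= 0 -> 0 <= inner (u + v) (u' + v') u u' -> 0 <= inner (u + v) (u' + v') v v' ->
  0 <= dirichlet (a%:~R * u + b%:~R * v) (a%:~R * u' + b%:~R * v').
Proof.
move=> du du_ dv dv_ dw dw_ uv wu wv.
have wu_ : 0 <= inner (- (u + v)) (- (u' + v')) (- u) (- u') by move: wu; rewrite /inner; lra.
have wv_ : 0 <= inner (- (u + v)) (- (u' + v')) (- v) (- v') by move: wv; rewrite /inner; lra.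
have uv1 : 0 <= inner u u' (- v) (- v') by move: uv; rewrite /inner; lra.
have uv2 : 0 <= inner (- u) (- u') v v' by move: uv; rewrite /inner; lra.
have cone (s s' t t' : R) (c d : nat) : 0 <= dirichlet s s' -> 0 <= dirichlet t t' ->
    0 <= inner s s' t t' -> a%:~R * u + b%:~R * v = c%:R * s + d%:R * t ->
    a%:~R * u' + b%:~R * v' = c%:R * s' + d%:R * t' ->
    0 <= dirichlet (a%:~R * u + b%:~R * v) (a%:~R * u' + b%:~R * v').
  by move=> ds dt st -> ->; exact: dirichlet_cone.
have cast (i : int) : 0 <= i -> (`|i|%N%:R : R) = i%:~R by move=> i0; rewrite natr_absz ger0_norm.
have [a0|a0] := leP 0 a; have [b0|b0] := leP 0 b.
- have [ab|ab] := leP b a.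
    have e1 := cast _ b0; have e2 : (`|a - b|%N%:R : R) = (a - b)%:~R by apply: cast; rewrite subr_ge0.
    by apply: (cone _ _ _ _ `|b|%N `|a - b|%N dw du wu); rewrite e1 e2 rmorphB /=; ring_lra.
  have e1 := cast _ a0; have e2 : (`|b - a|%N%:R : R) = (b - a)%:~R by apply: cast; rewrite subr_ge0 ltW.
  by apply: (cone _ _ _ _ `|a|%N `|b - a|%N dw dv wv); rewrite e1 e2 rmorphB /=; ring_lra.
- have e1 := cast _ a0; have e2 : (`|- b|%N%:R : R) = (- b)%:~R by apply: cast; rewrite oppr_ge0 ltW.
  by apply: (cone _ _ _ _ `|a|%N `|- b|%N du dv_ uv1); rewrite e1 e2 rmorphN /=; ring_lra.
- have e1 : (`|- a|%N%:R : R) = (- a)%:~R by [apply: cast; rewrite oppr_ge0 ltW]; have e2 := cast _ b0.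
  by apply: (cone _ _ _ _ `|- a|%N `|b|%N du_ dv uv2); rewrite e1 e2 rmorphN /=; ring_lra.
- have [ab|ab] := leP a b.
    have e1 : (`|- b|%N%:R : R) = (- b)%:~R by apply: cast; rewrite oppr_ge0 ltW.
    have e2 : (`|b - a|%N%:R : R) = (b - a)%:~R by apply: cast; rewrite subr_ge0.
    by apply: (cone _ _ _ _ `|- b|%N `|b - a|%N dw_ du_ wu_); rewrite e1 e2 rmorphB rmorphN /=; ring_lra.
  have e1 : (`|- a|%N%:R : R) = (- a)%:~R by apply: cast; rewrite oppr_ge0 ltW.
  have e2 : (`|a - b|%N%:R : R) = (a - b)%:~R by apply: cast; rewrite subr_ge0 ltW.
  by apply: (cone _ _ _ _ `|- a|%N `|a - b|%N dw_ dv_ wv_); rewrite e1 e2 rmorphB rmorphN /=; ring_lra.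
Qed.

End Selling.

(** * The chain of bases and the sufficiency of the list [L] *)

Section Chain.
Variables (R : realType) (n : nat).
Hypotheses (n2 : (2 <= n)%N) (sfn : squarefree n).
Notation eps := (fund_unit R n).
Hypothesis ueps : quad_unit n eps.
Notation conj := (@conjq R n).
Notation om := (omega R n).
Notation z_ i := (zpair R n i).1.
Notation z'_ i := (zpair R n i).2.

Lemma zpairS i : zpair R n i.+1 = (z_ i + z'_ i, if `|conj (z_ i)| < `|conj (z'_ i)| then z_ i else z'_ i).
Proof. by rewrite /=; case: (zpair R n i). Qed.

Let conj1 : conj 1 = 1. Proof. exact: (conjq_int R n2 sfn 1). Qed.

(** The sign conditions make [inner k] of the pair change sign exactly once as [k] runs over the
    positive reals. *)
Definition good_basis (u v : R) := [/\ quad_int n u, quad_int n v, 0 < u, 0 < v & conj u * conj v < 0] /\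
  forall z, quad_int n z -> exists a b : int, z = a%:~R * u + b%:~R * v.

(** The conjugate of the sum has the sign of the larger of the two conjugates, and the vector kept
    is the other one, so the signs stay opposite. A tie would give [conj (u + v) = 0], which is
    impossible as [u + v > 0]. *)
Lemma zpair_basis i : good_basis (z_ i) (z'_ i).
Proof.
elim: i => [|i [[iu iv u0 v0 uv] basis]].
  split; last by move=> z /quad_intP[]// a [b ->]; exists a, b; rewrite mulr1.
  split=> //=.
  - exact: (quad_int_int R n2 sfn 1).
  - exact: quad_int_omega.
  - exact: lt_trans (omega_gt1 R n2).
  - by rewrite conj1 mul1r; exact: conj_omega_lt0.
have Ku := quad_int_field iu; have Kv := quad_int_field iv.
rewrite zpairS /=; set u := z_ i in iu u0 uv basis Ku *; set v := z'_ i in iv v0 uv basis Kv *.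
case: ifP => h; split.
- split=> //; [exact: quad_intD|exact: addr_gt0|].
  rewrite conjqD//; move: h uv; move: (conj u) (conj v) => x y h xy.
  have [x0|x0] := ltP x 0.
    have y0 : 0 < y by rewrite -(nmulr_rlt0 _ x0).
    by move: h; rewrite ltr0_norm// gtr0_norm// => h; nra.
  have {}x0 : 0 < x by rewrite lt_neqAle x0 andbT eq_sym; apply: contraTneq xy => ->; rewrite mul0r ltxx.
  have y0 : y < 0 by rewrite -(pmulr_rlt0 _ x0).
  by move: h; rewrite (gtr0_norm x0) ltr0_norm// => h; nra.
- move=> z /basis[a [b ->]]; exists b, (a - b); rewrite rmorphB /=; lra.
- split=> //; [exact: quad_intD|exact: addr_gt0|].
  have ne : conj (u + v) != 0.
    apply/eqP => c0; have e : conj (u + v) = conj 0 by rewrite c0 (conjq_int R n2 sfn 0).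
    have /eqP := conjq_inj n2 sfn (quad_fieldD Ku Kv) (quad_field_int R n 0) e.
    by rewrite gt_eqF// addr_gt0.
  move: ne; rewrite conjqD//; move/negbT: h; rewrite -leNgt; move: uv; move: (conj u) (conj v) => x y xy
    h ne.
  have [x0|x0] := ltP x 0.
    have y0 : 0 < y by rewrite -(nmulr_rlt0 _ x0).
    by move: h; rewrite (ltr0_norm x0) gtr0_norm// => h; nra.
  have {}x0 : 0 < x by rewrite lt_neqAle x0 andbT eq_sym; apply: contraTneq xy => ->; rewrite mul0r ltxx.
  have y0 : y < 0 by rewrite -(pmulr_rlt0 _ x0).
  by move: h; rewrite (gtr0_norm x0) (ltr0_norm y0) => h; nra.
- move=> z /basis[a [b ->]]; exists a, (b - a); rewrite rmorphB /=; lra.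
Qed.

(* Going backwards from a basis with nonnegative coordinates is the
   subtractive Euclidean algorithm on the coordinates. *)
Lemma zpair_reach (N a b c d : nat) : (a + b + c + d <= N)%N ->
  (a * d = b * c + 1 \/ b * c = a * d + 1)%N ->
  (conj (a%:R + b%:R * om) * conj (c%:R + d%:R * om) < 0) ->
  exists i, zpair R n i = (a%:R + b%:R * om, c%:R + d%:R * om) \/
            zpair R n i = (c%:R + d%:R * om, a%:R + b%:R * om).
Proof.
have cE (x y : nat) : conj (x%:R + y%:R * om) = x%:R + y%:R * conj om.
  by have := conjq_coord R n2 sfn x%:Z y%:Z; rewrite -!pmulrn.
(* Undoing a step: conjugates of opposite signs make [conj (u - v)] larger than [conj v] in absolute
   value, so the rule applied to the pair of [u - v] and [v] keeps [v]. *)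
have step (u u' v v' : R) i : conj u = u' -> conj v = v' -> u' * v' < 0 ->
    (zpair R n i = (u - v, v) \/ zpair R n i = (v, u - v)) -> quad_int n u -> quad_int n v ->
    exists j, zpair R n j = (u, v) \/ zpair R n j = (v, u).
  move=> cu cv uv ziE iu iv; exists i.+1; left; rewrite zpairS.
  have Ku := quad_int_field iu; have Kv := quad_int_field iv.
  have lt : `|conj v| < `|conj (u - v)|.
    rewrite conjqB// cu cv; move: uv; have [x0|x0] := ltP u' 0 => uv.
      have y0 : 0 < v' by rewrite -(nmulr_rlt0 _ x0).
      by rewrite gtr0_norm// ltr0_norm; lra.
    have {}x0 : 0 < u' by rewrite lt_neqAle x0 andbT eq_sym; apply: contraTneq uv => ->; rewrite mul0r ltxx.
    have y0 : v' < 0 by rewrite -(pmulr_rlt0 _ x0).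
    by rewrite ltr0_norm// gtr0_norm; lra.
  by case: ziE => -> /=; [rewrite ltNge (ltW lt) subrK|rewrite lt addrC subrK].
have ii (x y : nat) : quad_int n (x%:R + y%:R * om).
  by apply/quad_intP => //; exists x%:Z, y%:Z; rewrite -!pmulrn.
elim: N a b c d => [|N IH]; first by move=> a b c d abN det neg; exfalso; move: abN det; nia.
have key (a b c d : nat) : (c <= a)%N -> (d <= b)%N -> (0 < c + d)%N -> (a + b + c + d <= N.+1)%N ->
  (a * d = b * c + 1 \/ b * c = a * d + 1)%N ->
  (conj (a%:R + b%:R * om) * conj (c%:R + d%:R * om) < 0) ->
  exists i, zpair R n i = (a%:R + b%:R * om, c%:R + d%:R * om) \/
            zpair R n i = (c%:R + d%:R * om, a%:R + b%:R * om).
  move=> ca db cd abcd det' neg'.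
  have uvE : (a - c)%N%:R + (b - d)%N%:R * om = (a%:R + b%:R * om) - (c%:R + d%:R * om).
    by rewrite !natrB//; lra.
  have [||| i zi] := IH (a - c)%N (b - d)%N c d.
  - by lia.
  - case: det' => det'; [left|right].
      by rewrite !mulnBl det' (mulnC c d); have := leq_mul ca (leqnn d); have := leq_mul db (leqnn c); nia.
    by rewrite !mulnBl det' (mulnC c d); have := leq_mul ca (leqnn d); have := leq_mul db (leqnn c); nia.
  - rewrite uvE (conjqB n2 sfn (quad_int_field (ii a b)) (quad_int_field (ii c d))).
    move: neg'; move: (conj (a%:R + _)) (conj (c%:R + _)) => x y xy.
    by rewrite mulrBl; have := sqr_ge0 y; rewrite expr2; lra.
  rewrite uvE in zi; apply: step (cE a b) (cE c d) _ zi (ii a b) (ii c d).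
  by rewrite -!cE.
move=> a b c d abN det neg.
have [cd0|cd0] := posnP (c + d)%N; first by exfalso; move: cd0 det; nia.
have [ab0|ab0] := posnP (a + b)%N; first by exfalso; move: ab0 det; nia.
have [ca|ac] := leqP c a; have [db|bd] := leqP d b.
- exact: key.
- have [ac|ca'] := leqP a c.
    have [] // := key c d a b ac (ltnW bd).
    + by lia.
    + by case: det => e; [right; rewrite (mulnC d a) e (mulnC b c)|left; rewrite (mulnC c b) e (mulnC a d)].
    + by rewrite mulrC.
    + by move=> i [] zi; exists i; [right|left].
  (* When neither coordinate vector dominates the other, determinant 1 or -1 leaves only the initial
     basis. *)
  have [-> -> -> ->] : [/\ a = 1, b = 0, c = 0 & d = 1]%N by split; nia.
  by exists 0%N; left; rewrite /= mulr0n mulr1n; congr pair; lra.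
- have [db'|bd'] := leqP b d.
    have [] // := key c d a b (ltnW ac) db'.
    + by lia.
    + by case: det => e; [right; rewrite (mulnC d a) e (mulnC b c)|left; rewrite (mulnC c b) e (mulnC a d)].
    + by rewrite mulrC.
    + by move=> i [] zi; exists i; [right|left].
  have [-> -> -> ->] : [/\ a = 0, b = 1, c = 1 & d = 0]%N by split; nia.
  by exists 0%N; right; rewrite /= mulr0n mulr1n; congr pair; lra.
- have [] // := key c d a b (ltnW ac) (ltnW bd).
  + by lia.
  + by case: det => e; [right; rewrite (mulnC d a) e (mulnC b c)|left; rewrite (mulnC c b) e (mulnC a d)].
  + by rewrite mulrC.
  + by move=> i [] zi; exists i; [right|left].
Qed.

Lemma stops_exists : exists m, stops R n m.
Proof.
set E := eps ^+ 2.
have E1 : 1 < E by exact: E_gt1.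
have cE : conj E = E^-1 by exact: conj_E.
have E0 : 0 < E by exact: lt_trans E1.
have EV1 : E^-1 < 1 by rewrite invf_lt1.
have EV0 : 0 < E^-1 by rewrite invr_gt0.
have om1 := omega_gt1 R n2; have om0 := conj_omega_lt0 R n2 sfn.
have Ei : quad_int n E by exact: E_int.
have [a' [b' Eab]] := (quad_intP n2 sfn E).1 Ei.
have Eab' : E^-1 = a'%:~R + b'%:~R * conj om by rewrite -cE Eab conjq_coord.
(* Both coordinates of [E] are positive: [E - E^-1 = b' * (om - conj om)], and
   [E^-1 = a' + b' * conj om] with [conj om < 0]. *)
have b0 : 0 < b'.
  rewrite ltNge; apply/negP; rewrite -(ler_int R) => b0.
  have : b'%:~R * (om - conj om) <= 0 by rewrite mulr_le0_ge0//; lra.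
  have : b'%:~R * (om - conj om) = E - E^-1 by rewrite Eab' {1}Eab; lra.
  by lra.
have a0 : 0 < a'.
  rewrite -(ltr0z R); have : b'%:~R * conj om < 0 by rewrite pmulr_rlt0// ltr0z.
  by move: Eab' EV0; lra.
have [a aE] : exists a : nat, a' = a by exists `|a'|%N; rewrite gez0_abs// ltW.
have [b bE] : exists b : nat, b' = b by exists `|b'|%N; rewrite gez0_abs// ltW.
rewrite {}aE {}bE -!pmulrn in a0 b0 Eab Eab'.
(* The determinant of multiplication by [E] in the basis [(1, om)] is the norm of [E]. *)
have det : (a * (a + b * omega_tr n) = b * (b * omega_nm n) + 1)%N.
  apply/eqP; rewrite -(eqr_nat R); apply/eqP; rewrite !(natrD, natrM) -(omega_sum R n2 sfn).
  have e1 : (a%:R + b%:R * om) * (a%:R + b%:R * conj om) = 1 by rewrite -Eab -Eab' divff// gt_eqF.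
  by have := congr1 (fun x => b%:R * b%:R * x) (omega_prod R n2 sfn); rewrite /=; lra.
have EomE : E * om = (b * omega_nm n)%N%:R + (a + b * omega_tr n)%N%:R * om.
  rewrite {1}Eab !(natrD, natrM).
  by have := congr1 (fun x => b%:R * x) (omega_sqr R n2 sfn); rewrite /=; lra.
have [|| i zi] := @zpair_reach _ a b (b * omega_nm n) (a + b * omega_tr n) (leqnn _).
- by left.
- rewrite -Eab -EomE conjqM//; [|exact: quad_int_field|exact: omega_field].
  by rewrite cE mulrA pmulr_rlt0// mulr_gt0.
exists i; rewrite /stops -/E mulr1; case: zi => -> /=; rewrite -Eab -EomE //.
by apply/seteqP; split=> x [->|->]; [right|left|right|left].
Qed.

Lemma stop_index_exists : exists m, stop_index R n m.
Proof.
have [m0 st0] := stops_exists.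
have ex : exists m, `[< stops R n m >] by exists m0; apply/asboolP.
have [m /asboolP stm mmin] := ex_minnP ex; exists m; split=> // i im /asboolP/mmin.
by rewrite leqNgt im.
Qed.

Lemma Llist_int z : Llist n z -> quad_int n (z : R).
Proof.
have iN w : quad_int n (w : R) -> quad_int n (- w) by exact: quad_intN.
move=> [[m [i [_ _ [w wE [->|->]]]]]|[_ [->|->]]].
- by have [[iu iv _ _ _] _] := zpair_basis i; case: wE => ->.
- by apply: iN; have [[iu iv _ _ _] _] := zpair_basis i; case: wE => ->.
- by apply/quad_intP => //; exists (omega_tr n), (-1); rewrite -pmulrn -(omega_sum R n2 sfn); lra.
- by apply: iN; apply/quad_intP => //; exists (omega_tr n), (-1); rewrite -pmulrn -(omega_sum R n2 sfn);
  lra.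
Qed.

(* The consecutive pairs [(z_i, z'_i)] are the bases for which [inner] changes
   sign at some [k]; between two sign changes the next pair completes an
   obtuse superbase. *)
Lemma Llist_dirichlet (x1 x2 k : R) : 1 <= k -> k < eps ^+ 4 ->
  (forall z, Llist n z -> 0 <= dirichlet x1 x2 k z (conj z)) ->
  forall z, quad_int n z -> 0 <= dirichlet x1 x2 k z (conj z).
Proof.
move=> k1 k4 hL.
have k0 : 0 < k by exact: lt_le_trans k1.
have kk1 : 1 <= k ^+ 2 by rewrite expr2 mulr_ege1.
have kk0 : 0 <= k ^+ 2 by rewrite sqr_ge0.
have om1 := omega_gt1 R n2; have om0 := conj_omega_lt0 R n2 sfn.
have i1 : quad_int n (1 : R) by exact: (quad_int_int R n2 sfn 1).
have io : quad_int n om by exact: quad_int_omega.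
have hN z : quad_int n z -> Llist n z -> Llist n (- z) -> 0 <= dirichlet x1 x2 k z (conj z) /\
    0 <= dirichlet x1 x2 k (- z) (- conj z).
  move=> iz /hL hz /hL; rewrite conjqN//; exact: quad_int_field.
have sup u v : quad_int n u -> quad_int n v -> (forall z, quad_int n z -> exists a b : int, z = a%:~R * u
  + b%:~R * v) ->
    Llist n u -> Llist n (- u) -> Llist n v -> Llist n (- v) -> Llist n (u + v) -> Llist n (- (u + v)) ->
    inner k u (conj u) v (conj v) <= 0 ->
    0 <= inner k (u + v) (conj u + conj v) u (conj u) ->
    0 <= inner k (u + v) (conj u + conj v) v (conj v) ->
    forall z, quad_int n z -> 0 <= dirichlet x1 x2 k z (conj z).
  move=> iu iv basis lu lu_ lv lv_ lw lw_ uv wu wv z /basis[a [b ->]].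
  have Ku := quad_int_field iu; have Kv := quad_int_field iv.
  have [du du_] := hN _ iu lu lu_; have [dv dv_] := hN _ iv lv lv_.
  have [dw dw_] := hN _ (quad_intD iu iv) lw lw_.
  rewrite conjqD// in dw dw_.
  rewrite conjqD//; [|by apply: quad_fieldM => //; exact: quad_field_int..].
  rewrite !conjqM//; [|exact: quad_field_int..].
  rewrite !conjq_int//; exact: dirichlet_superbase.
have [m stm] := stop_index_exists; have [st _] := stm.
have L i w : (i <= m)%N -> w = z_ i \/ w = z'_ i -> Llist n w /\ Llist n (- w).
  by move=> im wE; split; left; exists m, i; split=> //; exists w => //; [left|right].
pose q i := inner k (z_ i) (conj (z_ i)) (z'_ i) (conj (z'_ i)).
have [q0|q0] := leP (q 0%N) 0; last first.
  (* For [k] near 1 the first pair may already have positive inner product, but only when [n = 1]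
     modulo 4. Then [1], [- om] and their sum [conj om] give the obtuse superbase, which is why
     [conj om] belongs to the list. *)
  have n41 : (n %% 4 == 1)%N.
    apply/negPn/negP => /negbTE n41; move: q0; rewrite /q /inner /= conj1 mul1r (conjq_omega R n2 sfn)
      /omega n41.
    have := sqrtn_gt1 R n2; set s := Num.sqrt _ => s1.
    have : 0 <= (k ^+ 2 - 1) * s by apply: mulr_ge0; lra.
    by lra.
  have sumE : 1 + (- om) = conj om by have := omega_sum R n2 sfn; rewrite /omega_tr n41 /=; lra.
  have [l1 l1_] := L 0%N _ isT (or_introl erefl).
  have [lo lo_] := L 0%N _ isT (or_intror erefl).
  have cNo : conj (- om) = - conj om by apply: conjqN => //; exact: quad_int_field.
  have csum : conj 1 + conj (- om) = om by rewrite conj1 cNo; lra.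
  have sum2 := omega_sum R n2 sfn; rewrite /omega_tr n41 /= in sum2.
  have prodE := omega_prod R n2 sfn.
  have kn : 0 <= (k ^+ 2 - 1) * om by apply: mulr_ge0; lra.
  apply: (sup 1 (- om)) => //.
  - exact: quad_intN.
  - by move=> z /quad_intP[]// a [b ->]; exists a, (- b); rewrite rmorphN /=; lra.
  - by rewrite opprK.
  - by rewrite sumE; right; split=> //; left.
  - by rewrite sumE; right; split=> //; right.
  - by move: q0; rewrite /q /inner /= cNo; lra.
  - by rewrite csum sumE /inner conj1; move: kn; lra.
  - rewrite csum sumE cNo /inner.
    have : 0 <= k ^+ 2 * (omega_nm n)%:R + (omega_nm n)%:R by apply: addr_ge0 => //; exact: mulr_ge0.
    have := congr1 (fun x => k ^+ 2 * x) prodE; move: prodE; rewrite /=; lra.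
(* The last pair is [E] times [(1, om)]. Its inner product is that of [(1, om)] at
   [k / E ^+ 2 <= 1], up to a positive factor, and is nonnegative because [- conj om <= om]. *)
have qm : 0 <= q m /\ (0 < m)%N.
  have E1 := E_gt1 R n; have E0 := E_gt0 R n; have cE := conj_E n2 sfn ueps.
  have iE := E_int n2 sfn ueps; set E := eps ^+ 2 in E1 E0 cE iE.
  have KE := quad_int_field iE; have Ko := quad_int_field io.
  have qE : q m = inner k E (conj E) (E * om) (conj (E * om)).
    have sE : [set z_ m; z'_ m] = [set E; E * om] by move: st; rewrite /stops mulr1.
    have [_ basis] := zpair_basis m.
    have : [set E; E * om] (z_ m) by rewrite -sE; left.
    have : [set E; E * om] (z'_ m) by rewrite -sE; right.
    have ne : z_ m <> z'_ m.
      move=> e; have : [set z_ m; z'_ m] E by rewrite sE; left.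
      have : [set z_ m; z'_ m] (E * om) by rewrite sE; right.
      rewrite -e => -[] <- -[]; have : E < E * om by rewrite ltr_pMr.
      - by move=> + h; rewrite {1}h ltxx.
      - by move=> + h; rewrite {1}h ltxx.
      - by move=> + h; rewrite {1}h ltxx.
      - by move=> + h; rewrite {1}h ltxx.
    move=> [] e' [] e; try (by case: ne; rewrite e e'); rewrite /q e e' // /inner; lra.
  split.
    rewrite qE conjqM// cE /inner.
    have EV0 : 0 < E^-1 by rewrite invr_gt0.
    have k2 : k ^+ 2 <= E ^+ 4.
      have -> : E ^+ 4 = (eps ^+ 4) ^+ 2 by rewrite /E -!exprM.
      have ep0 : 0 < eps by exact: lt_trans ltr01 (fund_unit_gt1 R n).
      by rewrite !expr2; apply: ler_pM; exact: ltW.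
    have om_ge : - conj om <= om by have := omega_sum R n2 sfn; have : (0:R) <= (omega_tr n)%:R by []; lra.
    have : k ^+ 2 * (E^-1 * E^-1) <= E * E.
      rewrite -invfM (ler_pdivrMr _ _ (mulr_gt0 E0 E0)).
      by have -> : E * E * (E * E) = E ^+ 4 by rewrite !exprS expr0; lra.
    move=> h; have h1 : k ^+ 2 * (E^-1 * E^-1) * (- conj om) <= (E * E) * om.
      apply: ler_pM => //; [|lra]; apply: mulr_ge0 => //; apply: mulr_ge0; exact: ltW.
    by move: h1; lra.
  rewrite lt0n; apply/eqP => m0; move: st; rewrite m0 /stops /= -/E mulr1 => sE.
  have : [set E; E * om] 1 by rewrite -sE; left.
  have : 1 < E * om by rewrite (lt_trans E1)// ltr_pMr.
  by move=> + [] h; [move: E1|]; rewrite -h ltxx.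
(* Discrete intermediate values: [q] starts nonpositive and ends nonnegative. *)
have [i im [qi qi1]] : exists2 i, (i < m)%N & q i <= 0 /\ 0 <= q i.+1.
  move: qm => []; elim: {stm st L} m => [//|m IH] qm _.
  have [qmle|qmgt] := leP (q m) 0; first by exists m.
  case: m IH qm qmgt => [|m] IH qm qmgt; first by move: (le_lt_trans q0 qmgt); rewrite ltxx.
  by have [] // := IH (ltW qmgt); move=> i im qi; exists i => //; rewrite ltnW.
have [[iu iv u0 v0 uv] basis] := zpair_basis i.
have [l1 l1_] := L i _ (ltnW im) (or_introl erefl).
have [l2 l2_] := L i _ (ltnW im) (or_intror erefl).
have [l3 l3_] := L i.+1 _ im (or_introl erefl).
move: l3 l3_ qi1; rewrite /q zpairS [fst _]/= [snd _]/= => l3 l3_ qi1.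
have Ku := quad_int_field iu; have Kv := quad_int_field iv.
move: qi1; rewrite conjqD//.
move: qi l1 l1_ l2 l2_ l3 l3_ iu iv u0 v0 uv basis Ku Kv; rewrite /q.
move: (z_ i) (z'_ i) => u v qi l1 l1_ l2 l2_ l3 l3_ iu iv u0 v0 uv basis Ku Kv qi1.
(* [q i.+1 >= 0] is one of the two required inequalities, between [u + v] and the vector kept. For
   the vector dropped, whose conjugate is at least as large, both terms of [inner] are
   nonnegative. *)
have other (x y : R) : `|x| <= `|y| -> x * y < 0 -> 0 <= (x + y) * y.
  move=> xy neg; have : - (x * y) <= y * y.
    have yy : y * y = `|y| * `|y| by rewrite -normrM ger0_norm// -expr2 sqr_ge0.
    by rewrite -(ltr0_norm neg) normrM yy; apply: ler_wpM2r.
  by lra.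
have [wu wv] : 0 <= inner k (u + v) (conj u + conj v) u (conj u) /\
    0 <= inner k (u + v) (conj u + conj v) v (conj v).
  move: qi1; case: ifP => h qi1; split=> //; rewrite /inner.
  - apply: addr_ge0; first by rewrite mulr_ge0 ?addr_ge0// ltW.
    by apply: mulr_ge0 => //; apply: other => //; exact: ltW.
  - apply: addr_ge0; first by rewrite mulr_ge0 ?addr_ge0// ltW.
    apply: mulr_ge0 => //; rewrite [_ + conj v]addrC; apply: other; last by rewrite mulrC.
    by rewrite leNgt h.
exact: (sup u v).
Qed.

End Chain.

(** * Covering by translates and thinness of their intersections *)

Section FundamentalDomain.
Variables (R : realType) (n : nat).
Hypotheses (n2 : (2 <= n)%N) (sfn : squarefree n).
Notation eps := (fund_unit R n).
Hypothesis ueps : quad_unit n eps.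
Notation conj := (@conjq R n).
Notation X := (cusp_space R).
Notation iota := (set_val : X -> 'rV[R]_3).
Notation E := (eps ^+ 2).

Lemma region_dirichlet (p : X) z : region n p -> quad_int n z ->
  0 <= dirichlet (iota p 0 i1) (iota p 0 i2) (iota p 0 i3) z (conj z).
Proof.
by move=> [/andP[k1 k4] hL]; apply: Llist_dirichlet.
Qed.

Lemma Ez_floor (k : R) : 0 < k -> exists j : int, 1 <= E ^ j * E ^ j * k < eps ^+ 4.
Proof.
move=> k0; have E1 := E_gt1 R n; have E0 := E_gt0 R n.
pose F := E * E; have F1 : 1 < F by rewrite mulr_egt1.
have F0 : 0 < F by exact: lt_trans F1.
have Fj (j : int) : E ^ j * E ^ j = F ^ j by rewrite -expfzMl.
have FE : F = eps ^+ 4 by rewrite /F -exprD.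
have big (x : R) : 0 < x -> exists N : nat, x < F ^+ N.
  move=> x0; have d0 : 0 < F - 1 by lra.
  exists (Num.bound (x / (F - 1))).
  have := @archi_boundP _ (x / (F - 1)); set N := Num.bound _ => /(_ _).
  have l0 : 0 <= x / (F - 1) by rewrite divr_ge0 ?ltW.
  move=> /(_ l0); rewrite ltr_pdivrMr// => h; apply: (lt_le_trans h).
  have -> : F ^+ N = (1 + (F - 1)) ^+ N by congr (_ ^+ _); lra.
  elim: {h} N => [|N IH]; first by rewrite mul0r.
  have X1 : 1 <= (1 + (F - 1)) ^+ N by apply: exprn_ege1; lra.
  rewrite exprS -natr1; move: IH X1; move: ((1 + (F - 1)) ^+ N) => Y IH Y1.
  have : 0 <= (F - 1) * (Y - 1) by apply: mulr_ge0; lra.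
  by lra.
have [N1 hN1] := big _ k0; have [N2 hN2] : exists N, k^-1 < F ^+ N by apply: big; rewrite invr_gt0.
(* [k * F ^+ N2] exceeds 1, so the power of [F] just above it can be searched among natural
   exponents and is not the zeroth. *)
have ex : exists N : nat, k * F ^+ N2 < F ^+ N.
  exists (N1 + N2)%N; rewrite exprD ltr_pM2r//; exact: exprn_gt0.
have [m hm mmin] := ex_minnP ex.
have m1 : (0 < m)%N.
  rewrite lt0n; apply/eqP => m0; move: hm; rewrite m0 expr0.
  by move: hN2; rewrite -(ltr_pM2l k0) divff ?gt_eqF// => h1 h2; have := lt_trans h1 h2; rewrite ltxx.
exists (N2%:Z - m.-1%:Z); rewrite Fj expfzDr ?gt_eqF// -invr_expz -!exprnP.
have Fm0 : 0 < F ^+ m.-1 by exact: exprn_gt0.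
rewrite mulrAC ler_pdivlMr// mul1r ltr_pdivrMr// -FE -exprS prednK// mulrC hm andbT.
by rewrite leNgt; apply/negP => /mmin; rewrite leqNgt prednK// leqnn.
Qed.

(** A power of [eta] first brings [k] into range; then one translates to a point of least norm in
    its orbit under the lattice, which exists by discreteness. The inequality for [w] is the growth
    of the norm under the further translation by [w]. *)
Lemma region_covers (p : X) : exists2 g, transf (cusp_group R n) g & (g @` @region R n) p.
Proof.
have [j kj] := Ez_floor (upper_gt0 p).
pose q := celem n 0 j p; set x1 := iota q 0 i1; set x2 := iota q 0 i2; set k := iota q 0 i3.
have k0 : 0 < k by exact: upper_gt0.
pose N z : R := (x1 + z) ^+ 2 + k ^+ 2 * (x2 + conj z) ^+ 2.
pose C := `|x1| + `|x2| + N 0 + N 0 / k ^+ 2 + 2.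
have kk0 : 0 < k ^+ 2 by exact: exprn_gt0.
have N0 z : 0 <= N z by apply: addr_ge0; [exact: sqr_ge0|apply: mulr_ge0; exact: sqr_ge0].
have fin := quad_int_discrete n2 sfn C.
have sq1 (y b : R) : y ^+ 2 <= b -> `|y| <= b + 1.
  move=> yb; have := sqr_ge0 (`|y| - 1 / 2); have : `|y| ^+ 2 = y ^+ 2 by rewrite real_normK ?num_real.
  by rewrite !expr2 in yb *; move=> h1 h2; lra.
have sub z : quad_int n z -> N z <= N 0 -> [set z : R | [/\ quad_int n z, `|z| <= C & `|conj z| <= C]] z.
  move=> iz Nz.
  have a1 : `|x1 + z| <= N 0 + 1.
    by apply: sq1; apply: le_trans Nz; rewrite /N lerDl; apply: mulr_ge0; exact: sqr_ge0.
  have a2 : `|x2 + conj z| <= N 0 / k ^+ 2 + 1.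
    apply: sq1; rewrite ler_pdivlMr// mulrC; apply: le_trans Nz; rewrite /N lerDr; exact: sqr_ge0.
  have b1 := N0 0; have b2 : 0 <= N 0 / k ^+ 2 by apply: divr_ge0 => //; exact: ltW.
  have c1 := normr_ge0 x1; have c2 := normr_ge0 x2.
  split=> //.
    have -> : z = (x1 + z) - x1 by lra.
    by apply: le_trans (ler_normB _ _) _; rewrite /C; lra.
  have -> : conj z = (x2 + conj z) - x2 by lra.
  by apply: le_trans (ler_normB _ _) _; rewrite /C; lra.
have i0 : quad_int n (0 : R) by exact: (quad_int_int R n2 sfn 0).
have [z iz zmin] : exists2 z, quad_int n z & forall w, quad_int n w -> N z <= N w.
  pose A := [set z : R | quad_int n z /\ N z <= N 0].
  have fA : finite_set (N @` A).
    by apply: finite_image; apply: sub_finite_set fin => z [iz Nz]; exact: sub.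
  have [|m [z [iz Nz] <-] mmin] := finite_set_min fA; first by exists (N 0), 0.
  exists z => // w iw; have [wN|Nw] := leP (N w) (N 0); first by apply: mmin; exists w.
  exact: le_trans Nz (ltW Nw).
pose r := celem n z 0 q.
have rE : iota r = vec3 (x1 + z) (x2 + conj z) k.
  by rewrite celemE oppr0 expr0z !mul1r.
have rP : region n r.
  rewrite /region /= rE !vec3E; split.
    by move: kj; rewrite /k /q celemE vec3E.
  move=> w Lw; have iw := Llist_int n2 sfn Lw.
  have := zmin (z + w) (quad_intD iz iw).
  rewrite /N conjqD//; [|exact: quad_int_field..].
  by rewrite !expr2; lra.
have jj : quad_int n (0 : R) by [].
have Gr : transf (cusp_group R n) (celem n z 0 \o celem n 0 j).
  by apply: transf_comp; apply/cusp_groupP => //; [exists z, 0|exists 0, j].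
have [g Gg [gK _]] := transf_inv Gr.
by exists g => //; exists r => //; rewrite -[RHS]gK.
Qed.

(** A difference of levels multiplies [k] by at least [E * E = eps ^+ 4], the ratio of the ends of
    the half-open range. *)
Lemma region_level i j (x y : R) : 1 <= x < eps ^+ 4 -> 1 <= y < eps ^+ 4 ->
  E ^ i * E ^ i * x = E ^ j * E ^ j * y -> i = j :> int.
Proof.
move: i j x y; have E1 := E_gt1 R n; have E0 := E_gt0 R n.
have E4 : eps ^+ 4 = E * E by rewrite -exprD.
have lt (i j : int) (x y : R) : 1 <= x < eps ^+ 4 -> 1 <= y < eps ^+ 4 ->
    E ^ i * E ^ i * x = E ^ j * E ^ j * y -> (i < j) -> False.
  move=> /andP[x1 x4] /andP[y1 y4] e ij.
  have [m mE] : exists m : nat, j = i + m.+1 by exists `|(j - i - 1)%R|%N; lia.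
  have Em1 : 1 <= E ^+ m by exact/exprn_ege1/ltW.
  have Em : E <= E ^+ m.+1 by rewrite (exprS E m); apply: ler_peMr => //; exact: ltW.
  move: e; rewrite mE (EzD R n) -exprnP => e.
  have Ei := Ez_gt0 R n i; have EE : 0 < E ^ i * E ^ i by exact: mulr_gt0.
  have xE : x = E ^+ m.+1 * E ^+ m.+1 * y by apply: (mulfI (lt0r_neq0 EE)); rewrite e; lra.
  have : E * E <= E ^+ m.+1 * E ^+ m.+1 by apply: ler_pM => //; exact: ltW.
  move: x4; rewrite xE E4; have F0 : 0 < E ^+ m.+1 * E ^+ m.+1 by rewrite mulr_gt0// exprn_gt0.
  move: (E ^+ m.+1 * E ^+ m.+1) F0 => F F0 h1 h2.
  have : F * 1 <= F * y by rewrite ler_pM2l.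
  by lra.
move=> i j x y hx hy e; case: (ltgtP i j) => // ij; first by case: (lt _ _ _ _ hx hy e ij).
by case: (lt _ _ _ _ hy hx (esym e) ij).
Qed.

(** At a common point of two translates, the inequalities for [zeta] and [- zeta], seen from the two
    sides, force [dirichlet] to vanish at [zeta != 0]. This equation is affine in [x1] with nonzero
    slope, so it fails after a small shift of [x1] inside an open set. *)
Lemma region_disjoint g h : transf (cusp_group R n) g -> transf (cusp_group R n) h -> g <> h ->
  interior (g @` @region R n `&` h @` @region R n) = set0.
Proof.
move=> /cusp_groupP[]// z [i [iz ->]] /cusp_groupP[]// w [j [iw ->]] gh.
apply/seteqP; split=> // p; set S := _ `&` _ => intS.
pose zeta := E ^ (- i) * (z - w).
have key q : S q -> z <> w /\ dirichlet (E ^ (- i) * (iota q 0 i1 - z)) (E ^ i * (iota q 0 i2 - conj z))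
    (E ^ (- i) * E ^ (- i) * iota q 0 i3) zeta (conj zeta) = 0.
  move=> [[a Pa aq] [b Pb bq]].
  have aE := congr1 (fun r => iota r) aq; have bE := congr1 (fun r => iota r) bq.
  rewrite /= celemE in aE; rewrite /= celemE in bE.
  have a1 : E ^ i * iota a 0 i1 + z = iota q 0 i1 by rewrite -aE vec3E.
  have a2 : E ^ (- i) * iota a 0 i2 + conj z = iota q 0 i2 by rewrite -aE vec3E.
  have a3 : E ^ i * E ^ i * iota a 0 i3 = iota q 0 i3 by rewrite -aE vec3E.
  have b1 : E ^ j * iota b 0 i1 + w = iota q 0 i1 by rewrite -bE vec3E.
  have b2 : E ^ (- j) * iota b 0 i2 + conj w = iota q 0 i2 by rewrite -bE vec3E.
  have b3 : E ^ j * E ^ j * iota b 0 i3 = iota q 0 i3 by rewrite -bE vec3E.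
  have ij : i = j.
    by apply: (region_level (x := iota a 0 i3) (y := iota b 0 i3)); [case: Pa|case: Pb|rewrite a3 b3].
  have [iE cE] := Ez_quad n2 sfn ueps (- i); rewrite opprK in cE.
  have izeta : quad_int n zeta by apply: quad_intM => //; exact: quad_intB.
  have czeta : conj zeta = E ^ i * (conj z - conj w).
    rewrite /zeta conjqM// ?conjqB ?cE//; try exact: quad_int_field.
    by apply: quad_int_field; exact: quad_intB.
  have da := region_dirichlet Pa izeta.
  have db := region_dirichlet Pb (quad_intN n2 sfn izeta).
  rewrite conjqN// in db; last exact: quad_int_field.
  split; first by move=> zw; apply: gh; rewrite zw ij.
  have EN : E ^ i * E ^ (- i) = 1 by rewrite -(EzD R n) subrr expr0z.
  have EN' : E ^ (- i) * E ^ i = 1 by rewrite mulrC.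
  have q1 : E ^ (- i) * (iota q 0 i1 - z) = iota a 0 i1 by rewrite -a1 addrK mulrA EN' mul1r.
  have q2 : E ^ i * (iota q 0 i2 - conj z) = iota a 0 i2 by rewrite -a2 addrK mulrA EN mul1r.
  have q3 : E ^ (- i) * E ^ (- i) * iota q 0 i3 = iota a 0 i3 by rewrite -a3 mulrA mulrACA EN' mul1r mul1r.
  have p1 : iota b 0 i1 = iota a 0 i1 + zeta.
    rewrite -q1 -mulrDr; have -> : iota q 0 i1 - z + (z - w) = iota q 0 i1 - w by lra.
    by rewrite -b1 addrK -ij mulrA EN' mul1r.
  have p2 : iota b 0 i2 = iota a 0 i2 + conj zeta.
    rewrite -q2 czeta -mulrDr; have -> : iota q 0 i2 - conj z + (conj z - conj w) = iota q 0 i2 - conj w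
      by lra.
    by rewrite -b2 addrK -ij mulrA EN mul1r.
  have p3 : iota b 0 i3 = iota a 0 i3.
    by rewrite -q3 -b3 -ij mulrA mulrACA EN' mul1r mul1r.
  rewrite q1 q2 q3; apply/eqP; rewrite eq_le da andbT.
  move: db; rewrite p1 p2 p3 /dirichlet.
  move: (iota a 0 i1) (iota a 0 i2) (iota a 0 i3) (conj zeta) => r1 r2 r3 c; lra.
have Sp : S p by exact: nbhs_singleton.
have oS : open (iota @` S^°) by apply: (one_chart_open (cusp_space_one_chart R)); exact: open_interior.
have : nbhs (iota p) (iota @` S^°).
  by apply: open_nbhs_nbhs; split=> //; exists p.
move=> /nbhs_ballP[r /= r0 rS].
pose v := vec3 (iota p 0 i1 + r / 2) (iota p 0 i2) (iota p 0 i3).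
have [p' Sp' p'v] : (iota @` S^°) v.
  apply: rS; rewrite -ball_normE /= /Num.Def.normr/= mx_normrE; apply/bigmax_ltP; split=> // -[l m] _ /=.
  rewrite !mxE ord1; move: m; apply: I3P => /=; rewrite /v ?vec3E.
  - by rewrite opprD addrA subrr sub0r normrN gtr0_norm; lra.
  - by rewrite subrr normr0.
  - by rewrite subrr normr0.
have [zw k1] := key p Sp; have [_ k2] := key p' (interior_subset Sp').
move: k2; rewrite p'v /v !vec3E => k2.
have zeta0 : zeta != 0.
  by rewrite mulf_neq0 ?subr_eq0//; [rewrite gt_eqF// Ez_gt0|exact/eqP].
have : zeta * (E ^ (- i) * r) = 0.
  move: k1 k2; rewrite /dirichlet; move: (E ^ (- i)) (E ^ i) (conj zeta) => e e' c k1 k2; lra.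
by move/eqP; rewrite mulf_eq0 (negbTE zeta0) mulf_eq0 (gt_eqF r0) (gt_eqF (Ez_gt0 R n (- i))).
Qed.

Lemma cusp_fundamental_domain : fundamental_domain (cusp_group R n) (@region R n).
Proof. by split; [exact: region_covers|exact: region_disjoint]. Qed.

End FundamentalDomain.

(** * Cocompact groups of isometries of Sol *)

Lemma sequence_pigeonhole (T : Type) (A : set T) (f : nat -> T) : finite_set A -> (forall i, A (f i)) ->
  exists i j, (i < j)%N /\ f i = f j.
Proof.
move=> fA Af; apply: contrapT => ne; apply: infinite_nat.
have inj : {in [set: nat] &, injective f}.
  move=> i j _ _ fij; case: (ltngtP i j) => // ij; case: ne.
    by exists i, j.
  by exists j, i.
have : finite_set (f @` [set: nat]) by apply: sub_finite_set fA => _ [i _ <-].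
by rewrite (eq_finite_set (inj_card_eq inj)).
Qed.

Section SolSpace.
Variable R : realType.

Lemma Sol_one_chart : @one_chart R (Sol R) id.
Proof.
split=> //; split=> /=; [exact: openT|by move=> x y _ _|].
by move=> A _; rewrite image_id.
Qed.

Lemma sol_isometryP (f : Sol R -> Sol R) : sol_isometry f ->
  exists s1 s2 a b c : R, [/\ s1 ^+ 2 = 1, s2 ^+ 2 = 1 &
  (forall x, f x = vec3 (s1 * expR c * x 0 i1 + a) (s2 * expR (- c) * x 0 i2 + b) (x 0 i3 + c)) \/
  (forall x, f x = vec3 (s1 * expR c * x 0 i2 + a) (s2 * expR (- c) * x 0 i1 + b) (- x 0 i3 + c))].
Proof.
move=> [[g [_ _ [_ /(_ (Chart setT id) (Chart setT id) erefl erefl) [t [ct tE]]] _]] fg].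
have tf : t = f.
  by apply/funext => x; apply: tE; split.
apply: (@isometry_normal_form R (f : 'rV[R]_3 -> 'rV[R]_3)) => //.
by rewrite -tf => k; apply: class_C_sub (ct k) => x _; exists x.
Qed.

Lemma coord_le_norm (x : 'rV[R]_3) i : `|x 0 i| <= `|x|.
Proof.
rewrite [leRHS]/Num.Def.normr/= mx_normrE.
exact: (le_bigmax _ (fun ij : 'I_1 * 'I_3 => `|x ij.1 ij.2|) (0, i)).
Qed.

Lemma norm_le_coord (x : 'rV[R]_3) C : 0 <= C -> (forall i, `|x 0 i| <= C) -> `|x| <= C.
Proof.
move=> C0 xC; rewrite /Num.Def.normr/= mx_normrE bigmax_le// => -[i j] _ /=.
by rewrite ord1.
Qed.

Lemma compact_ball (C : R) : compact [set x : 'rV[R]_3 | `|x| <= C].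
Proof.
apply: bounded_closed_compact.
  exists `|C|; split=> [|M hM x /= xC]; first exact: num_real.
  exact: le_trans xC (le_trans (ler_norm C) (ltW hM)).
have -> : [set x : 'rV[R]_3 | `|x| <= C] = (fun x => `|x|) @^-1` [set y : R | y <= C] by [].
by apply: closed_comp => [x _|]; [exact: norm_continuous|exact: closed_le].
Qed.

End SolSpace.

Section CocompactGroup.
Variables (R : realType) (G : transf_group (Sol R)).
Hypothesis Giso : forall g, transf G g -> sol_isometry g.
Hypothesis Gpd : acts_properly_discontinuously G.

Lemma isometry_smooth g : transf G g -> smooth g.
Proof. by move=> /Giso [[h []]]. Qed.

Lemma cocompact_bound : compact [set: quotient G] ->
  exists2 N : R, 0 < N & forall p : Sol R, exists2 g, transf G g & `|(g p : 'rV[R]_3)| <= N.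
Proof.
rewrite compact_cover => /(_ nat setT (fun m => @orbit_proj (Sol R) G @` [set x : 'rV[R]_3 | `|x| < m%:R])).
case=> [m _|y _|D _ cov].
- apply: (quotient_pi_open isometry_smooth).
  have -> : [set x : 'rV[R]_3 | `|x| < m%:R] = (fun x => `|x|) @^-1` [set y : R | y < m%:R] by [].
  by apply: open_comp => [x _|]; [exact: norm_continuous|exact: open_lt].
- have [x <-] := orbit_proj_surj y; exists (Num.bound `|x : 'rV[R]_3|) => //.
  by exists x => //=; exact: archi_boundP.
pose N := \max_(m <- finmap.enum_fset D) m.
exists N.+1%:R => [|p]; first by rewrite ltr0n.
have [m Dm [x /= xm /esym/orbit_projP[g Gg gp]]] := cov (orbit_proj G p) I.
exists g => //; rewrite gp; apply: le_trans (ltW xm) _; rewrite ler_nat.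
by apply: leq_trans (leqnSn N); apply: (@leq_bigmax_seq _ _ xpredT id).
Qed.

Definition tr (u v : R) : Sol R -> Sol R := fun x => vec3 (x 0 i1 + u) (x 0 i2 + v) (x 0 i3).

(** A diagonal element with the vertical line over [(x0, y0)] as axis. *)
Definition diag (x0 y0 c : R) : Sol R -> Sol R := fun x =>
  vec3 (x0 + expR c * (x 0 i1 - x0)) (y0 + expR (- c) * (x 0 i2 - y0)) (x 0 i3 + c).

Variable N : R.
Hypothesis Gco : forall p : Sol R, exists2 g, transf G g & `|(g p : 'rV[R]_3)| <= N.

Let N_ge0 : 0 <= N.
Proof. by have [g _] := Gco 0; exact: le_trans. Qed.

Lemma exists_straight : exists h s1 s2 a b c, [/\ transf G h, s1 ^+ 2 = 1 :> R, s2 ^+ 2 = 1 :> R, 0 < c &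
  forall x, h x = vec3 (s1 * expR c * x 0 i1 + a) (s2 * expR (- c) * x 0 i2 + b) (x 0 i3 + c)].
Proof.
(* A point at height [- N - 1] returns to the ball either by a move upwards with [c >= 1] or by a
   flip. *)
have [g1 Gg1 b1] := Gco (vec3 0 0 (- N - 1)).
have := le_trans (coord_le_norm _ i3) b1.
have [s1 [s2 [a [b [c [s11 s21 [g1E|g1E]]]]]]] := sol_isometryP (Giso Gg1).
  rewrite g1E !vec3E => h; exists g1, s1, s2, a, b, c; split=> //.
  by move: h; rewrite ler_norml => /andP[h1 h2]; lra.
rewrite g1E !vec3E => h1; move: h1; rewrite ler_norml => /andP[h1 h1'].
(* Low enough that, if this is a flip too, [c' <= - 2 N - 2] while [c >= - 2 N - 1]; the product of
   the two flips then moves up by [c - c' >= 1]. *)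
have [g2 Gg2 b2] := Gco (vec3 0 0 (- N - 1 - 2 * N - 1)).
have := le_trans (coord_le_norm _ i3) b2.
have [r1 [r2 [a' [b' [c' [r11 r21 [g2E|g2E]]]]]]] := sol_isometryP (Giso Gg2).
  rewrite g2E !vec3E => h; exists g2, r1, r2, a', b', c'; split=> //.
  by move: h; rewrite ler_norml => /andP[h2 h2']; have := N_ge0; lra.
rewrite g2E !vec3E => h2; move: h2; rewrite ler_norml => /andP[h2 h2'].
exists (g1 \o g2), (s1 * r2), (s2 * r1), (s1 * expR c * b' + a), (s2 * expR (- c) * a' + b), (c - c').
split.
- exact: transf_comp.
- by rewrite exprMn s11 r21 mulr1.
- by rewrite exprMn s21 r11 mulr1.
- by lra.
- move=> x; rewrite /= g1E g2E !vec3E opprB expRD; congr vec3.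
  + by lra.
  + by rewrite expRD; lra.
  + by lra.
Qed.

(** Squaring removes the signs, and the axis is the fixed point of the affine maps [x -> mu x + a2]
    and [y -> nu y + b2]. *)
Lemma exists_diag : exists x0 y0 c, 0 < c /\ transf G (diag x0 y0 c).
Proof.
have [h [s1 [s2 [a [b [c [Gh s11 s21 c0 hE]]]]]]] := exists_straight.
pose mu := expR (c + c); pose nu := expR (- (c + c)).
have mu1 : 1 < mu by rewrite /mu expR_gt1; lra.
have nu1 : nu < 1 by rewrite /nu expR_lt1; lra.
pose a2 := s1 * expR c * a + a; pose b2 := s2 * expR (- c) * b + b.
exists (a2 / (1 - mu)), (b2 / (1 - nu)), (c + c); split; first by lra.
have -> : diag (a2 / (1 - mu)) (b2 / (1 - nu)) (c + c) = h \o h; last exact: transf_comp.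
apply/funext => x; rewrite /= /diag !hE !vec3E -/mu -/nu; congr vec3.
- have e : a2 / (1 - mu) * (1 - mu) = a2 by rewrite divfK// subr_eq0 lt_eqF.
  have muE : mu = s1 ^+ 2 * (expR c * expR c) by rewrite s11 mul1r -expRD.
  transitivity (mu * x 0 i1 + a2 / (1 - mu) * (1 - mu)); first lra.
  by rewrite e muE /a2; lra.
- have e : b2 / (1 - nu) * (1 - nu) = b2 by rewrite divfK// subr_eq0 gt_eqF.
  have nuE : nu = s2 ^+ 2 * (expR (- c) * expR (- c)) by rewrite s21 mul1r -expRD /nu opprD.
  transitivity (nu * x 0 i2 + b2 / (1 - nu) * (1 - nu)); first lra.
  by rewrite e nuE /b2; lra.
- by lra.
Qed.

Variables (x0 y0 c : R).
Hypothesis c0 : 0 < c.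
Hypothesis G0 : transf G (diag x0 y0 c).

Let mu := expR c.
Let nu := expR (- c).
Let munu : mu * nu = 1. Proof. by rewrite /mu /nu -expRD subrr expR0. Qed.
Let mu1 : 1 < mu. Proof. by rewrite /mu expR_gt1. Qed.
Let nu0 : 0 < nu. Proof. exact: expR_gt0. Qed.
Let nu1 : nu < 1. Proof. by rewrite /nu expR_lt1 oppr_lt0. Qed.

Lemma trans_of_eq (f g : Sol R -> Sol R) (u v : R) : transf G f -> transf G g ->
  (forall x, f x = tr u v (g x)) -> transf G (tr u v).
Proof.
move=> Gf Gg fg; have [k Gk [gk kg]] := transf_inv Gg.
have -> : tr u v = f \o k by apply/funext => x; rewrite /= fg kg.
exact: transf_comp.
Qed.

(* Otherwise every element of [G] normalizes the group generated by [diag],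
   hence preserves its axis, and [(x1 - x0) (x2 - y0)] is invariant up to sign. *)
Lemma exists_translation : exists u v, transf G (tr u v) /\ (u != 0 \/ v != 0).
Proof.
apply: contrapT => ne.
have tr0 u v : transf G (tr u v) -> u = 0 /\ v = 0.
  move=> Gt; have [u0|u0] := eqVneq u 0; last by case: ne; exists u, v; split=> //; left.
  have [v0|v0] := eqVneq v 0; last by case: ne; exists u, v; split=> //; right.
  by [].
pose Phi (x : Sol R) := `|(x 0 i1 - x0) * (x 0 i2 - y0)|.
have mu10 : mu - 1 != 0 by rewrite subr_eq0 gt_eqF.
have nu10 : nu - 1 != 0 by rewrite subr_eq0 lt_eqF.
have inv g x : transf G g -> Phi (g x) = Phi x.
  move=> Gg; have [s1 [s2 [a [b [d [s11 s21 gE]]]]]] := sol_isometryP (Giso Gg).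
  have dd : expR d * expR (- d) = 1 by rewrite -expRD subrr expR0.
  have sg : `|s1 * s2| = 1.
    have : `|s1 * s2| ^+ 2 = 1 by rewrite -normrX exprMn s11 s21 mulr1 normr1.
    by move/eqP; rewrite sqrp_eq1// => /eqP.
  case: gE => gE.
    (* [g] and [diag] commute up to a translation; as this one is trivial, [g] preserves the
       axis. *)
    have Gt : transf G (tr ((mu - 1) * (x0 - s1 * expR d * x0 - a)) ((nu - 1) * (y0 - s2 * expR (- d) *
      y0 - b))).
      apply: (trans_of_eq (transf_comp Gg G0) (transf_comp G0 Gg)) => y.
      rewrite /= /diag /tr !gE !vec3E -/mu -/nu; congr vec3; lra.
    have [e1 e2] := tr0 _ _ Gt.
    have {}e1 : s1 * expR d * x0 + a = x0.
      by move/eqP: e1; rewrite mulf_eq0 (negbTE mu10)/= => /eqP e1; lra.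
    have {}e2 : s2 * expR (- d) * y0 + b = y0.
      by move/eqP: e2; rewrite mulf_eq0 (negbTE nu10)/= => /eqP e2; lra.
    rewrite /Phi gE !vec3E -{1}e1 -{1}e2.
    have -> : (s1 * expR d * x 0 i1 + a - (s1 * expR d * x0 + a)) *
       (s2 * expR (- d) * x 0 i2 + b - (s2 * expR (- d) * y0 + b)) =
       (s1 * s2) * ((x 0 i1 - x0) * (x 0 i2 - y0)) * (expR d * expR (- d)) by lra.
    by rewrite dd mulr1 normrM sg mul1r.
  (* A flip conjugates [diag] into its inverse, again up to a translation. *)
  have Gt : transf G (tr ((mu - 1) * (s1 * expR d * y0 + a - x0)) ((nu - 1) * (s2 * expR (- d) * x0 + b -
    y0))).
    apply: (trans_of_eq (transf_comp G0 (transf_comp Gg G0)) Gg) => y.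
    rewrite /= /diag /tr !gE !vec3E -/mu -/nu.
    have m1 := congr1 (fun w => s1 * expR d * w * (y 0 i2 - y0)) munu.
    have m2 := congr1 (fun w => s2 * expR (- d) * w * (y 0 i1 - x0)) munu.
    by move: m1 m2 => /= m1 m2; congr vec3; lra.
  have [e1 e2] := tr0 _ _ Gt.
  have {}e1 : s1 * expR d * y0 + a = x0.
    by move/eqP: e1; rewrite mulf_eq0 (negbTE mu10)/= => /eqP e1; lra.
  have {}e2 : s2 * expR (- d) * x0 + b = y0.
    by move/eqP: e2; rewrite mulf_eq0 (negbTE nu10)/= => /eqP e2; lra.
  rewrite /Phi gE !vec3E -{1}e1 -{2}e2.
  have -> : (s1 * expR d * x 0 i2 + a - (s1 * expR d * y0 + a)) *
     (s2 * expR (- d) * x 0 i1 + b - (s2 * expR (- d) * x0 + b)) =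
     (s1 * s2) * ((x 0 i1 - x0) * (x 0 i2 - y0)) * (expR d * expR (- d)) by lra.
  by rewrite dd mulr1 normrM sg mul1r.
(* Chosen so that [Phi] is larger at this point than anywhere on the ball of radius [N], against its
   invariance. *)
pose C := N + `|x0| + `|y0| + 1.
have C0 : 0 < C by rewrite ltr_wpDl// !addr_ge0.
have [g Gg gb] := Gco (vec3 (C + x0) (C + y0) 0).
have := inv g (vec3 (C + x0) (C + y0) 0) Gg.
rewrite {2}/Phi !vec3E !addrK gtr0_norm ?mulr_gt0// => PhiE.
have g1 := le_trans (coord_le_norm _ i1) gb; have g2 := le_trans (coord_le_norm _ i2) gb.
have : Phi (g (vec3 (C + x0) (C + y0) 0)) <= (N + `|x0|) * (N + `|y0|).
  rewrite /Phi normrM; apply: ler_pM => //.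
    by apply: le_trans (ler_normB _ _) _; rewrite lerD2r.
  by apply: le_trans (ler_normB _ _) _; rewrite lerD2r.
rewrite PhiE; have := normr_ge0 x0; have := normr_ge0 y0; rewrite /C.
move: (`|x0|) (`|y0|) => r1 r2 r10 r20 h; have := N_ge0 => N0.
have : (N + r1) * (N + r2) < (N + r1 + r2 + 1) * (N + r1 + r2 + 1) by apply: ltr_pM; lra.
by lra.
Qed.

Definition translation (u v : R) := transf G (tr u v).

Lemma translationD u v u' v' : translation u v -> translation u' v' -> translation (u + u') (v + v').
Proof.
move=> t t'; rewrite /translation; have -> : tr (u + u') (v + v') = tr u v \o tr u' v'.
  by apply/funext => x; rewrite /tr /= !vec3E; congr vec3; lra.
exact: transf_comp.
Qed.

Lemma translationN u v : translation u v -> translation (- u) (- v).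
Proof.
move=> t; apply: (trans_of_eq (transf_id G) t) => x.
by rewrite /tr !vec3E !addrK vec3_eta.
Qed.

Lemma translation_mu u v : translation u v -> translation (mu * u) (nu * v).
Proof.
move=> t; apply: (trans_of_eq (transf_comp G0 t) G0) => x.
by rewrite /diag /tr /= !vec3E -/mu -/nu; congr vec3; lra.
Qed.

Lemma translation_nu u v : translation u v -> translation (nu * u) (mu * v).
Proof.
move=> t; have [k Gk [gk kg]] := transf_inv G0.
rewrite /translation; have -> : tr (nu * u) (mu * v) = k \o (tr u v \o diag x0 y0 c).
  apply/funext => x; rewrite -[LHS]gk /=; congr k.
  rewrite /diag /tr /= !vec3E -/mu -/nu.
  have m1 := congr1 (fun w => w * u) munu; have m2 := congr1 (fun w => w * v) munu.
  by move: m1 m2 => /= m1 m2; congr vec3; lra.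
by apply: transf_comp => //; exact: transf_comp.
Qed.

Lemma translation0 : translation 0 0.
Proof.
rewrite /translation; have -> : tr 0 0 = id; last exact: transf_id.
by apply/funext => x; rewrite /tr !addr0 vec3_eta.
Qed.

Lemma translationZ u v (m : int) : translation u v -> translation (m%:~R * u) (m%:~R * v).
Proof.
move=> t; have pos (k : nat) : translation (k%:R * u) (k%:R * v).
  elim: k => [|k IH]; first by rewrite !mul0r; exact: translation0.
  by rewrite -natr1 !mulrDl !mul1r; exact: translationD.
case: m => k; first by rewrite -!pmulrn.
by rewrite NegzE !mulrNz !mulNr; apply: translationN; rewrite -!pmulrn.
Qed.

Lemma translation_mun u v k : translation u v -> translation (mu ^+ k * u) (nu ^+ k * v).
Proof.
move=> t; elim: k => [|k IH]; first by rewrite !mul1r.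
by rewrite !exprS -!mulrA; exact: translation_mu.
Qed.

Lemma translation_discrete (C : R) :
  finite_set [set uv : R * R | [/\ translation uv.1 uv.2, `|uv.1| <= C & `|uv.2| <= C]].
Proof.
have fin := Gpd (@compact_ball R `|C|).
pose f (g : Sol R -> Sol R) : R * R := (g 0 0 i1, g 0 0 i2).
apply: sub_finite_set (finite_image f fin) => -[u v] /= [t uC vC].
exists (tr u v); last by rewrite /f /tr !vec3E !mxE !add0r.
split=> //; exists (tr u v 0); split; first by exists 0 => //=; rewrite normr0.
apply: norm_le_coord => // i; have C0 : C <= `|C| by exact: ler_norm.
move: i; apply: I3P; rewrite /tr !vec3E !mxE ?add0r ?normr0//.
  exact: le_trans C0.
exact: le_trans C0.
Qed.

(** If one coordinate vanishes, conjugation by powers of [diag] or of its inverse contracts the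
    other one to 0 through distinct values, against discreteness. *)
Lemma translation_neq0 u v : translation u v -> u != 0 \/ v != 0 -> u != 0 /\ v != 0.
Proof.
have half u' v' (T : nat -> R * R) : (forall k, translation (T k).1 (T k).2) ->
    (forall k, `|(T k).1| <= u' /\ `|(T k).2| <= v') -> exists i j, (i < j)%N /\ T i = T j.
  move=> tT bT; apply: (sequence_pigeonhole (translation_discrete (Num.max u' v'))) => k.
  have [b1 b2] := bT k; split=> //; first by apply: le_trans b1 _; rewrite le_max lexx.
  by apply: le_trans b2 _; rewrite le_max lexx orbT.
have nuk (k : nat) (w : R) : `|nu ^+ k * w| <= `|w|.
  have h0 : 0 <= nu ^+ k by exact/exprn_ge0/ltW.
  have h1 : nu ^+ k <= 1 by apply: exprn_ile1; exact: ltW.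
  by rewrite normrM (ger0_norm h0) ler_piMl.
have inj i j w : (i < j)%N -> nu ^+ i * w = nu ^+ j * w -> w = 0.
  move=> ij e; apply: contrapT => /eqP w0.
  have [k kE] : exists k, j = (i + k.+1)%N by exists (j - i).-1; lia.
  have ni : nu ^+ i != 0 by rewrite expf_neq0// gt_eqF.
  have /(mulIf w0) := e; rewrite kE exprD -[LHS]mulr1 => /(mulfI ni)/eqP.
  rewrite gt_eqF// exprS (le_lt_trans _ nu1)// ler_piMr//; first exact: ltW.
  by apply: exprn_ile1; exact: ltW.
move=> t uv; split; apply/eqP => z.
- have v0 : v != 0 by case: uv => //; rewrite z eqxx.
  have [||i [j [ij /(congr1 snd)/= e]]] := half 0 `|v| (fun k => (0, nu ^+ k * v)).
  + by move=> k /=; have := translation_mun k t; rewrite z mulr0.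
  + by move=> k /=; rewrite normr0.
  + by move: v0; rewrite (inj _ _ _ ij e) eqxx.
- have u0 : u != 0 by case: uv => //; rewrite z eqxx.
  have tk k : translation (nu ^+ k * u) 0.
    elim: k => [|k IH]; first by rewrite mul1r -z.
    by rewrite exprS -mulrA -(mulr0 mu); exact: translation_nu.
  have [||i [j [ij /(congr1 fst)/= e]]] := half `|u| 0 (fun k => (nu ^+ k * u, 0)).
  + exact: tk.
  + by move=> k /=; rewrite normr0.
  + by move: u0; rewrite (inj _ _ _ ij e) eqxx.
Qed.

(** Solve [u = a + b mu], [v = a + b nu] over the reals and take floors; the fractional parts lie in
    [[0, 1]] and [nu <= mu]. *)
Lemma lattice_reduce (u v : R) : exists A B : int,
  `|u - (A%:~R + B%:~R * mu)| <= 1 + mu /\ `|v - (A%:~R + B%:~R * nu)| <= 1 + mu.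
Proof.
have mn : 0 < mu - nu by move: mu1 nu1; lra.
pose b := (u - v) / (mu - nu); pose a := u - b * mu.
have vE : v = a + b * nu.
  have e : b * (mu - nu) = u - v by rewrite /b divfK// gt_eqF.
  by rewrite /a; lra.
exists (Num.floor a), (Num.floor b).
have /andP[a1 a2] := floor_itv a; have /andP[b1 b2] := floor_itv b.
rewrite rmorphD /= in a2; rewrite rmorphD /= in b2.
have fa0 : 0 <= a - (Num.floor a)%:~R by lra.
have fa1 : a - (Num.floor a)%:~R <= 1 by lra.
have fb0 : 0 <= b - (Num.floor b)%:~R by lra.
have fb1 : b - (Num.floor b)%:~R <= 1 by lra.
have -> : u - ((Num.floor a)%:~R + (Num.floor b)%:~R * mu) =
  (a - (Num.floor a)%:~R) + (b - (Num.floor b)%:~R) * mu by rewrite /a; lra.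
have -> : v - ((Num.floor a)%:~R + (Num.floor b)%:~R * nu) =
  (a - (Num.floor a)%:~R) + (b - (Num.floor b)%:~R) * nu by rewrite {1}vE; lra.
move: (a - _) (b - _) fa0 fa1 fb0 fb1 => x y x00 x01 y00 y01.
have := mu1; have := nu1; have := nu0 => n0' n1' m1'.
have p1 : 0 <= y * mu by apply: mulr_ge0 => //; lra.
have p2 : 0 <= y * nu by apply: mulr_ge0 => //; lra.
have p3 : 0 <= (1 - y) * mu by apply: mulr_ge0; lra.
have p4 : 0 <= (1 - y) * nu by apply: mulr_ge0; lra.
by split; rewrite ger0_norm; lra.
Qed.

Variables (p q : R).
Hypotheses (p0 : p != 0) (q0 : q != 0) (tpq : translation p q).

Lemma translation_lattice (A B : int) :
  translation (p * (A%:~R + B%:~R * mu)) (q * (A%:~R + B%:~R * nu)).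
Proof.
have -> : p * (A%:~R + B%:~R * mu) = A%:~R * p + B%:~R * (mu * p) by lra.
have -> : q * (A%:~R + B%:~R * nu) = A%:~R * q + B%:~R * (nu * q) by lra.
apply: translationD; apply: translationZ => //; exact: translation_mu.
Qed.

(** Subtracting lattice vectors spanned by [w] and its image under [g] leaves translations of
    bounded size. Two of these remainders coincide. *)
Lemma lattice_pigeonhole (u v : nat -> R) : (forall k, translation (p * u k) (q * v k)) ->
  exists i j (A B : int), [/\ (i < j)%N, u j - u i = A%:~R + B%:~R * mu & v j - v i = A%:~R + B%:~R * nu].
Proof.
move=> tuv; pose C := (`|p| + `|q|) * (1 + mu).
have mu10 : 0 <= 1 + mu by move: mu1; lra.
have red k : {AB : int * int | `|u k - (AB.1%:~R + AB.2%:~R * mu)| <= 1 + mu /\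
    `|v k - (AB.1%:~R + AB.2%:~R * nu)| <= 1 + mu}.
  by apply: cid; have [A [B h]] := lattice_reduce (u k) (v k); exists (A, B).
pose AB k := projT1 (red k).
pose f k := (p * (u k - ((AB k).1%:~R + (AB k).2%:~R * mu)), q * (v k - ((AB k).1%:~R + (AB k).2%:~R *
  nu))).
have [|i [j [ij]]] := @sequence_pigeonhole _ _ f (translation_discrete C).
  move=> k; rewrite /f /AB; case: (red k) => -[A B] /= [h1 h2]; split.
  - rewrite !mulrBr; apply: translationD => //; apply: translationN; exact: translation_lattice.
  - by rewrite normrM /C; apply: ler_pM => //; rewrite lerDl.
  - by rewrite normrM /C; apply: ler_pM => //; rewrite lerDr.
move=> [/(mulfI p0) e1 /(mulfI q0) e2].
exists i, j, ((AB j).1 - (AB i).1), ((AB j).2 - (AB i).2); split=> //.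
  by rewrite !rmorphB /=; lra.
by rewrite !rmorphB /=; lra.
Qed.

Lemma trace_int : exists t : int, mu + nu = t%:~R.
Proof.
(* Pigeonhole on the integer multiples of [mu ^+ 2] gives [(j - i) mu^2 = A + B mu] and the same
   relation for [nu]. Subtracting and dividing by [mu - nu] yields [(j - i) (mu + nu) = B]. *)
have [r rE] : exists r : rat, mu + nu = ratr r.
  have tk k : translation (p * (k%:R * mu ^+ 2)) (q * (k%:R * nu ^+ 2)).
    have -> : p * (k%:R * mu ^+ 2) = k%:~R * (mu ^+ 2 * p) by rewrite -pmulrn; lra.
    have -> : q * (k%:R * nu ^+ 2) = k%:~R * (nu ^+ 2 * q) by rewrite -pmulrn; lra.
    by apply: translationZ; exact: translation_mun.
  have [i [j [A [B [ij e1 e2]]]]] := lattice_pigeonhole tk.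
  exists (B%:~R / (j%:R - i%:R)).
  rewrite rmorphM fmorphV rmorphB /= !rmorph_nat ratr_int.
  have ji : (j%:R - i%:R : R) != 0 by rewrite subr_eq0 eqr_nat gtn_eqF.
  apply: (mulIf ji); rewrite divfK//.
  have mn : mu - nu != 0 by rewrite gt_eqF//; move: mu1 nu1; lra.
  by apply: (mulIf mn); move: e1 e2; rewrite !expr2; lra.
(* Pigeonhole on the powers now makes [mu] and [nu] algebraic integers. Exponents start at 2 so that
   the leading term stays above [B * x]. *)
have integ (x y : R) (i j : nat) (A B : int) : (i < j)%N ->
    x ^+ j.+2 - x ^+ i.+2 = A%:~R + B%:~R * x -> integralOver (intr : int -> R) x.
  move=> ij e; pose P : {poly int} := 'X^(j.+2) - ('X^(i.+2) + (B *: 'X + A%:P)).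
  have sz : (size ('X^(i.+2) + (B *: 'X + A%:P) : {poly int})%R < j.+3)%N.
    apply: leq_ltn_trans (size_polyD _ _) _; rewrite gtn_max; apply/andP; split.
      by rewrite size_polyXn !ltnS.
    apply: leq_ltn_trans (size_polyD _ _) _; rewrite gtn_max; apply/andP; split.
      by apply: leq_ltn_trans (size_scale_leq _ _) _; rewrite size_polyX.
    exact: leq_ltn_trans (size_polyC_leq1 _) _.
  exists P; first by rewrite monicE lead_coefDl ?lead_coefXn// size_polyXn size_polyN.
  apply/rootP; rewrite /P !(rmorphB, rmorphD) /= !map_polyXn map_polyZ map_polyX map_polyC /=.
  by rewrite !hornerE /=; lra.
have tk k : translation (p * mu ^+ k.+2) (q * nu ^+ k.+2).
  by rewrite [p * _]mulrC [q * _]mulrC; exact: translation_mun.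
have [i [j [A [B [ij e1 e2]]]]] := lattice_pigeonhole tk.
have [m mE] : exists m : int, r = m%:~R.
  apply: (@integral_rat R); rewrite -rE.
  by apply: integral_add; [exact: integ ij e1|exact: integ ij e2].
by exists m; rewrite rE mE ratr_int.
Qed.

End CocompactGroup.

(** * The quadratic field of [mu] *)

Section Discriminant.
Variables (R : realType) (mu nu : R) (t : int).
Hypotheses (mu1 : 1 < mu) (munu : mu * nu = 1) (tE : mu + nu = t%:~R).

Lemma squarefree_part (d : nat) : (0 < d)%N -> exists n s : nat, d = (n * s ^ 2)%N /\ squarefree n.
Proof.
elim/ltn_ind: d => d IH d0.
have [[k [k1 /dvdnP[e dE]]]|sf] := pselect (exists k, (1 < k)%N /\ (k ^ 2 %| d)%N).
  have e0 : (0 < e)%N by move: d0; rewrite dE muln_gt0 => /andP[].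
  have [|n [s [eE sfn]]] := IH e _ e0; first by rewrite dE -[X in (X < _)%N]muln1 ltn_pmul2l// -(exp1n 2)
    ltn_exp2r.
  by exists n, (s * k)%N; split=> //; rewrite dE eE expnMn mulnA.
exists d, 1%N; split; first by rewrite muln1.
move=> k kd; apply/eqP; rewrite eqn_leq; apply/andP; split.
  by rewrite leqNgt; apply/negP => k1; apply: sf; exists k.
by case: k kd => //; rewrite dvd0n => /eqP d00; move: d0; rewrite d00.
Qed.

(** [mu] and [nu] are the roots of [X^2 - t X + 1], and [n] is the squarefree part of its
    discriminant, so that [mu - nu] is a multiple of [sqrt n] by a natural number. *)
Lemma quadratic_unit : exists n : nat, [/\ (2 <= n)%N, squarefree n, quad_unit n mu & conjq n mu = nu].
Proof.
have nu0 : 0 < nu by rewrite -(pmulr_rgt0 nu (lt_trans ltr01 mu1)) munu.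
have nu1 : nu < 1 by rewrite -munu ltr_pMl.
have tgt2 : 2 < t.
  rewrite -(ltr_int R) -tE; have : 0 < (mu - 1) * (1 - nu) by rewrite mulr_gt0// subr_gt0.
  by move: munu; lra.
have [T TE] : exists T : nat, t = T%:Z by exists `|t|%N; lia.
have T3 : (2 < T)%N by lia.
have d0 : (0 < T ^ 2 - 4)%N by nia.
have [n [s [dE sfn]]] := squarefree_part d0.
have s0 : (0 < s)%N by case: s dE d0 => // ->; rewrite muln0.
have n2 : (2 <= n)%N.
  (* With [n = 1], [T ^ 2 = s ^ 2 + 4] and [s < T] would force [2 s + 1 <= 4]; neither remaining
     value of [s] works. *)
  case: n dE sfn => [|[|n]] dE sfn //; first by move: d0; rewrite dE.
  have e : (T * T = s * s + 4)%N by move: dE d0; rewrite mul1n !expnS !expn0 !muln1; lia.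
  have sT : (s < T)%N by nia.
  have : (s.+1 * s.+1 <= T * T)%N by exact: leq_mul.
  have : (s.+1 * s.+1 != s * s + 4)%N by apply/eqP; lia.
  have : (s < 2)%N by nia.
  by case: s e sT {dE s0} => [|[|s]] // e sT; nia.
exists n; have sq : (mu - nu) ^+ 2 = n%:R * s%:R ^+ 2.
  have -> : (n%:R * s%:R ^+ 2 : R) = (T ^ 2 - 4)%N%:R by rewrite dE natrM natrX.
  rewrite natrB ?natrX; last by move: d0; rewrite subn_gt0 => /ltnW.
  by have := congr1 (fun x => x ^+ 2) tE; rewrite TE -pmulrn /= !expr2; move: munu; lra.
have sqE : mu - nu = Num.sqrt n%:R * s%:R.
  have h : 0 <= mu - nu by move: mu1; lra.
  have h' : 0 <= Num.sqrt n%:R * s%:R :> R by rewrite mulr_ge0// sqrtr_ge0.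
  by apply/eqP; rewrite -(@eqrXn2 _ 2)// sq exprMn sqr_sqrtr.
have two : (2 : R) != 0 by rewrite pnatr_eq0.
have muE : mu = ratr (t%:~R / 2) + ratr (s%:R / 2) * Num.sqrt n%:R.
  by rewrite !rmorphM !fmorphV /= ratr_int !rmorph_nat -tE; lra.
have integ (x : R) : x * x = t%:~R * x - 1 -> integralOver (intr : int -> R) x.
  move=> xE; pose P : {poly int} := 'X^2 - (t *: 'X - 1).
  have sz : (size (t *: 'X - 1 : {poly int})%R < 3)%N.
    apply: leq_ltn_trans (size_polyD _ _) _; rewrite gtn_max; apply/andP; split.
      by rewrite ltnS (leq_trans (size_scale_leq _ _))// size_polyX.
    by rewrite size_polyN size_poly1.
  exists P; first by rewrite monicE lead_coefDl ?lead_coefXn// size_polyXn size_polyN.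
  apply/rootP; rewrite /P !rmorphB /= map_polyXn map_polyZ map_polyX rmorph1 /=.
  by rewrite !hornerE /= expr2 xE subrr.
have muI : quad_int n mu.
  by split; [exists (t%:~R / 2), (s%:R / 2)|apply: integ; rewrite -tE; move: munu; lra].
have nuE : conjq n mu = nu.
  by rewrite muE conjqE// !rmorphM !fmorphV /= ratr_int !rmorph_nat -tE; lra.
have nuI : quad_int n nu.
  split; last by apply: integ; rewrite -tE; move: munu; lra.
  exists (t%:~R / 2), (- (s%:R / 2)).
  by rewrite rmorphN !rmorphM !fmorphV /= ratr_int !rmorph_nat -tE; lra.
by split=> //; split=> //; exists nu.
Qed.

End Discriminant.

(** * Commensurability *)

Lemma expR_int (R : realType) (c : R) (m : int) : expR c ^ m = expR (m%:~R * c).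
Proof.
case: m => k; first by rewrite -exprnP -pmulrn expRM_natl.
by rewrite NegzE -invr_expz -exprnP mulrNz mulNr expRN -pmulrn expRM_natl.
Qed.

Section CommonSubgroup.
Variables (R : realType) (G : transf_group (Sol R)).
Hypothesis Giso : forall g, transf G g -> sol_isometry g.
Hypotheses (Gfree : acts_freely G) (Gpd : acts_properly_discontinuously G).
Variables (x0 y0 c p q : R).
Hypotheses (c0 : 0 < c) (G0 : transf G (diag x0 y0 c)).
Hypotheses (p0 : p != 0) (q0 : q != 0) (tpq : translation G p q).
Variables (n j : nat) (t : int).
Notation mu := (expR c).
Notation nu := (expR (- c)).
Notation eps := (fund_unit R n).
Notation E := (eps ^+ 2).
Notation conj := (@conjq R n).
Hypotheses (n2 : (2 <= n)%N) (sfn : squarefree n) (umu : quad_unit n mu) (cmu : conj mu = nu).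
Hypotheses (ueps : quad_unit n eps) (muj : mu = eps ^+ j) (tE : mu + nu = t%:~R).
Notation X := (cusp_space R).
Notation iota := (set_val : X -> 'rV[R]_3).

Let munu : mu * nu = 1. Proof. by rewrite -expRD subrr expR0. Qed.

Let Ej : E ^ j = expR (2 * c).
Proof. by rewrite -exprnP -exprM mulnC exprM -muj expr2 -expRD; congr expR; lra. Qed.

Let Ejm (m : int) : E ^ (j%:Z * m) = expR (m%:~R * (2 * c)).
Proof. by rewrite -exprz_exp Ej expR_int. Qed.

Definition sol_to_cusp_subproof (x : Sol R) :
  vec3 ((x 0 i1 - x0) / p) ((x 0 i2 - y0) / q) (expR (2 * x 0 i3)) \in @upper R.
Proof. by apply/mem_set; rewrite /upper /= vec3E expR_gt0. Qed.

(** The horizontal part puts the axis of [g] at the origin and turns the translation [(p, q)] into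
    [(1, 1)], the image of [1] under the two embeddings of [K]. *)
Definition sol_to_cusp (x : Sol R) : X := exist (fun v => v \in @upper R) _ (sol_to_cusp_subproof x).

Definition cusp_to_sol (y : X) : Sol R :=
  vec3 (x0 + p * iota y 0 i1) (y0 + q * iota y 0 i2) (ln (iota y 0 i3) / 2).

Lemma sol_to_cuspE x : iota (sol_to_cusp x) =
  vec3 ((x 0 i1 - x0) / p) ((x 0 i2 - y0) / q) (expR (2 * x 0 i3)).
Proof. by []. Qed.

Lemma sol_to_cuspK : cancel sol_to_cusp cusp_to_sol.
Proof.
move=> x; rewrite /cusp_to_sol (sol_to_cuspE x) !vec3E expRK.
rewrite (mulrC p) (mulrC q) !divfK// -[RHS]vec3_eta; congr vec3; lra.
Qed.

Lemma cusp_to_solK : cancel cusp_to_sol sol_to_cusp.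
Proof.
move=> y; apply: val_inj; rewrite -set_valE sol_to_cuspE /cusp_to_sol !vec3E -[RHS]vec3_eta.
congr vec3.
- by rewrite addrC addKr mulrC mulKf.
- by rewrite addrC addKr mulrC mulKf.
- by rewrite mulrC divfK// lnK// posrE upper_gt0.
Qed.

Lemma sol_to_cusp_smooth : smooth sol_to_cusp.
Proof.
apply: (smooth_one_chart (Sol_one_chart R) (cusp_space_one_chart R)
  (t := fun x : 'rV[R]_3 => vec3 ((x 0 i1 - x0) / p) ((x 0 i2 - y0) / q) (expR (2 * x 0 i3)))) => //.
have oU : open (range (@id (Sol R))) by rewrite image_id; exact: openT.
move=> k; apply: class_C_rV => // l.
have cl i : class_C k (range id) (fun x : 'rV[R]_3 => x 0 i).
  by apply: class_C_coord => //; exact: class_C_id.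
have aff i d e : class_C k (range id) (fun x : 'rV[R]_3 => (x 0 i - d) / e).
  apply: (class_CM oU); last exact: class_C_cst.
  by apply: (class_CD oU) => //; exact: class_C_cst.
move: l; apply: I3P.
- by apply: class_C_eqon (aff i1 x0 p) => // x _; rewrite vec3E.
- by apply: class_C_eqon (aff i2 y0 q) => // x _; rewrite vec3E.
- apply: class_C_eqon (class_C_expR oU (class_CM_cst 2 oU (cl i3))) => // x _.
  by rewrite vec3E.
Qed.

Lemma cusp_to_sol_smooth : smooth cusp_to_sol.
Proof.
have X1 := cusp_space_one_chart R.
apply: (smooth_one_chart X1 (Sol_one_chart R)
  (t := fun y : 'rV[R]_3 => vec3 (x0 + p * y 0 i1) (y0 + q * y 0 i2) (ln (y 0 i3) / 2))) => //.
have oU : open (range iota) by rewrite range_iota; exact: upper_open.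
move=> k; apply: class_C_rV => // l.
have cl i : class_C k (range iota) (fun x : 'rV[R]_3 => x 0 i).
  by apply: class_C_coord => //; exact: class_C_id.
have aff i d e : class_C k (range iota) (fun x : 'rV[R]_3 => d + e * x 0 i).
  by apply: (class_CD oU); [exact: class_C_cst|exact: class_CM_cst].
move: l; apply: I3P.
- by apply: class_C_eqon (aff i1 x0 p) => // x _; rewrite vec3E.
- by apply: class_C_eqon (aff i2 y0 q) => // x _; rewrite vec3E.
- have pos (x : 'rV[R]_3) : range iota x -> 0 < x 0 i3 by rewrite range_iota.
  have cln : class_C k (range iota) (fun x : 'rV[R]_3 => ln (x 0 i3) / 2).
    by apply: (class_CM oU (class_C_ln oU pos (cl i3))); exact: class_C_cst.
  by apply: class_C_eqon cln => // x _; rewrite vec3E.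
Qed.

Definition lat (z : R) := exists a b : int, z = a%:~R + b%:~R * mu.

Lemma latD z w : lat z -> lat w -> lat (z + w).
Proof. by move=> [a [b ->]] [a' [b' ->]]; exists (a + a'), (b + b'); rewrite !rmorphD /=; lra. Qed.

Lemma latN z : lat z -> lat (- z).
Proof. by move=> [a [b ->]]; exists (- a), (- b); rewrite !rmorphN /=; lra. Qed.

Lemma lat_mu z : lat z -> lat (mu * z).
Proof.
move=> [a [b ->]]; exists (- b), (a + b * t).
rewrite rmorphN rmorphD rmorphM /= -tE.
by have := congr1 (fun w => b%:~R * w) munu; rewrite /=; lra.
Qed.

Lemma lat_nu z : lat z -> lat (nu * z).
Proof.
move=> lz; have -> : nu * z = t%:~R * z - mu * z by rewrite -tE; lra.
apply: latD; last by apply: latN; exact: lat_mu.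
by move: lz => [a [b ->]]; exists (t * a), (t * b); rewrite !rmorphM /=; lra.
Qed.

Lemma lat_pow (m : int) z : lat z -> lat (E ^ (j%:Z * m) * z).
Proof.
move=> lz; rewrite Ejm.
have pos d (k : nat) : (forall w, lat w -> lat (expR d * w)) -> lat (expR (k%:R * (2 * d)) * z).
  move=> ld; elim: k => [|k IH]; first by rewrite mul0r expR0 mul1r.
  have -> : k.+1%:R * (2 * d) = d + (d + k%:R * (2 * d)) by rewrite -natr1; lra.
  by rewrite !expRD -!mulrA; exact/ld/ld/IH.
case: m => k; first by rewrite -pmulrn; exact: pos lat_mu.
have -> : (Negz k)%:~R * (2 * c) = k.+1%:R * (2 * (- c)).
  by rewrite NegzE mulrNz -pmulrn; lra.
exact: pos lat_nu.
Qed.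

Lemma lat_quad z : lat z -> quad_int n z.
Proof.
move=> [a [b ->]]; apply: quad_intD; first exact: (quad_int_int R n2 sfn).
by apply: quad_intM; [exact: (quad_int_int R n2 sfn)|case: umu].
Qed.

Lemma conj_lat (a b : int) : conj (a%:~R + b%:~R * mu) = a%:~R + b%:~R * nu.
Proof.
have Kmu : quad_field n mu by apply: quad_int_field; case: umu.
rewrite conjqD// ?conjqM// ?conjq_int// ?cmu//; try exact: quad_field_int.
by apply: quad_fieldM => //; exact: quad_field_int.
Qed.

Definition common_set : set (X -> X) := [set h | exists z (m : int), lat z /\ h = celem n z (j%:Z * m)].

Lemma lat0 : lat 0. Proof. by exists 0, 0; rewrite mul0r addr0. Qed.

Lemma common_id : common_set id.
Proof. by exists 0, 0; split; [exact: lat0|rewrite mulr0; exact: celem_id]. Qed.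

Lemma common_comp f g : common_set f -> common_set g -> common_set (f \o g).
Proof.
move=> [z [m [lz ->]]] [w [k [lw ->]]]; exists (z + E ^ (j%:Z * m) * w), (m + k); split.
  by apply: latD => //; exact: lat_pow.
by rewrite celem_comp ?mulrDr//; exact: lat_quad.
Qed.

Lemma common_inv f : common_set f -> exists2 g, common_set g & cancel f g /\ cancel g f.
Proof.
move=> [z [m [lz ->]]]; have [h1 h2] := celem_inv n2 sfn ueps (j%:Z * m) (lat_quad lz).
exists (celem n (- (E ^ (- (j%:Z * m)) * z)) (- (j%:Z * m))).
  exists (- (E ^ (- (j%:Z * m)) * z)), (- m); rewrite mulrN; split=> //.
  by apply: latN; rewrite -mulrN; exact: lat_pow.
by split=> y; [exact: (congr1 (fun f => f y) h1)|exact: (congr1 (fun f => f y) h2)].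
Qed.

Definition common_group : transf_group X := TransfGroup common_id common_comp common_inv.

Lemma common_cusp : transf common_group `<=` transf (cusp_group R n).
Proof.
move=> h [z [m [lz ->]]]; apply/cusp_groupP => //.
by exists z, (j%:Z * m); split=> //; exact: lat_quad.
Qed.

Definition common_sol_group : transf_group (Sol R) := conj_group cusp_to_solK sol_to_cuspK common_group.

(** Checked on generators: translations by [lat] come from [translation_lattice], and [celem n 0 j]
    becomes the square of [diag]. *)
Lemma common_sol : transf common_sol_group `<=` transf G.
Proof.
pose A (h : X -> X) := transf G (cusp_to_sol \o h \o sol_to_cusp).
have Acomp h h' : A h -> A h' -> A (h \o h').
  move=> Ah Ah'; rewrite /A; have -> : cusp_to_sol \o (h \o h') \o sol_to_cusp =
    (cusp_to_sol \o h \o sol_to_cusp) \o (cusp_to_sol \o h' \o sol_to_cusp).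
    by apply/funext => x /=; rewrite cusp_to_solK.
  exact: transf_comp.
have Ainv h h' : h \o h' = id -> A h -> A h'.
  move=> hh' Ah; have [k Gk [kh hk]] := transf_inv Ah.
  rewrite /A; have -> : cusp_to_sol \o h' \o sol_to_cusp = k.
    apply/funext => x; rewrite -[LHS]kh /= cusp_to_solK.
    by rewrite -[h (h' _)]/((h \o h') _) hh' /= sol_to_cuspK.
  exact: Gk.
have Atr z : lat z -> A (celem n z 0).
  move=> [a [b ->]]; rewrite /A.
  have -> : cusp_to_sol \o celem n (a%:~R + b%:~R * mu) 0 \o sol_to_cusp =
      tr (p * (a%:~R + b%:~R * mu)) (q * (a%:~R + b%:~R * nu)).
    apply/funext => x; rewrite /= /cusp_to_sol celemE sol_to_cuspE conj_lat oppr0 expr0z !mul1r !vec3E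
      expRK.
    rewrite /tr !mulrDr !(mulrC p (_ / p)) !(mulrC q (_ / q)) !divfK//.
    congr vec3; lra.
  exact: (translation_lattice G0 tpq a b).
have Ad : A (celem n 0 j).
  rewrite /A; have -> : cusp_to_sol \o celem n 0 j \o sol_to_cusp = diag x0 y0 c \o diag x0 y0 c.
    have EjN : E ^ (- (j%:Z)) = nu * nu.
      by rewrite -invr_expz Ej -expRN -expRD; congr expR; lra.
    have Ejmu : E ^ j = mu * mu by rewrite Ej -expRD; congr expR; lra.
    apply/funext => x; rewrite /= /cusp_to_sol celemE sol_to_cuspE /diag !vec3E EjN conj0// !addr0.
    have -> : E ^ j * E ^ j * expR (2 * x 0 i3) = expR (2 * (x 0 i3 + c + c)).
      by rewrite Ej -!expRD; congr expR; lra.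
    have sub u v : u + v - u = v :> R by lra.
    rewrite expRK Ejmu !sub.
    have e1 : p * (mu * mu * ((x 0 i1 - x0) / p)) = mu * mu * (x 0 i1 - x0) by rewrite mulrCA (mulrC p)
      divfK.
    have e2 : q * (nu * nu * ((x 0 i2 - y0) / q)) = nu * nu * (x 0 i2 - y0) by rewrite mulrCA (mulrC q)
      divfK.
    by rewrite e1 e2; congr vec3; lra.
  exact: transf_comp.
have i0 : quad_int n (0 : R) by exact: (quad_int_int R n2 sfn 0).
have Apos (k : nat) : A (celem n 0 (j%:Z * k)).
  elim: k => [|k IH]; first by rewrite mulr0; apply: Atr; exact: lat0.
  have -> : celem n (0 : R) (j%:Z * k.+1) = celem n 0 j \o celem n 0 (j%:Z * k).
    by rewrite celem_comp// mulr0 addr0 intS mulrDr mulr1.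
  exact: Acomp.
move=> _ [h [z [m [lz ->]]] ->].
have -> : celem n z (j%:Z * m) = celem n z 0 \o celem n 0 (j%:Z * m).
  by rewrite celem_comp ?mulr0 ?addr0 ?add0r//; exact: lat_quad.
apply: Acomp; first exact: Atr.
case: m => k; first exact: Apos.
have [_ h2] := celem_inv n2 sfn ueps (j%:Z * k.+1) i0.
by rewrite NegzE mulrN; apply: Ainv (Apos k.+1); rewrite mulr0 oppr0 in h2.
Qed.

(** One bounded set serves both covers, since the group acts on the two spaces through the same
    change of coordinates. *)
Lemma common_cocompact : exists N : R, forall x : Sol R, exists2 h, transf common_group h &
  `|(cusp_to_sol (h (sol_to_cusp x)) : 'rV[R]_3)| <= N.
Proof.
have mu0 : 0 < mu by exact: expR_gt0.
exists (`|x0| + `|y0| + (`|p| + `|q|) * (1 + mu) + 2 * c) => x.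
(* The generator [celem n 0 j] raises the height by [2 * c], so the [m]-th power brings it into
   [[0, 2 c]]. *)
pose m := - Num.floor (x 0 i3 / (2 * c)).
have [A [B [hA hB]]] := lattice_reduce c0
  (expR (m%:~R * (2 * c)) * ((x 0 i1 - x0) / p)) (expR (- (m%:~R * (2 * c))) * ((x 0 i2 - y0) / q)).
have l : lat (- (A%:~R + B%:~R * mu)) by apply: latN; exists A, B.
exists (celem n (- (A%:~R + B%:~R * mu)) (j%:Z * m)).
  by exists (- (A%:~R + B%:~R * mu)), m.
rewrite /cusp_to_sol celemE sol_to_cuspE !vec3E.
have cN : conj (- (A%:~R + B%:~R * mu)) = - (A%:~R + B%:~R * nu).
  have e := conj_lat (- A) (- B); rewrite !rmorphN /= in e.
  have e1 : - (A%:~R + B%:~R * mu) = - A%:~R + - B%:~R * mu by lra.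
  by rewrite e1 e; lra.
rewrite cN -invr_expz Ejm -expRN.
have -> : expR (m%:~R * (2 * c)) * expR (m%:~R * (2 * c)) * expR (2 * x 0 i3) = expR (2 * (x 0 i3 + m%:~R
  * (2 * c))).
  by rewrite -!expRD; congr expR; lra.
rewrite expRK.
have C0 : 0 < 2 * c by move: c0; lra.
have pq0 : 0 <= `|p| * (1 + mu) by rewrite mulr_ge0//; lra.
have pq0' : 0 <= `|q| * (1 + mu) by rewrite mulr_ge0//; lra.
have nx := normr_ge0 x0; have ny := normr_ge0 y0.
apply: norm_le_coord; first by lra.
apply: I3P; rewrite vec3E.
- apply: le_trans (ler_normD _ _) _; rewrite normrM.
  by have := ler_wpM2l (normr_ge0 p) hA; lra.
- apply: le_trans (ler_normD _ _) _; rewrite normrM.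
  by have := ler_wpM2l (normr_ge0 q) hB; lra.
- have /andP[f1 f2] := floor_itv (x 0 i3 / (2 * c)).
  have e : x 0 i3 / (2 * c) * (2 * c) = x 0 i3 by rewrite divfK// gt_eqF.
  have g1 := ler_wpM2r (ltW C0) f1; have g2 := ler_wpM2r (ltW C0) (ltW f2).
  rewrite e in g1; rewrite e rmorphD /= in g2.
  rewrite /m rmorphN /= ger0_norm; last by lra.
  by lra.
Qed.

Lemma sol_commensurable (M : atlas_space R) : manifold M -> diffeomorphic M (quotient G) ->
  commensurable M (cusp_section R n).
Proof.
move=> mM [f [g [fg gf sf sg]]].
have S1 := Sol_one_chart R; have X1 := cusp_space_one_chart R.
have Gs h : transf G h -> smooth h by exact: isometry_smooth.
have Ds := @cusp_smooth R n; have Df := cusp_free n2 sfn ueps; have Dp := cusp_pd n2 sfn ueps.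
have Ds' h : transf (cusp_group R n) h -> smooth h by exact: cusp_smooth.
have HGs h : transf common_sol_group h -> smooth h by move=> /common_sol; exact: Gs.
have HXs h : transf common_group h -> smooth h by move=> /common_cusp; exact: Ds'.
have Hf := subgroup_free Gfree common_sol; have Hp := subgroup_pd Gpd common_sol.
have H'f := subgroup_free Df common_cusp; have H'p := subgroup_pd Dp common_cusp.
have [N coN] := common_cocompact.
have cK := @compact_ball R N.
have mH := quotient_manifold S1 HGs Hf Hp.
have mH' := quotient_manifold X1 HXs H'f H'p.
have mG := quotient_manifold S1 Gs Gfree Gpd.
exists (quotient common_sol_group), (quotient common_group),
  (g \o @subgroup_proj R (Sol R) G common_sol_group), (@subgroup_proj R X (cusp_group R n) common_group).
split=> //.
- apply: (cover_diffeo mH mG mM _ gf fg sg sf).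
  apply: (subgroup_cover S1 Gs Gfree Gpd common_sol cK) => x.
  have [h Hh hN] := coN x; exists (cusp_to_sol \o h \o sol_to_cusp) => //.
  by exists h.
- apply: (subgroup_cover X1 Ds' Df Dp common_cusp (K := sol_to_cusp @` [set x : 'rV[R]_3 | `|x| <= N])).
    apply: continuous_compact => //; apply: continuous_subspaceT => x.
    by case: sol_to_cusp_smooth => + _; apply.
  move=> y; have [h Hh hN] := coN (cusp_to_sol y); exists h => //.
  rewrite cusp_to_solK in hN.
  by exists (cusp_to_sol (h y)) => //; rewrite cusp_to_solK.
- have [F [B [FB BF sF sB]]] := conj_quotient_diffeomorphic X1 S1 (phiK := cusp_to_solK) (psiK :=
  sol_to_cuspK)
    cusp_to_sol_smooth sol_to_cusp_smooth HXs HGs H'f H'p Hf Hp.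
  by exists B, F.
Qed.

End CommonSubgroup.

Theorem corollary4p4 (R : realType) (M : atlas_space R) :
  compact_sol_manifold M ->
  exists n : nat,
    [/\ (2 <= n)%N, squarefree n,
        manifold (cusp_section R n),
        commensurable M (cusp_section R n)
      & fundamental_domain (cusp_group R n) (@region R n)].
Proof.
move=> [mM cM [G [Giso Gfree Gpd dM]]].
have cQ : compact [set: quotient G].
  have [f [g [fg gf sf sg]]] := dM.
  have -> : [set: quotient G] = f @` [set: M].
    by apply/seteqP; split=> // y _; exists (g y).
  apply: continuous_compact => //; apply: continuous_subspaceT => x.
  by case: sf => + _; apply.
have [N N0 Gco] := cocompact_bound Giso cQ.
have [x0 [y0 [c [c0 G0]]]] := exists_diag Giso Gco.
have [p [q [tpq pq]]] := exists_translation Giso Gco c0 G0.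
have [p0 q0] := translation_neq0 Gpd Gco c0 G0 tpq pq.
have [t tE] := trace_int Gpd c0 G0 p0 q0 tpq.
have mu1 : 1 < expR c by rewrite expR_gt1.
have munu : expR c * expR (- c) = 1 by rewrite -expRD subrr expR0.
have [n [n2 sfn umu cmu]] := quadratic_unit mu1 munu tE.
have [ueps _ _] := fund_unitP n2 sfn umu mu1.
have [j _ muj] := unit_power_fund_unit n2 sfn umu mu1.
exists n; split=> //.
- exact: cusp_manifold.
- exact: (sol_commensurable Giso Gfree Gpd c0 G0 p0 q0 tpq n2 sfn umu cmu ueps muj tE mM dM).
- exact: cusp_fundamental_domain.
Qed.
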